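(* Let $n\ge 3$ and let $h_1,\dots,h_{n-1}$ be arbitrary positive numbers; write $\boldsymbol h=(h_1,\dots,h_{n-1})$. Then there exists a non-degenerate $\mathbb{Z}_2$-harmonic function $f_{\boldsymbol h}$ on $\mathbb{R}^n$ (with the Euclidean metric) whose branching set is the codimension-$2$ ellipsoid $$E_{\boldsymbol h}=\Big\{x\in\mathbb{R}^n:\ \sum_{i=1}^{n-1}\frac{x_i^2}{h_i^2}=1,\ x_n=0\Big\},$$ and such that, outside a large ball, one can pick a single-valued branch of $f_{\boldsymbol h}$ on which $$f_{\boldsymbol h}=a_0-\sum_{i=1}^{n}a_i x_i^2+O(|x|^{2-n}),\qquad |x|\to\infty .$$ Here $S(y)=\prod_{i=1}^{n-1}(y+h_i^2)$ and the constants $a_i$ are $$a_i=\frac{\prod_{j=1}^{n-1}h_j}{2}\int_0^\infty\frac{du}{(u^2+h_i^2)\sqrt{S(u^2)}}\quad(1\le i\le n-1),$$ $$a_n=-\frac{\prod_{j=1}^{n-1}h_j}{2}\int_0^\infty\frac{S'(u^2)\,du}{S(u^2)^{3/2}},\qquad a_0=\frac{\prod_{j=1}^{n-1}h_j}{2}\int_0^\infty\frac{du}{\sqrt{S(u^2)}} .$$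
   Context: $\mathbb{Z}_2$-harmonic function. Let $\Sigma\subset\mathbb{R}^n$ be a compact smooth embedded oriented codimension-$2$ submanifold and let $L$ be a flat real line bundle (structure group $\{\pm1\}$) over $\mathbb{R}^n\setminus\Sigma$ such that every small loop linking $\Sigma$ has monodromy $-1$. A $\mathbb{Z}_2$-harmonic function with branching set $\Sigma$ is a section $f$ of $L$ over $\mathbb{R}^n\setminus\Sigma$ with $f,\nabla f\in L^2_{loc}(\mathbb{R}^n)$ and $\Delta f=0$ on $\mathbb{R}^n\setminus\Sigma$ (derivatives taken with respect to the flat structure of $L$). Equivalently, it is a function on the double cover of $\mathbb{R}^n$ branched along $\Sigma$ that is anti-invariant under the covering involution. Outside a large ball containing $\Sigma$ the bundle $L$ is trivial, so $f$ is represented there by an ordinary function, unique up to sign; this is called a single-valued branch. Non-degenerate. Let $N$ be the normal bundle of $\Sigma$, regarded as a complex line bundle via the co-orientation, and let $\zeta$ be the inverse of the normal exponential map from a tubular neighbourhood of $\Sigma$ to $N$. The monodromy of $L$ around $\Sigma$ defines a square root $N^{1/2}$, so for a half-integer $p$ and a section $\sigma_p$ of $N^{-p}$ over $\Sigma$ there is a (two-valued) function $\sigma_p\zeta^p$ near $\Sigma$. Every $\mathbb{Z}_2$-harmonic function satisfies $f=\mathrm{Re}(A\zeta^{1/2})+O(|\zeta|^{3/2})$ near $\Sigma$ with $A$ a section of $N^{-1/2}$, and if $A\equiv0$ then $f=\mathrm{Re}(B\zeta^{3/2})+O(|\zeta|^{5/2})$ with $B$ a section of $N^{-3/2}$. The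 function $f$ is called non-degenerate if $A\equiv 0$ and $B$ is nowhere vanishing on $\Sigma$. *)

(* Defs.v *)
From HB Require Import structures.
From mathcomp Require Import all_boot all_order all_algebra.
From mathcomp Require Import all_classical all_reals all_analysis.
From mathcomp Require Import complex.

Set Implicit Arguments.
Unset Strict Implicit.
Unset Printing Implicit Defensive.

Import Order.TTheory GRing.Theory Num.Theory.
Import numFieldNormedType.Exports.

Local Open Scope classical_set_scope.
Local Open Scope ring_scope.

(* The ambient Euclidean space is 'rV[R]_n.+1.  The norm `|x| that the library
   puts on it is the sup norm: it is used for the topology only, and Euclidean
   lengths are written enorm x. *)

Section Euclidean.
Context {R : realType} {n : nat}.
Implicit Types (u v x : 'rV[R]_n) (i : 'I_n).

Definition dot u v : R := \sum_(i < n) u 0 i * v 0 i.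
Definition enorm x : R := Num.sqrt (dot x x).
Definition basis_vec i : 'rV[R]_n := delta_mx 0 i.
End Euclidean.

Section Differentiability.
Context {R : realType} {n : nat}.
Local Notation V := 'rV[R]_n.+1.

(* f is of class C^k on U; meant for open U *)
Fixpoint class_C {W : normedModType R} (k : nat) (U : set V) (f : V -> W) : Prop :=
  match k with
  | 0 => forall x, U x -> {for x, continuous f}
  | k'.+1 => (forall x, U x -> differentiable f x) /\
             forall i, class_C k' U ('D_(basis_vec i) f)
  end.

Definition smooth_on {W : normedModType R} (U : set V) (f : V -> W) : Prop :=
  forall k, class_C k U f.

Definition grad_sq (f : V -> R) (x : V) : R :=
  \sum_i ('D_(basis_vec i) f x) ^+ 2.

Definition laplacian (f : V -> R) (x : V) : R :=
  \sum_i 'D_(basis_vec i) ('D_(basis_vec i) f) x.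
End Differentiability.

(* n-dimensional Lebesgue measure: the product R * (R * (... * unit)) of n copies
   of the Lebesgue measure on R, together with the identification of its carrier
   with 'rV[R]_n. *)
Record euclidean_measure_space (R : realType) (n : nat) := EuclideanMeasureSpace {
  ems_disp : measure_display;
  ems_type : measurableType ems_disp;
  ems_mu : {measure set ems_type -> \bar R};
  ems_vec : ems_type -> 'rV[R]_n }.

Fixpoint lebesgue_space (R : realType) (n : nat) : euclidean_measure_space R n :=
  match n with
  | 0 => @EuclideanMeasureSpace R 0 _ unit (dirac tt) (fun=> 0)
  | m.+1 =>
      let E := lebesgue_space R m in
      @EuclideanMeasureSpace R m.+1 _ (measurableTypeR R * ems_type E)%type
        (product_measure2 (@lebesgue_measure R) (ems_mu E))
        (fun p => row_mx (p.1%:M : 'rV[R]_1) (ems_vec p.2) : 'rV[R]_(1 + m))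
  end.

(* meant for F >= 0 *)
Definition locally_integrable {R : realType} {n : nat} (F : 'rV[R]_n -> R) : Prop :=
  forall K : set 'rV[R]_n, compact K ->
    (\int[ems_mu (lebesgue_space R n)]_(t in ems_vec (e:=lebesgue_space R n) @^-1` K)
        (F (ems_vec t))%:E < +oo)%E.

(* A flat real line bundle with structure group {1, -1} over the open set Omega:
   an open cover of Omega with locally constant transition functions. *)
Record flat_line_bundle (R : realType) (n : nat) (Omega : set 'rV[R]_n.+1) :=
  FlatLineBundle {
  chart : Type;
  dom : chart -> set 'rV[R]_n.+1;
  trans : chart -> chart -> 'rV[R]_n.+1 -> R;
  dom_open : forall i, open (dom i);
  dom_cover : \bigcup_i dom i = Omega;
  trans_sign : forall i j x, dom i x -> dom j x ->
    trans i j x = 1 \/ trans i j x = -1;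
  trans_loc_const : forall i j x, dom i x -> dom j x ->
    \forall y \near x, trans i j y = trans i j x;
  trans_cocycle : forall i j k x, dom i x -> dom j x -> dom k x ->
    trans i j x * trans j k x = trans i k x }.

Section FlatLineBundle.
Context {R : realType} {n : nat} {Omega : set 'rV[R]_n.+1}.
Local Notation V := 'rV[R]_n.+1.
Variable L : flat_line_bundle Omega.

(* Sections are given by their local representatives f i : dom i -> R; the values
   of f i outside dom i are irrelevant. *)
Definition is_section (f : chart L -> V -> R) : Prop :=
  forall i j x, dom i x -> dom j x -> f i x = trans i j x * f j x.

Definition harmonic_section (f : chart L -> V -> R) : Prop :=
  forall i, class_C 2 (dom i) (f i) /\
            forall x, dom i x -> laplacian (f i) x = 0.

(* |f|^2 and |grad f|^2 do not depend on the representative; 0 off Omega *)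
Definition section_sq (f : chart L -> V -> R) (x : V) : R :=
  xget 0 [set y | exists2 i, dom i x & y = (f i x) ^+ 2].
Definition section_grad_sq (f : chart L -> V -> R) (x : V) : R :=
  xget 0 [set y | exists2 i, dom i x & y = grad_sq (f i) x].

(* tau is a parallel section of length 1 of the pull-back of L by Phi : D -> Omega *)
Definition parallel_unit {T : topologicalType} (D : set T) (Phi : T -> V)
    (tau : chart L -> T -> R) : Prop :=
  [/\ forall i t, D t -> dom i (Phi t) -> tau i t = 1 \/ tau i t = -1,
      forall i t, D t -> dom i (Phi t) ->
        \forall t' \near t, D t' -> dom i (Phi t') -> tau i t' = tau i t &
      forall i j t, D t -> dom i (Phi t) -> dom j (Phi t) ->
        tau i t = trans i j (Phi t) * tau j t].

(* meant for gamma 0 = gamma 1 *)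
Definition has_monodromy (gamma : R -> V) (m : R) : Prop :=
  exists2 tau : chart L -> R -> R, parallel_unit (T := R) `[0, 1] gamma tau &
    forall i, dom i (gamma 0) -> tau i 1 = m * tau i 0.

Definition single_valued_branch (f : chart L -> V -> R) (D : set V) (F : V -> R) :
    Prop :=
  exists2 tau : chart L -> V -> R, parallel_unit D id tau &
    forall i x, D x -> dom i x -> F x = tau i x * f i x.
End FlatLineBundle.

Section Submanifold.
Context {R : realType} {n : nat}.
Local Notation V := 'rV[R]_n.+1.
Implicit Types (Sigma : set V) (J : V -> 'M[R]_n.+1).

Definition codim2_submanifold Sigma : Prop :=
  forall p, Sigma p -> exists (W : set V) (phi : V -> 'rV[R]_2),
    [/\ open W, W p, smooth_on W phi,
        Sigma `&` W = [set x | W x /\ phi x = 0] &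
        forall x, W x -> Sigma x -> \rank ('J phi x) = 2%N].

Definition tangent_vec Sigma (q v : V) : Prop :=
  exists gamma : R -> V,
    [/\ gamma 0 = q, \forall t \near (0 : R), Sigma (gamma t) &
        is_derive (0 : R) (1 : R) gamma v].

Definition normal_vec Sigma (q w : V) : Prop :=
  forall v, tangent_vec Sigma q v -> dot w v = 0.

Definition unit_normal Sigma (q e : V) : Prop := normal_vec Sigma q e /\ enorm e = 1.

(* A co-orientation is encoded by the complex structure it induces on the normal
   bundle: w *m J q is w turned by a right angle in the positive direction.  J q
   is extended by 0 to the tangent space, so that continuity makes sense. *)
Definition coorientation Sigma J : Prop :=
  {within Sigma, continuous J} /\
  forall q, Sigma q ->
    [/\ forall w, normal_vec Sigma q w -> normal_vec Sigma q (w *m J q),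
        forall w, normal_vec Sigma q w -> enorm (w *m J q) = enorm w,
        forall w, normal_vec Sigma q w -> w *m J q *m J q = - w &
        forall v, tangent_vec Sigma q v -> v *m J q = 0].

(* the normal exponential map is injective on vectors of length < eps *)
Definition tubular_radius Sigma (eps : R) : Prop :=
  0 < eps /\
  forall q q' v v', Sigma q -> Sigma q' ->
    normal_vec Sigma q v -> normal_vec Sigma q' v' ->
    enorm v < eps -> enorm v' < eps -> q + v = q' + v' -> q = q' /\ v = v'.

(* the tubular neighbourhood with Sigma removed *)
Definition punctured_tube Sigma (eps : R) : set V :=
  [set x | exists q v, [/\ Sigma q, normal_vec Sigma q v, 0 < enorm v < eps & x = q + v]].

(* the point with zeta = r e^(i theta), in the trivialization of the normal plane
   at q by the unit normal vector e *)
Definition normal_polar J (q e : V) (r theta : R) : V :=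
  q + r *: (cos theta *: e + sin theta *: (e *m J q)).

Definition linking_monodromy Sigma J (L : flat_line_bundle (~` Sigma)) : Prop :=
  exists2 eps, tubular_radius Sigma eps &
    forall q e r, Sigma q -> unit_normal Sigma q e -> 0 < r < eps ->
      has_monodromy L (fun t => normal_polar J q e r (2 * pi * t)) (-1).

Record Z2_harmonic Sigma J (L : flat_line_bundle (~` Sigma))
    (f : chart L -> V -> R) : Prop := {
  Z2_compact : compact Sigma;
  Z2_submanifold : codim2_submanifold Sigma;
  Z2_coorientation : coorientation Sigma J;
  Z2_monodromy : linking_monodromy J L;
  Z2_section : is_section f;
  Z2_L2loc : locally_integrable (section_sq f);
  Z2_grad_L2loc : locally_integrable (section_grad_sq f);
  Z2_harmonicity : harmonic_section f }.

Local Notation reC := (@complex.Re R).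
Local Notation imC := (@complex.Im R).

Definition expi (theta : R) : R[i] := Complex (cos theta) (sin theta).

(* s is the two-valued function sigma zeta^(k/2), k odd, for some section sigma of
   N^(-k/2).  Since N^(1/2) is the square root of N given by the monodromy of L,
   such a function is a section of the complexification of L over the punctured
   tube; over the universal cover of the punctured normal disc at q, in a parallel
   trivialization of L, it is c r^(k/2) e^(i k theta / 2), where c is the value of
   sigma at q. *)
Definition half_power Sigma J (L : flat_line_bundle (~` Sigma)) (eps : R) (k : nat)
    (s : chart L -> V -> R[i]) : Prop :=
  [/\ forall i j x, punctured_tube Sigma eps x -> dom i x -> dom j x ->
        s i x = Complex (trans i j x) 0 * s j x,
      forall i, {within punctured_tube Sigma eps `&` dom i, continuous (reC \o s i)} /\
                {within punctured_tube Sigma eps `&` dom i, continuous (imC \o s i)} &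
      forall q e, Sigma q -> unit_normal Sigma q e ->
        exists (tau : chart L -> R * R -> R) (c : R[i]),
          parallel_unit (T := (R * R)%type) [set z | 0 < z.1 < eps]
            (fun z => normal_polar J q e z.1 z.2) tau /\
          forall i r theta, 0 < r < eps -> dom i (normal_polar J q e r theta) ->
            Complex (tau i (r, theta)) 0 * s i (normal_polar J q e r theta) =
            c * Complex (r `^ (k%:R / 2)) 0 * expi (k%:R / 2 * theta)].

(* f = Re s + O(|zeta|^p) near Sigma *)
Definition expansion Sigma (L : flat_line_bundle (~` Sigma)) (eps : R)
    (f : chart L -> V -> R) (s : chart L -> V -> R[i]) (p : R) : Prop :=
  exists C : R, forall i q v, Sigma q -> normal_vec Sigma q v -> 0 < enorm v < eps ->
    dom i (q + v) -> `|f i (q + v) - reC (s i (q + v))| <= C * enorm v `^ p.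

(* sA and sB are the two-valued functions A zeta^(1/2) and B zeta^(3/2) *)
Definition Z2_nondegenerate Sigma J (L : flat_line_bundle (~` Sigma))
    (f : chart L -> V -> R) : Prop :=
  exists (eps : R) (sA sB : chart L -> V -> R[i]),
    [/\ tubular_radius Sigma eps,
        half_power J eps 1 sA /\ expansion eps f sA (3 / 2),
        half_power J eps 3 sB /\ expansion eps f sB (5 / 2),
        forall i x, punctured_tube Sigma eps x -> dom i x -> sA i x = 0 &
        forall i x, punctured_tube Sigma eps x -> dom i x -> sB i x != 0].
End Submanifold.

Section Ellipsoid.
Context {R : realType} {n : nat}.
Variable h : 'I_n -> R.
Local Notation V := 'rV[R]_n.+1.

Definition hcoord (x : V) (i : 'I_n) : R := x 0 (widen_ord (leqnSn n) i).
Definition lastcoord (x : V) : R := x 0 ord_max.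

Definition ellipsoid : set V :=
  [set x | \sum_(i < n) hcoord x i ^+ 2 / h i ^+ 2 = 1 /\ lastcoord x = 0].

Definition S_poly : {poly R} := \prod_(i < n) ('X + (h i ^+ 2)%:P).

Definition a_zero : R :=
  (\prod_(j < n) h j) / 2 *
  \int[lebesgue_measure]_(u in `[0, +oo[) (Num.sqrt S_poly.[u ^+ 2])^-1.

Definition a_coef (i : 'I_n) : R :=
  (\prod_(j < n) h j) / 2 *
  \int[lebesgue_measure]_(u in `[0, +oo[)
    ((u ^+ 2 + h i ^+ 2) * Num.sqrt S_poly.[u ^+ 2])^-1.

Definition a_last : R :=
  - ((\prod_(j < n) h j) / 2 *
     \int[lebesgue_measure]_(u in `[0, +oo[)
       (S_poly^`().[u ^+ 2] / S_poly.[u ^+ 2] `^ (3 / 2))).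
End Ellipsoid.

(* Main.v *)
(* With h_n = 0, the ellipsoidal equation
   sum_i x_i^2 / (h_i^2 + w^2) + x_n^2 / w^2 = 1 defines, away from the ellipsoid E,
   numbers w and z with w z = x_n and sum_(i < n) x_i^2 / (h_i^2 + w^2) + z^2 = 1.
   The pair (w, z) is determined up to a common sign; on the double cover branched
   along E both are smooth and odd.  With c = prod h_i / 2, the Newtonian potential of
   the homogeneous focal ellipsoid, integrated from 0 to w instead of from w to
   infinity, is an odd function f with gradient
   - 2 c x_i int_0^w du / ((u^2 + h_i^2) sqrt (S (u^2))) in the first coordinates,
   because the integrand of the potential vanishes at u = w; this gives
   harmonicity.  At infinity w ~ |x|, and the tails of the integrals are O(|x|^(2-n)).

   Near a point q of E, put k = (sum_i q_i^2 / h_i^4)^(1/2) and omega = k w + i z.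
   Then omega^2 = 2 k zeta + O(|zeta|^2), while
   f = w z^2 - k^2 w^3 / 3 + O(|zeta|^(5/2)) = - Re (omega^3) / (3 k) + O(|zeta|^(5/2)).
   Hence A = 0 and B = - (2 / 3) sqrt (2 k), which never vanishes. *)
Require Import Defs.
From HB Require Import structures.
From mathcomp Require Import all_boot all_order all_algebra.
From mathcomp Require Import all_classical all_reals all_analysis.
From mathcomp Require Import measurable_realfun complex ring lra.

Set Implicit Arguments.
Unset Strict Implicit.
Unset Printing Implicit Defensive.

Import Order.TTheory GRing.Theory Num.Theory.
Import numFieldNormedType.Exports.

Local Open Scope classical_set_scope.
Local Open Scope ring_scope.

(** * Primitives *)

(** The nonnegative w and z have creases along the hyperplane and degenerate on E, so they are
    obtained and shown continuous by monotonicity alone; derivatives come from Caratheodory slopes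
    of the equations w z = x_n and z^2 = [level x w], whose increments satisfy a linear system that
    stays invertible off E. Signs are settled by two charts, w > 0 off the closed disc and z > 0 off
    the exterior part of the hyperplane; on the overlap the pairs (w, z) differ by the sign of x_n,
    which becomes the transition function of the bundle. Near E the obstacle is the square root: an
    estimate of omega^2 determines omega only up to sign. But the imaginary part of omega^2 is
    exactly 2 k x_n, and in each chart omega and the chosen root of 2 k zeta lie in the same closed
    quadrant; this bounds their distance by O(|zeta|^(3/2)). All constants depend on h alone, since
    the expansion must be uniform in the foot point. *)

Section Primitive.
Context {R : realType}.
Implicit Types (g : R -> R).
Local Notation mu := (@lebesgue_measure R).

(** The primitive vanishing at 0. Two integrals from -oo give one formula for both signs of w, so
    that it can be differentiated across 0 and is odd for even g. *)
Definition prim g (w : R) : R :=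
  \int[mu]_(t in `]-oo, w]) g t - \int[mu]_(t in `]-oo, 0]) g t.

Lemma prim0 g : prim g 0 = 0. Proof. exact: subrr. Qed.

Lemma integrable_oneDsqr : mu.-integrable setT (EFin \o (fun u : R => (oneDsqr u)^-1)).
Proof.
apply/integrableP; split.
  by apply: measurableT_comp => //; apply: continuous_measurable_fun; exact: continuous_oneDsqrV.
rewrite /=; under eq_integral => x _ do rewrite ger0_norm ?invr_ge0 ?(ltW (oneDsqr_gt0 _))//.
rewrite ge0_symfun_integralT; first last.
- by move=> x /=; rewrite /oneDsqr sqrrN.
- exact: continuous_oneDsqrV.
- by move=> x; rewrite invr_ge0 ltW// oneDsqr_gt0.
rewrite -set_itvcy integral0y_oneDsqr -EFinM; exact: ltry.
Qed.

(** This domination is the standing decay hypothesis on the integrands: it provides integrability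
    here and sup bounds for g later. *)
Lemma integrable_dominated g (C : R) : continuous g ->
  (forall u, 0 <= g u <= C / oneDsqr u) -> mu.-integrable setT (EFin \o g).
Proof.
move=> cg gC; apply: (@le_integrable _ _ _ mu _ measurableT _
  (EFin \o (fun u => C * (oneDsqr u)^-1))).
- by apply: measurableT_comp => //; exact: continuous_measurable_fun.
- move=> u _ /=; rewrite lee_fin; have /andP[h0 h1] := gC u.
  by rewrite !ger0_norm// (le_trans h0).
- exact: (integrableZl measurableT C integrable_oneDsqr).
Qed.

Lemma is_derive_prim g (C : R) w : continuous g ->
  (forall u, 0 <= g u <= C / oneDsqr u) -> is_derive w (1 : R) (prim g) (g w).
Proof.
move=> cg gC.
have ig : mu.-integrable [set` Interval -oo%O (BRight (w + 1))] (EFin \o g).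
  by apply: (integrableS measurableT) (integrable_dominated cg gC).
have [| |dF dFE] := @continuous_FTC1 R g -oo%O w (w + 1) _ ig _ (cg w).
- by rewrite ltrDl.
- by rewrite ltNyr.
have := is_deriveB (derivableP dF) (is_derive_cst (\int[mu]_(t in `]-oo, 0]) g t) w 1).
by rewrite -derive1E dFE subr0.
Qed.

(** With M = 0 this proves identities between primitives; with M of order r^2 it carries the
    estimates near the ellipsoid. *)
Lemma derive_le_bound (A dA : R -> R) (w M : R) :
  (forall u, is_derive u (1 : R) A (dA u)) ->
  (forall u, `|u| <= `|w| -> `|dA u| <= M) -> `|A w - A 0| <= M * `|w|.
Proof.
move=> dAP dAM.
have cA : continuous A.
  by move=> u; apply/differentiable_continuous/derivable1_diffP; case: (dAP u).
have [w0|w0] := leP 0 w.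
  have [c + ->] := MVT_segment w0 (fun x _ => dAP x) (continuous_subspaceT cA).
  rewrite in_itv/= => /andP[c0 cw].
  by rewrite subr0 normrM ler_wpM2r// dAM// !ger0_norm.
rewrite distrC; have [c + ->] := MVT_segment (ltW w0) (fun x _ => dAP x) (continuous_subspaceT cA).
rewrite in_itv/= => /andP[wc c0].
by rewrite sub0r normrM normrN ler_wpM2r// dAM// !ler0_norm ?lerN2// ltW.
Qed.

Lemma derive_le_incr (A B dA dB : R -> R) (a b : R) : a <= b ->
  (forall u, a <= u -> is_derive u (1 : R) A (dA u)) ->
  (forall u, a <= u -> is_derive u (1 : R) B (dB u)) ->
  (forall u, a <= u -> dA u <= dB u) -> A b - A a <= B b - B a.
Proof.
move=> ab dAP dBP AB.
have dP u : a <= u -> is_derive u (1 : R) (B - A) (dB u - dA u).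
  by move=> au; apply: is_deriveB; [exact: dBP|exact: dAP].
have [||c + E] := @MVT_segment R (B - A) (fun u => dB u - dA u) _ _ ab.
- by move=> x /[!in_itv]/= /andP[/ltW ax _]; exact: dP.
- apply: derivable_within_continuous => x /[!in_itv]/= /andP[ax _].
  by case: (dP x ax).
rewrite in_itv/= => /andP[ac _].
have : 0 <= (B - A) b - (B - A) a by rewrite E mulr_ge0// subr_ge0// AB.
have E2 u : (B - A) u = B u - A u by [].
rewrite !E2; lra.
Qed.

Lemma is_derive_sqr (u : R) : is_derive u (1 : R) (fun u : R => u ^+ 2) (2 * u).
Proof.
apply: DeriveDef; first exact: exprn_derivable.
by rewrite exp_derive /GRing.scale/= mulr1.
Qed.

Lemma is_derive_exprV (m : nat) (u : R) : u != 0 ->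
  is_derive u (1 : R) (fun u => - (u ^+ m.+1)^-1) (m.+1%:R * (u ^+ m.+2)^-1).
Proof.
move=> u0; have um : u ^+ m.+1 != 0 by rewrite expf_neq0.
have h : is_derive u (1 : R) (fun u : R => u ^+ m.+1) (m.+1%:R * u ^+ m).
  apply: DeriveDef; first exact: exprn_derivable.
  by rewrite exp_derive /GRing.scale/= mulr1.
have := is_deriveN (@is_deriveV R (fun u => u ^+ m.+1) u _ 1 um h).
move=> h2; apply: (@is_derive_eq _ _ _ _ _ _ _ _ h2).
rewrite /GRing.scale/= mulNr opprK.
rewrite !exprS; field; by rewrite ?u0 ?expf_neq0.
Qed.

Lemma prim_ndecr g (C : R) : continuous g ->
  (forall u, 0 <= g u <= C / oneDsqr u) -> {homo prim g : u v / u <= v}.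
Proof.
move=> cg gC u v uv; rewrite -subr_ge0 -(subrr (0 : R)).
apply: (@derive_le_incr (cst 0) (prim g) (cst 0) g _ _ uv) => x _.
- exact: is_derive_prim gC.
- by have /andP[] := gC x.
Qed.

(** [prim g] increases, so the full integral is the supremum of its values; these are bounded by
    comparing derivatives with those of -k u^-(m+1), a primitive of the majorant of g. *)
Lemma prim_tail g (C k : R) (m : nat) (w : R) : continuous g ->
  (forall u, 0 <= g u <= C / oneDsqr u) ->
  (forall u, 0 < u -> g u <= k * (m.+1%:R * (u ^+ m.+2)^-1)) -> 0 <= k -> 0 < w ->
  0 <= \int[mu]_(u in `[0, +oo[) g u - prim g w <= k * (w ^+ m.+1)^-1.
Proof.
move=> cg gC gk k0 w0; have ndP := prim_ndecr cg gC.
have bnd W : prim g W <= prim g w + k * (w ^+ m.+1)^-1.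
  (* The supremum runs over all W, so W < w has to be covered as well; there monotonicity
     suffices. *)
  have [wW|/ltW Ww] := leP w W; last first.
    by rewrite (le_trans (ndP _ _ Ww))// lerDl mulr_ge0// invr_ge0 exprn_ge0 ?ltW.
  have := @derive_le_incr (prim g) (fun u => k * - (u ^+ m.+1)^-1) g
    (fun u => k * (m.+1%:R * (u ^+ m.+2)^-1)) _ _ wW.
  have -> : prim g w + k * (w ^+ m.+1)^-1 = (k * - (W ^+ m.+1)^-1 - k * - (w ^+ m.+1)^-1)
    + prim g w + k * (W ^+ m.+1)^-1 by ring.
  move=> H; have : prim g W - prim g w <= k * - (W ^+ m.+1)^-1 - k * - (w ^+ m.+1)^-1.
    apply: H => u wu.
    - exact: is_derive_prim gC.
    - have u0 : u != 0 by rewrite gt_eqF// (lt_le_trans w0).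
      exact: (is_deriveZ k (is_derive_exprV m u0)).
    - by apply: gk; exact: lt_le_trans wu.
  have : 0 <= k * (W ^+ m.+1)^-1.
    by rewrite mulr_ge0// invr_ge0 exprn_ge0// (le_trans (ltW w0)).
  lra.
have hub : has_ubound (range (prim g)).
  by exists (prim g w + k * (w ^+ m.+1)^-1) => _ [W _ <-].
have lim := nondecreasing_cvgr ndP hub.
have cP : continuous (prim g).
  move=> u; apply/differentiable_continuous/derivable1_diffP.
  by case: (is_derive_prim u cg gC).
rewrite (Rintegral_ge0_continuous_FTC2y _ _ lim); first last.
- by move=> u _; rewrite derive1E; case: (is_derive_prim u cg gC).
- by apply: cvg_at_right_filter; exact: cP.
- by move=> u _; case: (is_derive_prim u cg gC).
- exact: continuous_subspaceT.
- by move=> u _; have /andP[] := gC u.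
rewrite prim0 subr0 subr_ge0 lerBlDl; apply/andP; split.
  by rewrite -lerBlDl; apply: (ub_le_sup hub); exists w.
by rewrite lerBlDl; apply: ge_sup; [exists (prim g w), w|move=> _ [W _ <-]].
Qed.
End Primitive.

(** * Gradients *)

Lemma cvg_sumr {R : realType} {T : Type} (F : set_system T) {FF : Filter F} (m : nat)
    (f : 'I_m -> T -> R) (a : 'I_m -> R) :
  (forall i, f i x @[x --> F] --> a i) ->
  \sum_(i < m) f i x @[x --> F] --> \sum_(i < m) a i.
Proof. by move=> fa; apply: cvg_big => //; exact: add_continuous. Qed.

Section Gradient.
Context {R : realType} {n : nat}.
Local Notation V := 'rV[R]_n.+1.
Implicit Types (f g : V -> R) (x : V).

Definition has_grad f x (d : 'I_n.+1 -> R) : Prop :=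
  differentiable f x /\ forall i, 'D_(basis_vec i) f x = d i.

Lemma has_grad_ext f x d d' : has_grad f x d -> d =1 d' -> has_grad f x d'.
Proof. by move=> [df fd] dd'; split=> // i; rewrite fd dd'. Qed.

Lemma has_gradC (a : R) x : has_grad (cst a) x (fun=> 0).
Proof. by split=> [|i]; [exact: differentiable_cst|exact: derive_cst]. Qed.

Lemma has_grad_coord x (j : 'I_n.+1) :
  has_grad (fun y : V => y 0 j) x (fun i => (j == i)%:R).
Proof.
split=> [|i]; first exact: differentiable_coord.
have : is_derive x (basis_vec i) (fun y : V => y 0 j) ((basis_vec i : V) 0 j).
  apply: DeriveDef; first by apply: diff_derivable; exact: differentiable_coord.
  have := @derive_mx R V 1 n.+1 id x (basis_vec i) (@derivable_id R V x (basis_vec i)).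
  by rewrite derive_id => /matrixP/(_ 0 j); rewrite [RHS]mxE => <-.
by case=> _ ->; rewrite mxE eqxx.
Qed.

Lemma has_gradD f g x df dg : has_grad f x df -> has_grad g x dg ->
  has_grad (fun y => f y + g y) x (fun i => df i + dg i).
Proof.
move=> [df1 fE] [dg1 gE]; split=> [|i]; first exact: differentiableD.
by rewrite -fE -gE; apply: deriveD; exact: diff_derivable.
Qed.

Lemma has_gradN f x df : has_grad f x df ->
  has_grad (fun y => - f y) x (fun i => - df i).
Proof.
move=> [df1 fE]; split=> [|i]; first exact: differentiableN.
by rewrite -fE; apply: deriveN; exact: diff_derivable.
Qed.

Lemma has_gradM f g x df dg : has_grad f x df -> has_grad g x dg ->
  has_grad (fun y => f y * g y) x (fun i => df i * g x + f x * dg i).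
Proof.
move=> [df1 fE] [dg1 gE]; split=> [|i]; first exact: differentiableM.
rewrite -fE -gE addrC [X in _ + X]mulrC.
by apply: deriveM; exact: diff_derivable.
Qed.

Lemma has_grad_sum m (F : 'I_m -> V -> R) (dF : 'I_m -> 'I_n.+1 -> R) x :
  (forall k, has_grad (F k) x (dF k)) ->
  has_grad (fun y => \sum_(k < m) F k y) x (fun i => \sum_(k < m) dF k i).
Proof.
elim: m F dF => [|m IH] F dF FdF.
  rewrite (_ : (fun y => _) = cst 0); last by apply/funext => y; rewrite big_ord0.
  by apply: (has_grad_ext (has_gradC 0 x)) => i; rewrite big_ord0.
rewrite (_ : (fun y => _) = (fun y => \sum_(k < m) F (widen_ord (leqnSn m) k) y + F ord_max y));
  last first.
  by apply/funext => y; rewrite big_ord_recr.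
apply: (has_grad_ext (has_gradD (IH _ _ (fun k => FdF _)) (FdF ord_max))) => i.
by rewrite big_ord_recr.
Qed.

Lemma has_grad_comp (G : R -> R) (g : R) f x df :
  has_grad f x df -> is_derive (f x) (1 : R) G g ->
  has_grad (fun y => G (f y)) x (fun i => df i * g).
Proof.
move=> [df1 fE] [dG GE].
have dG1 : differentiable G (f x) by exact/derivable1_diffP.
split=> [|i]; first exact: (differentiable_comp df1 dG1).
rewrite deriveE; last exact: (differentiable_comp df1 dG1).
rewrite diff_comp//= deriv1E// -deriveE// fE.
by rewrite derive1E GE.
Qed.

Lemma differential_littleo f x (L : {linear V -> R}) : continuous L ->
  (forall e, 0 < e ->
    \forall y \near (0 : V), `|f (y + x) - (f x + L y)| <= e * `|y|) ->
  differentiable f x /\ 'd f x = L :> (V -> R).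
Proof.
move=> cL key; have dE : 'd f x = L :> (V -> R).
  by apply: diff_unique => //; apply/eqaddoP; exact: key.
split=> //; apply/diff_locallyP; rewrite dE; split => //.
by apply/eqaddoP; exact: key.
Qed.

Lemma has_grad_near f g x df : {near x, f =1 g} -> has_grad f x df -> has_grad g x df.
Proof.
move=> fg [df1 fE]; split=> [|i]; last by rewrite -(near_eq_derive _ fg).
have key e : 0 < e ->
    \forall y \near (0 : V), `|g (y + x) - (g x + 'd f x y)| <= e * `|y|.
  move=> e0; have /diff_locallyP[_ /eqaddoP/(_ e e0)] := df1.
  have : \forall y \near (0 : V), f (y + x) = g (y + x).
    by move: fg; rewrite (near_shift 0 x) subr0.
  apply: filterS2 => y /= <- H.
  by rewrite -(nbhs_singleton fg); exact: H.
by have [] := differential_littleo (diff_continuous df1) key.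
Qed.

(* Caratheodory's form of differentiability. *)
Lemma has_grad_slope f x (phi : 'I_n.+1 -> V -> R) :
  (\forall y \near x, f y - f x = \sum_i (y 0 i - x 0 i) * phi i y) ->
  (forall i, {for x, continuous (phi i)}) ->
  has_grad f x (fun i => phi i x).
Proof.
move=> fphi cphi.
pose L (v : V) : R := \sum_i v 0 i * phi i x.
have Llin : linear L.
  move=> a u v; rewrite /L /GRing.scale/= mulr_sumr -big_split/=.
  by apply: eq_bigr => i _; rewrite !mxE; ring.
pose Lm := GRing.isLinear.Build _ _ _ _ L Llin.
pose LL : {linear V -> R} := HB.pack L Lm.
have cL : continuous LL.
  move=> v; apply: (@cvg_sumr R V (nbhs v) _ n.+1 (fun i (v : V) => v 0 i * phi i x)) => i.
  by apply: cvgMr_tmp; exact: coord_continuous.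
have [df dE] : differentiable f x /\ 'd f x = LL :> (V -> R).
  apply: differential_littleo => // e e0.
  pose e' := e / n.+1%:R.
  have e'0 : 0 < e' by rewrite divr_gt0// ltr0n.
  have A : \forall y \near x, forall i, `|phi i x - phi i y| <= e'.
    apply: (@filter_forall _ _ _ (nbhs x) _) => i.
    by have /cvgrPdist_le := cphi i; exact.
  have : \forall y \near (0 : V), (forall i, `|phi i x - phi i (y + x)| <= e') /\
      f (y + x) - f x = \sum_i ((y + x) 0 i - x 0 i) * phi i (y + x).
    have : \forall y \near x, (forall i, `|phi i x - phi i y| <= e') /\
      f y - f x = \sum_i (y 0 i - x 0 i) * phi i y.
      by near=> y; split; near: y.
    by rewrite (near_shift 0 x) subr0.
  apply: filterS => y [yphi fy].
  rewrite -[LL y]/(L y) opprD addrA fy /L -sumrB.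
  rewrite (le_trans (ler_norm_sum _ _ _))//.
  have -> : e * `|y| = \sum_(i < n.+1) e' * `|y|.
    by rewrite sumr_const card_ord -mulr_natr mulrAC divfK ?pnatr_eq0.
  apply: ler_sum => i _; rewrite mxE addrK -mulrBr normrM mulrC distrC.
  rewrite ler_pM// [leRHS]mx_normrE.
  by apply: (le_bigmax _ (fun ij : 'I_1 * 'I_n.+1 => `|y ij.1 ij.2|) (0, i)).
split=> // i; rewrite deriveE// dE /= /L (bigD1 i)//= mxE !eqxx mul1r big1 ?addr0//.
by move=> j ji; rewrite mxE eqxx (negPf ji) mul0r.
Unshelve. all: by end_near. Qed.

(** The explicit functions agree with the iterated ['D_] only on U; as U is open, this is agreement
    near each point, enough to transfer differentiability and continuity. *)
Lemma has_grad_class_C2 (U : set V) f (df : 'I_n.+1 -> V -> R)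
    (ddf : 'I_n.+1 -> 'I_n.+1 -> V -> R) : open U ->
  (forall x, U x -> has_grad f x (df ^~ x)) ->
  (forall x i, U x -> has_grad (df i) x (ddf i ^~ x)) ->
  (forall x i j, U x -> {for x, continuous (ddf i j)}) ->
  class_C 2 U f /\
  (forall x i, U x -> 'D_(basis_vec i) ('D_(basis_vec i) f) x = ddf i i x).
Proof.
move=> oU fdf dfddf cddf.
have nearU x : U x -> \forall y \near x, U y by move=> Ux; exact: open_nbhs_nbhs.
have Df x i : U x -> has_grad ('D_(basis_vec i) f) x (ddf i ^~ x).
  move=> Ux; apply: has_grad_near (dfddf x i Ux).
  by apply: filterS (nearU _ Ux) => y Uy; have [_ ->] := fdf y Uy.
split; last by move=> x i Ux; have [_ ->] := Df x i Ux.
split=> [x Ux|i]; first by have [] := fdf x Ux.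
split=> [x Ux|j x Ux]; first by have [] := Df x i Ux.
have E : \forall y \near x, ddf i j y = 'D_(basis_vec j) ('D_(basis_vec i) f) y.
  by apply: filterS (nearU _ Ux) => y Uy; have [_ ->] := Df y i Uy.
have cd : ddf i j y @[y --> x] --> ddf i j x := cddf x i j Ux.
suff : 'D_(basis_vec j) ('D_(basis_vec i) f) y @[y --> x] --> ddf i j x.
  by rewrite (nbhs_singleton E).
exact: (cvg_trans (near_eq_cvg E) cd).
Qed.

End Gradient.

(** * Ellipsoidal coordinates *)

Section ContinuousAt.
Context {R : realType} {T : topologicalType}.
Implicit Types (f g : T -> R) (x : T).

(* An opaque head symbol keeps unification from unfolding the neighbourhood
   filters of row vectors. *)
Definition cts f x : Prop := f @ x --> f x.

Lemma ctsC (a : R) x : cts (fun=> a) x.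
Proof. exact: cvg_cst. Qed.

Lemma ctsD f g x : cts f x -> cts g x -> cts (fun y => f y + g y) x.
Proof. exact: cvgD. Qed.

Lemma ctsN f x : cts f x -> cts (fun y => - f y) x.
Proof. exact: cvgN. Qed.

Lemma ctsM f g x : cts f x -> cts g x -> cts (fun y => f y * g y) x.
Proof. exact: cvgM. Qed.

Lemma ctsX f (k : nat) x : cts f x -> cts (fun y => f y ^+ k) x.
Proof.
move=> cf; elim: k => [|k IH]; first exact: ctsC.
rewrite (_ : (fun y => _) = fun y => f y * f y ^+ k); first exact: ctsM.
by apply/funext => y; rewrite exprS.
Qed.

Lemma ctsV f x : f x != 0 -> cts f x -> cts (fun y => (f y)^-1) x.
Proof. exact: cvgV. Qed.

Lemma cts_sum (m : nat) (f : 'I_m -> T -> R) x :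
  (forall i, cts (f i) x) -> cts (fun y => \sum_(i < m) f i y) x.
Proof. exact: cvg_sumr. Qed.

Lemma cts_comp (G : R -> R) f x : continuous G -> cts f x -> cts (fun y => G (f y)) x.
Proof. by move=> cG cf; apply: continuous_comp => //; exact: cG. Qed.

Lemma cts_near f g x : (\forall y \near x, f y = g y) -> cts f x -> cts g x.
Proof.
by move=> fg; rewrite /cts -(nbhs_singleton fg) => cf; exact: (cvg_trans (near_eq_cvg fg) cf).
Qed.

Lemma cts_dist f x :
  (forall e, 0 < e -> \forall y \near x, f x - e < f y < f x + e) -> cts f x.
Proof.
move=> H; apply/cvgrPdist_lt => e e0.
by apply: filterS (H e e0) => y; rewrite distrC ltr_distl.
Qed.

Lemma cts_lt f x (a : R) : cts f x -> f x < a -> \forall y \near x, f y < a.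
Proof. by move=> cf; exact: cvgr_lt. Qed.

Lemma cts_gt f x (a : R) : cts f x -> a < f x -> \forall y \near x, a < f y.
Proof. by move=> cf; exact: cvgr_gt. Qed.
End ContinuousAt.

Ltac cts_arith := repeat lazymatch goal with
  | |- cts (fun _ => ?a) _ => exact: ctsC
  | |- cts (fun y => @?f y + @?g y) _ => apply: (@ctsD _ _ f g)
  | |- cts (fun y => - @?f y) _ => apply: (@ctsN _ _ f)
  | |- cts (fun y => @?f y * @?g y) _ => apply: (@ctsM _ _ f g)
  | |- cts (fun y => @?f y ^+ ?k) _ => apply: (@ctsX _ _ f k)
  | |- cts (fun y => (@?f y)^-1) _ => apply: (@ctsV _ _ f)
  | |- cts _ _ => first [solve [auto] | apply: cts_sum => ? /=]
  end.

Section EllipsoidalCoordinates.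
Context {R : realType} {n : nat}.
Variable h : 'I_n -> R.
Hypothesis hpos : forall i, 0 < h i.
Local Notation V := 'rV[R]_n.+1.
Implicit Types (x y : V) (a b w : R) (i : 'I_n).

Lemma hcoord_cts i x : cts (hcoord ^~ i) x.
Proof. exact: coord_continuous. Qed.

Lemma lastcoord_cts x : cts (lastcoord (R := R) (n := n)) x.
Proof. exact: coord_continuous. Qed.

(** This is z^2 as a function of (x, w): multiplied by w^2, the ellipsoidal equation reads w^2
    [level x w] = x_n^2, which makes sense at w = 0 too. *)
Definition level x w : R := 1 - \sum_(i < n) hcoord x i ^+ 2 / (h i ^+ 2 + w ^+ 2).

Lemma hw_gt0 i w : 0 < h i ^+ 2 + w ^+ 2.
Proof. by rewrite ltr_wpDr ?sqr_ge0// exprn_gt0. Qed.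

Lemma hw_neq0 i w : h i ^+ 2 + w ^+ 2 != 0.
Proof. by rewrite gt_eqF// hw_gt0. Qed.

(** A common upper bound of the h_i^2, made at least 1 so that it absorbs other constants; [hinf] is
    its counterpart from below. *)
Definition hsup : R := 1 + \sum_(i < n) h i ^+ 2.

Lemma hsup_ge1 : 1 <= hsup.
Proof. by rewrite lerDl sumr_ge0// => i _; rewrite sqr_ge0. Qed.

Lemma hsup_gt0 : 0 < hsup. Proof. exact: lt_le_trans hsup_ge1. Qed.

Lemma le_hsup i : h i ^+ 2 <= hsup.
Proof.
rewrite /hsup (bigD1 i)//= addrCA lerDl addr_ge0// sumr_ge0// => j _.
by rewrite sqr_ge0.
Qed.

Lemma level_cts (T : topologicalType) (f : T -> V) (g : T -> R) t :
  (forall i, cts (fun s => hcoord (f s) i) t) -> cts g t ->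
  cts (fun s => level (f s) (g s)) t.
Proof.
by move=> fx gw; rewrite /level; cts_arith; rewrite ?hw_neq0.
Qed.

Lemma level_ctsl x a : cts (level ^~ a) x.
Proof. by apply: level_cts => [i|]; [exact: hcoord_cts|exact: ctsC]. Qed.

(** The divided difference of [level] with respect to w^2, see [levelB]. For a = b = w it is the
    derivative; for a = b = 0 at a point of the ellipsoid it is the square of the k of the
    overview. *)
Definition kap x y a b : R :=
  \sum_(i < n) hcoord x i ^+ 2 / ((h i ^+ 2 + a ^+ 2) * (h i ^+ 2 + b ^+ 2)).

Lemma levelB x a b : level x b - level x a = (b ^+ 2 - a ^+ 2) * kap x x a b.
Proof.
rewrite /level /kap.
have -> (u v : R) : 1 - u - (1 - v) = v - u by ring.
rewrite mulr_sumr -sumrB; apply: eq_bigr => i _.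
by field; rewrite !hw_neq0.
Qed.

Lemma kap_ge0 x y a b : 0 <= kap x y a b.
Proof.
apply: sumr_ge0 => i _.
by rewrite divr_ge0 ?sqr_ge0// mulr_ge0// ltW// hw_gt0.
Qed.

Lemma level_ge x a b : 0 <= a <= b -> level x a <= level x b.
Proof.
move=> /andP[a0 ab]; rewrite -subr_ge0 levelB mulr_ge0 ?kap_ge0// subr_ge0.
by rewrite lerXn2r// nnegrE// (le_trans a0).
Qed.

(** [level x] is constant when the first n coordinates vanish, so strict growth has to come from the
    assumption to be refuted: if [level x b] <= 0, the sum there is at least 1, which bounds [kap]
    below by a positive number. *)
Lemma level_gt0 x a b : 0 <= a < b -> 0 <= level x a -> 0 < level x b.
Proof.
move=> /andP[a0 ab] Ta; rewrite ltNge; apply/negP => Tb.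
have s1 : 1 <= \sum_(i < n) hcoord x i ^+ 2 / (h i ^+ 2 + b ^+ 2).
  by move: Tb; rewrite /level; lra.
have Ka : 0 < (hsup + a ^+ 2)^-1 by rewrite invr_gt0 ltr_wpDr ?sqr_ge0 ?hsup_gt0.
have : (hsup + a ^+ 2)^-1 <= kap x x a b.
  rewrite -[leLHS]mulr1 (le_trans (ler_wpM2l (ltW Ka) s1))// mulr_sumr.
  apply: ler_sum => i _; rewrite mulrCA ler_wpM2l ?sqr_ge0// invfM.
  rewrite ler_wpM2r ?invr_ge0 ?(ltW (hw_gt0 _ _))//.
  by rewrite lef_pV2 ?lerD2r ?le_hsup// posrE ?hw_gt0// ltr_wpDr ?sqr_ge0 ?hsup_gt0.
move=> kge; have : 0 < level x b - level x a.
  rewrite levelB mulr_gt0 ?(lt_le_trans Ka kge)// subr_gt0.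
  by rewrite ltrXn2r// nnegrE// (le_trans a0)// ltW.
by move: Tb Ta; lra.
Qed.

(* [w] is the square root of the nonnegative root lambda of
   sum_i x_i^2/(h_i^2+lambda) + x_n^2/lambda = 1, with the cases where x_n or
   lambda vanishes included. *)
Definition is_wcoord x w : Prop :=
  [/\ 0 <= w, 0 <= level x w & w ^+ 2 * level x w = lastcoord x ^+ 2].

Lemma is_wcoord_exists x : exists w, is_wcoord x w.
Proof.
pose M2 := \sum_(i < n) hcoord x i ^+ 2 + lastcoord x ^+ 2.
have S0 : 0 <= \sum_(i < n) hcoord x i ^+ 2 by apply: sumr_ge0 => i _; rewrite sqr_ge0.
have M20 : 0 <= M2 by rewrite addr_ge0// sqr_ge0.
(* The Euclidean length of x is an upper end for the root: M^2 [level x M] >= x_n^2. *)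
pose M := Num.sqrt M2.
have M0 : 0 <= M by exact: sqrtr_ge0.
have MM : M ^+ 2 = M2 by rewrite sqr_sqrtr.
have bM : lastcoord x ^+ 2 <= M ^+ 2 * level x M.
  rewrite /level mulrBr mulr1 mulr_sumr {1}MM /M2 [X in _ <= X - _]addrC -addrA lerDl subr_ge0.
  apply: ler_sum => i _; rewrite mulrCA ler_piMr ?sqr_ge0//.
  by rewrite ler_pdivrMr ?hw_gt0// mul1r lerDr sqr_ge0.
have cT : continuous (level x).
  by move=> w; apply: level_cts => [i|]; [exact: ctsC|exact: cvg_id].
have cF : continuous (fun w => w ^+ 2 * level x w).
  move=> w; change (cts (fun w => w ^+ 2 * level x w) w).
  have cid : cts (fun w : R => w) w by exact: cvg_id.
  have cTw : cts (level x) w by exact: cT.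
  by cts_arith.
(* The lower end: from a on, [level x] is nonnegative. It is 0, or a zero of [level x] when that
   function is negative at 0. *)
have [a [a0 aM Ta aTa]] : exists a, [/\ 0 <= a, a <= M, 0 <= level x a &
    a ^+ 2 * level x a <= lastcoord x ^+ 2].
  have [T0|T0] := leP 0 (level x 0).
    by exists 0; split=> //; rewrite expr0n/= mul0r sqr_ge0.
  have TM : 0 <= level x M.
    rewrite leNgt; apply/negP => TM.
    have : M ^+ 2 * level x M <= 0 by rewrite mulr_ge0_le0 ?sqr_ge0// ltW.
    move=> MT0; have xN0 : lastcoord x ^+ 2 = 0.
      by apply/eqP; rewrite eq_le sqr_ge0 (le_trans bM).
    have : M ^+ 2 * level x M == 0 by rewrite eq_le MT0 -xN0 bM.
    rewrite mulf_eq0 (lt_eqF TM) orbF MM => /eqP M20'.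
    have Sx0 : \sum_(i < n) hcoord x i ^+ 2 = 0 by move: M20'; rewrite /M2 xN0 addr0.
    have Sx i : hcoord x i ^+ 2 = 0.
      by apply: (psumr_eq0P _ Sx0) => // j _; rewrite sqr_ge0.
    move: TM; rewrite /level big1 => [|i _]; first lra.
    by rewrite Sx mul0r.
  have [||a + aE] := @IVT _ (level x) 0 M 0 M0; first exact: continuous_subspaceT.
    by rewrite ge_min le_max (ltW T0) TM orbT.
  rewrite in_itv/= => /andP[a0 aM]; exists a; split => //; first by rewrite aE.
  by rewrite aE mulr0 sqr_ge0.
have [||w + wE] := @IVT _ (fun w => w ^+ 2 * level x w) a M (lastcoord x ^+ 2) aM.
- exact: continuous_subspaceT.
- by rewrite ge_min le_max aTa bM orbT.
rewrite in_itv/= => /andP[aw wM]; exists w; split => //; first exact: le_trans aw.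
by rewrite (le_trans Ta)// level_ge// a0.
Qed.

(** This strict excess past the root is an open condition in x, which is what bounds [wcoord] from
    above near x. *)
Lemma is_wcoord_lt x w1 w2 : is_wcoord x w1 -> 0 <= level x w1 -> w1 < w2 ->
  0 < level x w2 /\ lastcoord x ^+ 2 < w2 ^+ 2 * level x w2.
Proof.
move=> [w10 T1 E1] _ w12.
have T2 : 0 < level x w2 by apply: (@level_gt0 _ w1) => //; rewrite w10.
split=> //; rewrite -E1; apply: (@le_lt_trans _ _ (w1 ^+ 2 * level x w2)).
  by rewrite ler_wpM2l ?sqr_ge0// level_ge// w10 ltW.
by rewrite ltr_pM2r// ltrXn2r// nnegrE// (le_trans w10)// ltW.
Qed.

Definition wcoord x : R := xget 0 [set w | is_wcoord x w].

Lemma wcoordP x : is_wcoord x (wcoord x).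
Proof. exact: (xgetPex 0 (is_wcoord_exists x)). Qed.

Lemma wcoord_ge0 x : 0 <= wcoord x. Proof. by case: (wcoordP x). Qed.

Definition zcoord x : R := Num.sqrt (level x (wcoord x)).

Lemma zcoord_ge0 x : 0 <= zcoord x. Proof. exact: sqrtr_ge0. Qed.

Lemma zcoord_sqr x : zcoord x ^+ 2 = level x (wcoord x).
Proof. by rewrite sqr_sqrtr//; case: (wcoordP x). Qed.

Lemma wzcoord x : wcoord x * zcoord x = `|lastcoord x|.
Proof.
have [w0 T0 E] := wcoordP x.
by rewrite -sqrtr_sqr -E sqrtrM ?sqr_ge0// sqrtr_sqr ger0_norm.
Qed.

(** The value is squeezed by conditions open in x: at [wcoord x + e] the function w^2 [level x w]
    exceeds x_n^2; at [wcoord x - e] either [level] is negative or that function falls short of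
    x_n^2. No derivative of the equation enters, so points of the ellipsoid are covered. *)
Lemma wcoord_cts x : cts wcoord x.
Proof.
have cFN a : cts (fun y => a ^+ 2 * level y a - lastcoord y ^+ 2) x.
  by have := @level_ctsl x a; have := @lastcoord_cts x; move=> *; cts_arith.
have [w0 T0 E0] := wcoordP x.
apply: cts_dist => e e0.
have up : \forall y \near x, wcoord y < wcoord x + e.
  have wb : wcoord x < wcoord x + e by rewrite ltrDl.
  have [T1 E1] := is_wcoord_lt (wcoordP x) T0 wb.
  have b0 : 0 <= wcoord x + e by rewrite (le_trans w0)// ltW.
  near=> y.
  have Ty : 0 < level y (wcoord x + e).
    by near: y; exact: (cts_gt (@level_ctsl x _) T1).
  have Ey : 0 < (wcoord x + e) ^+ 2 * level y (wcoord x + e) - lastcoord y ^+ 2.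
    by near: y; apply: (cts_gt (cFN _)); rewrite subr_gt0.
  rewrite ltNge; apply/negP => bw; have [v0 Tv Ev] := wcoordP y.
  move: Ey; rewrite -Ev subr_gt0 ltNge; apply/negP/negPn.
  rewrite ler_pM ?sqr_ge0 ?(ltW Ty)// ?lerXn2r ?nnegrE//.
  by apply: level_ge; rewrite b0.
have lo : \forall y \near x, wcoord x - e < wcoord y.
  have [a0|a0] := ltP (wcoord x - e) 0.
    by near=> y; rewrite (lt_le_trans a0)// wcoord_ge0.
  have aw : wcoord x - e < wcoord x by rewrite ltrBlDr ltrDl.
  have [Ta|Ta] := ltP (level x (wcoord x - e)) 0.
    near=> y; rewrite ltNge; apply/negP => wa; have [v0 Tv Ev] := wcoordP y.
    have : level y (wcoord x - e) < 0 by near: y; exact: (cts_lt (@level_ctsl x _) Ta).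
    rewrite ltNge; apply/negP/negPn; rewrite (le_trans Tv)// level_ge//.
    by rewrite v0.
  have Ea : (wcoord x - e) ^+ 2 * level x (wcoord x - e) < lastcoord x ^+ 2.
    rewrite -E0; apply: (@le_lt_trans _ _ ((wcoord x - e) ^+ 2 * level x (wcoord x))).
      by rewrite ler_wpM2l ?sqr_ge0// level_ge// a0 ltW.
    rewrite ltr_pM2r; first by rewrite ltrXn2r// nnegrE.
    by apply: (@level_gt0 _ (wcoord x - e)) => //; rewrite a0.
  near=> y; rewrite ltNge; apply/negP => wa; have [v0 Tv Ev] := wcoordP y.
  have : (wcoord x - e) ^+ 2 * level y (wcoord x - e) - lastcoord y ^+ 2 < 0.
    by near: y; apply: (cts_lt (cFN _)); rewrite subr_lt0.
  rewrite -Ev subr_lt0 ltNge; apply/negP/negPn.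
  rewrite ler_pM ?sqr_ge0 ?lerXn2r ?nnegrE//.
  by apply: level_ge; rewrite v0.
by near=> y; apply/andP; split; near: y.
Unshelve. all: by end_near. Qed.

Lemma zcoord_cts x : cts zcoord x.
Proof.
apply: cts_comp; first exact: sqrt_continuous.
by apply: level_cts => [i|]; [exact: hcoord_cts|exact: wcoord_cts].
Qed.

End EllipsoidalCoordinates.

Section LastCoordinate.
Context {R : realType} {n : nat}.
Local Notation V := 'rV[R]_n.+1.

Definition ext_last {A : Type} (a : 'I_n -> A) (b : A) (i : 'I_n.+1) : A :=
  if unlift ord_max i is Some j then a j else b.

Lemma widen_lift (j : 'I_n) : widen_ord (leqnSn n) j = lift ord_max j.
Proof. by apply: val_inj; rewrite /= /bump leqNgt ltn_ord. Qed.

Lemma ext_last_widen {A : Type} (a : 'I_n -> A) b j :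
  ext_last a b (widen_ord (leqnSn n) j) = a j.
Proof. by rewrite /ext_last widen_lift liftK. Qed.

Lemma ext_last_max {A : Type} (a : 'I_n -> A) b : ext_last a b ord_max = b.
Proof. by rewrite /ext_last unlift_none. Qed.

Lemma ord_lastP (P : 'I_n.+1 -> Prop) :
  (forall j : 'I_n, P (widen_ord (leqnSn n) j)) -> P ord_max -> forall i, P i.
Proof.
by move=> Pw Pm i; case: (unliftP ord_max i) => [j ->|->//]; rewrite -widen_lift.
Qed.

Lemma widen_eq_max (j : 'I_n) : (widen_ord (leqnSn n) j == ord_max) = false.
Proof. by rewrite -val_eqE /= ltn_eqF. Qed.

Lemma widen_eq (j k : 'I_n) :
  (widen_ord (leqnSn n) j == widen_ord (leqnSn n) k) = (j == k).
Proof. by rewrite -!val_eqE. Qed.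

Lemma max_eq_widen (j : 'I_n) : (ord_max == widen_ord (leqnSn n) j) = false.
Proof. by rewrite eq_sym widen_eq_max. Qed.
End LastCoordinate.

(** * The two charts and the first derivatives of w and z *)

Section Charts.
Context {R : realType} {n : nat}.
Variable h : 'I_n -> R.
Hypothesis hpos : forall i, 0 < h i.
Local Notation V := 'rV[R]_n.+1.
Implicit Types (x y : V) (b : bool) (i : 'I_n).
Local Notation N := (lastcoord (R := R) (n := n)).

Definition quad x : R := \sum_(i < n) hcoord x i ^+ 2 / h i ^+ 2.

Lemma level0 x : level h x 0 = 1 - quad x.
Proof.
by rewrite /level /quad; congr (_ - _); apply: eq_bigr => i _; rewrite expr0n/= addr0.
Qed.

Lemma quad_cts x : cts quad x.
Proof.
by rewrite /quad; have := @hcoord_cts R n => ch; cts_arith.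
Qed.

(* [chart_dom true] is the complement of the closed flat disc bounded by the
   ellipsoid, on which w > 0; [chart_dom false] is the complement of the exterior
   of that disc in the hyperplane, on which z > 0. *)
Definition chart_dom b : set V :=
  [set x | N x != 0 \/ (if b then 1 < quad x else quad x < 1)].

(** The sign of x_n goes to the factor that vanishes on the part of the hyperplane contained in the
    chart, so [Num.sg 0 = 0] agrees with its value there. *)
Definition wchart b x : R := if b then wcoord h x else Num.sg (N x) * wcoord h x.
Definition zchart b x : R := if b then Num.sg (N x) * zcoord h x else zcoord h x.

Lemma near_last_neq0 x : N x != 0 -> \forall y \near x, N y != 0.
Proof.
rewrite neq_lt => /orP[x0|x0].
  by apply: filterS (cts_lt (@lastcoord_cts R n x) x0) => y y0; rewrite lt_eqF.
by apply: filterS (cts_gt (@lastcoord_cts R n x) x0) => y y0; rewrite gt_eqF.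
Qed.

Lemma near_chart_dom b x : chart_dom b x -> \forall y \near x, chart_dom b y.
Proof.
case=> [x0|]; first by apply: filterS (near_last_neq0 x0) => y; left.
by case: b => Qx; [move: (cts_gt (@quad_cts x) Qx)|move: (cts_lt (@quad_cts x) Qx)];
  apply: filterS => y; right.
Qed.

Lemma chart_dom_open b : open (chart_dom b).
Proof. by rewrite openE => x; exact: near_chart_dom. Qed.

Lemma wcoord_gt0 x : chart_dom true x -> 0 < wcoord h x.
Proof.
move=> dx; rewrite lt_def wcoord_ge0// andbT; apply/eqP => w0.
have [_] := wcoordP hpos x; rewrite w0 level0 expr0n/= mul0r => Q1 x0.
case: dx => [|]; first by move/eqP; apply; apply/eqP; rewrite -sqrf_eq0 -x0.
by rewrite ltNge; apply/negP/negPn; rewrite -subr_ge0.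
Qed.

Lemma zcoord_gt0 x : chart_dom false x -> 0 < zcoord h x.
Proof.
move=> dx; rewrite lt_def zcoord_ge0 andbT; apply/eqP => z0.
have [w0 _] := wcoordP hpos x; rewrite -zcoord_sqr// z0 expr0n/= mulr0 => x0.
case: dx => [|Q1]; first by move/eqP; apply; apply/eqP; rewrite -sqrf_eq0 -x0.
have : level h x 0 <= level h x (wcoord h x) by rewrite level_ge// lexx.
rewrite -zcoord_sqr// z0 expr0n/= level0 subr_le0; apply/negP; rewrite -ltNge //.
Qed.

Lemma wz_chart b x : wchart b x * zchart b x = N x.
Proof.
by case: b; rewrite /wchart /zchart ?(mulrCA (wcoord h x)) -?mulrA wzcoord// mulr_sg_norm.
Qed.

Lemma wchart_sqr b x : chart_dom b x -> wchart b x ^+ 2 = wcoord h x ^+ 2.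
Proof.
case: b => //= dx; rewrite /wchart exprMn sqr_sg.
have [x0|x0] := eqVneq (N x) 0; last by rewrite mul1r.
have := wzcoord hpos x; rewrite x0 normr0 => /eqP; rewrite mulf_eq0.
by rewrite (gt_eqF (zcoord_gt0 dx)) orbF => /eqP ->; rewrite expr0n/= mulr0.
Qed.

Lemma zchart_sqr b x : chart_dom b x -> zchart b x ^+ 2 = zcoord h x ^+ 2.
Proof.
case: b => //= dx; rewrite /zchart exprMn sqr_sg.
have [x0|x0] := eqVneq (N x) 0; last by rewrite mul1r.
have := wzcoord hpos x; rewrite x0 normr0 => /eqP; rewrite mulf_eq0.
by rewrite (gt_eqF (wcoord_gt0 dx)) /= => /eqP ->; rewrite expr0n/= mulr0.
Qed.

Lemma level_wchart b x : chart_dom b x -> level h x (wchart b x) = zchart b x ^+ 2.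
Proof.
by move=> dx; rewrite /level wchart_sqr// zchart_sqr// zcoord_sqr.
Qed.

Lemma wzchart_cts b x : chart_dom b x -> cts (wchart b) x /\ cts (zchart b) x.
Proof.
have cw := @wcoord_cts _ _ _ hpos x; have cz := @zcoord_cts _ _ _ hpos x.
have cN := @lastcoord_cts R n x.
move=> dx; have near := near_chart_dom dx; case: b dx near => dx near.
  (* The sign function jumps, but the signed factor is x_n divided by the positive one. *)
  split=> //; apply: (@cts_near _ _ (fun y => N y / wcoord h y)).
    apply: filterS near => y dy; rewrite -(wz_chart true y) mulrAC divff ?mul1r//.
    by rewrite gt_eqF// wcoord_gt0.
  by cts_arith; rewrite gt_eqF// wcoord_gt0.
split=> //; apply: (@cts_near _ _ (fun y => N y / zcoord h y)).
  apply: filterS near => y dy; rewrite -(wz_chart false y) mulfK//.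
  by rewrite gt_eqF// zcoord_gt0.
by cts_arith; rewrite gt_eqF// zcoord_gt0.
Qed.

Lemma kap_lb x a c : (hsup h + a ^+ 2)^-1 * (1 - level h x c) <= kap h x x a c.
Proof.
rewrite /level subKr mulr_sumr; apply: ler_sum => i _.
rewrite mulrCA ler_wpM2l ?sqr_ge0// invfM ler_wpM2r ?invr_ge0 ?(ltW (hw_gt0 hpos _ _))//.
by rewrite lef_pV2 ?lerD2r ?le_hsup// posrE ?hw_gt0// ltr_wpDr ?sqr_ge0 ?hsup_gt0.
Qed.

Definition kapc b x := kap h x x (wchart b x) (wchart b x).

(* The Jacobian determinant of (w, z) |-> (w z, z^2 - level). *)
Definition jdet b x : R := 2 * (zchart b x ^+ 2 + kapc b x * wchart b x ^+ 2).

(** If z = 0, the chart is the one with w > 0, and [level] = 0 makes the sum in it equal to 1, so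
    [kap] is bounded below. Both terms vanish only on the ellipsoid. *)
Lemma jdet_gt0 b x : chart_dom b x -> 0 < jdet b x.
Proof.
move=> dx; rewrite mulr_gt0//.
have kw0 : 0 <= kapc b x * wchart b x ^+ 2 by rewrite mulr_ge0 ?sqr_ge0// kap_ge0.
have [z0|z0] := eqVneq (zchart b x) 0; last first.
  by rewrite ltr_pwDl// lt_def sqr_ge0 sqrf_eq0 z0.
have b1 : b = true.
  by case: b dx z0 {kw0} => // dx z0; move: (zcoord_gt0 dx);
    rewrite -[zcoord _ _]/(zchart false x) z0 ltxx.
subst b; rewrite z0 expr0n/= add0r mulr_gt0 ?exprn_gt0 ?wcoord_gt0//.
apply: lt_le_trans (kap_lb _ _ _).
by rewrite level_wchart// z0 expr0n/= subr0 mulr1 invr_gt0 ltr_wpDr ?sqr_ge0 ?hsup_gt0.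
Qed.

(** This and [dzchart] are Cramer's rule for the differentiated equations w z = x_n and z^2 =
    [level]. *)
Definition dwchart b x : 'I_n.+1 -> R := ext_last
  (fun j => 2 * wchart b x * hcoord x j / ((h j ^+ 2 + wchart b x ^+ 2) * jdet b x))
  (2 * zchart b x / jdet b x).

Definition dzchart b x : 'I_n.+1 -> R := ext_last
  (fun j => - (2 * zchart b x * hcoord x j / ((h j ^+ 2 + wchart b x ^+ 2) * jdet b x)))
  (2 * kapc b x * wchart b x / jdet b x).

Section Slopes.
Variables (b : bool) (x : V).
Hypothesis dx : chart_dom b x.
Let w := wchart b x.
Let z := zchart b x.
Let kslope y := kap h x x (wchart b y) w.
Let dslope y := zchart b y * (zchart b y + z) + kslope y * w * (wchart b y + w).

Let kslope_cts : cts kslope x.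
Proof.
have [cw cz] := wzchart_cts dx.
rewrite /kslope /kap; cts_arith.
by rewrite mulf_neq0 ?hw_neq0.
Qed.

Let dslope_cts : cts dslope x.
Proof.
by have [cw cz] := wzchart_cts dx; rewrite /dslope; cts_arith.
Qed.

Let dslopeE : dslope x = jdet b x.
Proof. by rewrite /dslope /jdet /kslope /kapc -/w -/z; ring. Qed.

Let dslope_neq0 : \forall y \near x, dslope y != 0.
Proof.
have d0 : 0 < dslope x by rewrite dslopeE jdet_gt0.
by apply: filterS (cts_gt dslope_cts d0) => y; exact: lt0r_neq0.
Qed.

(** Subtracting w z = x_n and z^2 = [level] at y and at x gives a linear system for the two
    increments with right-hand side (A, B) and determinant [dslope y]; this is Cramer's rule with
    the determinant multiplied out. A and B are linear in y - x with continuous coefficients, so the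
    slopes for [has_grad_slope] can be read off. *)
Let chart_increments y : chart_dom b y ->
  let A := N y - N x in
  let B := - \sum_(i < n) (hcoord y i - hcoord x i) * ((hcoord y i + hcoord x i) / (h i ^+ 2 +
    wchart b y ^+ 2)) in
  (wchart b y - w) * dslope y = (zchart b y + z) * A - w * B /\
  (zchart b y - z) * dslope y = zchart b y * B + kslope y * (wchart b y + w) * A.
Proof.
move=> dy A B.
have BE : B = zchart b y ^+ 2 - z ^+ 2 - kslope y * (wchart b y ^+ 2 - w ^+ 2).
  rewrite /z -!level_wchart// -/w.
  have -> : kslope y * (wchart b y ^+ 2 - w ^+ 2) = level h x (wchart b y) - level h x w.
    by rewrite levelB// mulrC /kslope /kap; congr (_ * _); apply: eq_bigr => i _;
      rewrite [X in _ / X]mulrC.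
  rewrite /level.
  have -> (s1 s2 s3 : R) : 1 - s1 - (1 - s2) - (1 - s3 - (1 - s2)) = - (s1 - s3) by ring.
  rewrite -sumrB; congr (- _); apply: eq_bigr => i _.
  by field; rewrite hw_neq0.
have AE : A = wchart b y * zchart b y - w * z by rewrite /A /w /z !wz_chart.
by rewrite BE AE /dslope; split; ring.
Qed.

Lemma has_grad_wchart : has_grad (wchart b) x (dwchart b x).
Proof.
have [cw cz] := wzchart_cts dx.
have cN := @lastcoord_cts R n x; have ch i := @hcoord_cts R n i x.
have dx0 : dslope x != 0 by rewrite dslopeE gt_eqF// jdet_gt0.
pose phi : 'I_n.+1 -> V -> R := ext_last
  (fun j y => w * ((hcoord y j + hcoord x j) / (h j ^+ 2 + wchart b y ^+ 2)) / dslope y)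
  (fun y => (zchart b y + z) / dslope y).
apply: (@has_grad_ext _ _ (wchart b) x (phi ^~ x)).
  apply: has_grad_slope.
    apply: filterS2 (near_chart_dom dx) dslope_neq0 => y dy d0.
    have [-> _] : wchart b y - wchart b x = ((zchart b y + z) * (N y - N x) - w *
      - \sum_(i < n) (hcoord y i - hcoord x i) * ((hcoord y i + hcoord x i) / (h i ^+ 2 +
        wchart b y ^+ 2))) / dslope y /\ True.
      by split=> //; have [<- _] := chart_increments dy; rewrite mulfK.
    rewrite big_ord_recr/= /phi ext_last_max mulrN opprK mulr_sumr mulrDl mulr_suml addrC.
    congr (_ + _); first by rewrite /lastcoord; ring.
    by apply: eq_bigr => i _; rewrite ext_last_widen /hcoord; ring.
  apply: ord_lastP => [j|]; rewrite /phi ?ext_last_widen ?ext_last_max.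
    change (cts (fun y => w * ((hcoord y j + hcoord x j) / (h j ^+ 2 +
      wchart b y ^+ 2)) / dslope y) x).
    by cts_arith; rewrite ?hw_neq0.
  change (cts (fun y => (zchart b y + z) / dslope y) x).
  by cts_arith.
apply: ord_lastP => [j|]; rewrite /phi /dwchart ?ext_last_widen ?ext_last_max dslopeE -/w -/z.
  by rewrite (invfM (h j ^+ 2 + w ^+ 2)); ring.
by ring.
Qed.

Lemma has_grad_zchart : has_grad (zchart b) x (dzchart b x).
Proof.
have [cw cz] := wzchart_cts dx.
have cN := @lastcoord_cts R n x; have ch i := @hcoord_cts R n i x.
have dx0 : dslope x != 0 by rewrite dslopeE gt_eqF// jdet_gt0.
pose phi : 'I_n.+1 -> V -> R := ext_last
  (fun j y => - (zchart b y * ((hcoord y j + hcoord x j) / (h j ^+ 2 +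
    wchart b y ^+ 2)) / dslope y))
  (fun y => kslope y * (wchart b y + w) / dslope y).
apply: (@has_grad_ext _ _ (zchart b) x (phi ^~ x)).
  apply: has_grad_slope.
    apply: filterS2 (near_chart_dom dx) dslope_neq0 => y dy d0.
    have [-> _] : zchart b y - zchart b x = (zchart b y * - \sum_(i < n) (hcoord y i -
      hcoord x i) * ((hcoord y i + hcoord x i) / (h i ^+ 2 + wchart b y ^+ 2)) + kslope y *
        (wchart b y + w) * (N y - N x)) / dslope y /\ True.
      by split=> //; have [_ <-] := chart_increments dy; rewrite mulfK.
    rewrite big_ord_recr/= /phi ext_last_max mulrN mulr_sumr mulrDl mulNr mulr_suml.
    congr (_ + _); last by rewrite /lastcoord; ring.
    by rewrite -sumrN; apply: eq_bigr => i _; rewrite ext_last_widen /hcoord; ring.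
  apply: ord_lastP => [j|]; rewrite /phi ?ext_last_widen ?ext_last_max.
    change (cts (fun y => - (zchart b y * ((hcoord y j + hcoord x j) / (h j ^+ 2 +
      wchart b y ^+ 2)) / dslope y)) x).
    by cts_arith; rewrite ?hw_neq0.
  change (cts (fun y => kslope y * (wchart b y + w) / dslope y) x).
  by cts_arith.
apply: ord_lastP => [j|]; rewrite /phi /dzchart ?ext_last_widen ?ext_last_max dslopeE -/w -/z.
  by rewrite (invfM (h j ^+ 2 + w ^+ 2)); ring.
by rewrite /kslope /kapc -/w; ring.
Qed.

End Slopes.
End Charts.

(** * The weights *)

Lemma deriv_prod_XaddC {F : fieldType} (m : nat) (k : 'I_m -> F) (v : F) :
  (forall i, v + k i != 0) ->
  (\prod_(i < m) ('X + (k i)%:P))^`().[v] =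
  (\prod_(i < m) ('X + (k i)%:P)).[v] * \sum_(i < m) (v + k i)^-1.
Proof.
elim: m k => [|m IH] k k0; first by rewrite !big_ord0 derivC horner0 mulr0.
rewrite !big_ord_recl derivM derivD derivX derivC addr0 mul1r hornerD !hornerM.
by rewrite IH// !hornerE mulrDr mulrAC divff// mul1r.
Qed.

Section Weights.
Context {R : realType} {n : nat}.
Variable h : 'I_n -> R.
Hypothesis hpos : forall i, 0 < h i.
Hypothesis n2 : (2 <= n)%N.
Implicit Types (u : R) (i : 'I_n).

(** [wt0], [wt i] and [wtlast] are the integrands of [a_zero], [a_coef h i] and, up to sign,
    [a_last]. *)
Definition wt0 u : R := (Num.sqrt (S_poly h).[u ^+ 2])^-1.
Definition wt i u : R := ((u ^+ 2 + h i ^+ 2) * Num.sqrt (S_poly h).[u ^+ 2])^-1.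
Definition wtlast u : R := (S_poly h)^`().[u ^+ 2] / (S_poly h).[u ^+ 2] `^ (3 / 2).

Lemma S_polyE u : (S_poly h).[u ^+ 2] = \prod_(i < n) (u ^+ 2 + h i ^+ 2).
Proof. by rewrite horner_prod; apply: eq_bigr => i _; rewrite !hornerE. Qed.

Lemma uh_gt0 i u : 0 < u ^+ 2 + h i ^+ 2.
Proof. by rewrite addrC hw_gt0. Qed.

Lemma S_poly_gt0 u : 0 < (S_poly h).[u ^+ 2].
Proof. by rewrite S_polyE prodr_gt0// => i _; rewrite uh_gt0. Qed.

Lemma sqrtS_gt0 u : 0 < Num.sqrt (S_poly h).[u ^+ 2].
Proof. by rewrite sqrtr_gt0 S_poly_gt0. Qed.

Lemma wt0_gt0 u : 0 < wt0 u. Proof. by rewrite invr_gt0 sqrtS_gt0. Qed.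

Lemma wtE i u : wt i u = wt0 u / (u ^+ 2 + h i ^+ 2).
Proof. by rewrite /wt invfM mulrC. Qed.

Lemma wt_gt0 i u : 0 < wt i u.
Proof. by rewrite wtE divr_gt0 ?wt0_gt0 ?uh_gt0. Qed.

Lemma deriv_S_poly u : (S_poly h)^`().[u ^+ 2] =
  (S_poly h).[u ^+ 2] * \sum_(i < n) (u ^+ 2 + h i ^+ 2)^-1.
Proof. by apply: deriv_prod_XaddC => i; rewrite gt_eqF// uh_gt0. Qed.

(** S' / S is the sum of the 1 / (u^2 + h_i^2). In the Laplacian this makes the x_n^2 term
    compensate the others. *)
Lemma wtlastE u : wtlast u = \sum_(i < n) wt i u.
Proof.
rewrite /wtlast deriv_S_poly; set s := (S_poly h).[_].
have s0 : 0 < s by exact: S_poly_gt0.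
have -> : s `^ (3 / 2) = s * Num.sqrt s.
  rewrite (_ : 3 / 2 = 1 + 2^-1 :> R); last by field.
  by rewrite powRD ?(gt_eqF s0) ?implybT// powRr1 ?(ltW s0)// powR12_sqrt// ltW.
rewrite -mulf_div divff ?gt_eqF// mul1r mulr_suml; apply: eq_bigr => i _.
by rewrite wtE /wt0 -/s mulrC.
Qed.

Definition hinf : R := (1 + \sum_(i < n) (h i ^+ 2)^-1)^-1.

Lemma hinf_den : 1 <= 1 + \sum_(i < n) (h i ^+ 2)^-1.
Proof. by rewrite lerDl sumr_ge0// => i _; rewrite invr_ge0 sqr_ge0. Qed.

Lemma hinf_gt0 : 0 < hinf.
Proof. by rewrite invr_gt0 (lt_le_trans _ hinf_den). Qed.

Lemma hinf_le1 : hinf <= 1.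
Proof. by rewrite invf_le1 ?hinf_den// (lt_le_trans _ hinf_den). Qed.

Lemma hinf_le i : hinf <= h i ^+ 2.
Proof.
have hi0 : 0 < h i ^+ 2 by rewrite exprn_gt0.
rewrite -[leRHS]invrK lef_pV2 ?posrE ?invr_gt0//; last exact: lt_le_trans hinf_den.
rewrite (bigD1 i)//= addrCA lerDl addr_ge0// sumr_ge0// => j _.
by rewrite invr_ge0 sqr_ge0.
Qed.

Lemma wt_le i u : wt i u <= hinf^-1 * wt0 u.
Proof.
rewrite wtE mulrC ler_wpM2r ?(ltW (wt0_gt0 _))// lef_pV2 ?posrE ?uh_gt0 ?hinf_gt0//.
by rewrite (le_trans (hinf_le i))// lerDr sqr_ge0.
Qed.

Definition wtC : R := (Num.sqrt (hinf ^+ n))^-1.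

Lemma wtC_gt0 : 0 < wtC.
Proof. by rewrite invr_gt0 sqrtr_gt0 exprn_gt0 ?hinf_gt0. Qed.

(** Every factor of S is at least hinf (1 + u^2), because hinf <= 1 and hinf <= h_i^2; with n >= 2
    factors the inverse square root decays at least like 1 / (1 + u^2). *)
Lemma wt0_bound u : wt0 u <= wtC / oneDsqr u.
Proof.
rewrite /wtC -invfM lef_pV2 ?posrE ?sqrtS_gt0 ?mulr_gt0 ?sqrtr_gt0 ?exprn_gt0 ?hinf_gt0
  ?oneDsqr_gt0//.
rewrite -[X in _ * X]ger0_norm ?(ltW (oneDsqr_gt0 _))// -sqrtr_sqr -sqrtrM ?exprn_ge0 ?(ltW
  hinf_gt0)//.
rewrite ler_sqrt ?(ltW (S_poly_gt0 _))// S_polyE (@le_trans _ _ ((hinf * oneDsqr u) ^+ n))//.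
  rewrite exprMn ler_wpM2l ?exprn_ge0 ?(ltW hinf_gt0)//.
  by rewrite ler_weXn2l// oneDsqr_ge1.
rewrite -[n in X in X <= _]card_ord -prodr_const ler_prod// => i _.
rewrite mulr_ge0 ?(ltW hinf_gt0) ?(ltW (oneDsqr_gt0 _))//= /oneDsqr mulrDr mulr1 addrC lerD//.
  by rewrite ler_piMl ?sqr_ge0// hinf_le1.
exact: hinf_le.
Qed.

Lemma wt0_bounds u : 0 <= wt0 u <= wtC / oneDsqr u.
Proof. by rewrite wt0_bound ltW// wt0_gt0. Qed.

Lemma wt_bounds i u : 0 <= wt i u <= hinf^-1 * wtC / oneDsqr u.
Proof.
rewrite ltW ?wt_gt0//= (le_trans (wt_le _ _))// -mulrA ler_wpM2l ?wt0_bound//.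
by rewrite invr_ge0 ltW// hinf_gt0.
Qed.

Lemma wtlast_bounds u : 0 <= wtlast u <= n%:R * (hinf^-1 * wtC) / oneDsqr u.
Proof.
rewrite wtlastE; apply/andP; split; first by apply: sumr_ge0 => i _; rewrite ltW// wt_gt0.
rewrite -mulrA -[n in n%:R]card_ord mulr_natl -sumr_const; apply: ler_sum => i _.
by have /andP[] := wt_bounds i u.
Qed.

(** This is the identity behind the integration by parts that turns u^(-2) [wt0] into [wtlast]. *)
Lemma is_derive_wt0 u : is_derive u (1 : R) wt0 (- u * wtlast u).
Proof.
have dsq := is_derive_sqr u.
have dS := @is_derive1_comp R _ (fun u : R => u ^+ 2) u _ _ (is_derive_poly (S_poly h) (u ^+ 2))
  dsq.
have dsS := @is_derive1_comp R _ (fun u : R => (S_poly h).[u ^+ 2]) u _ _ (is_derive1_sqrt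
  (S_poly_gt0 u)) dS.
have dV := @is_deriveV R _ u _ 1 (lt0r_neq0 (sqrtS_gt0 u)) dsS.
apply: (@is_derive_eq _ _ _ _ _ _ _ _ dV) => /=.
rewrite wtlastE /GRing.scale/= deriv_S_poly.
have -> : \sum_(i < n) wt i u = wt0 u * \sum_(i < n) (u ^+ 2 + h i ^+ 2)^-1.
  by rewrite mulr_sumr; apply: eq_bigr => i _; rewrite wtE.
rewrite /wt0; set s := (S_poly h).[_]; set q := \sum_(i < n) _.
have s0 : 0 < Num.sqrt s by exact: sqrtS_gt0.
rewrite -{3}[s](@sqr_sqrtr R) ?(ltW (S_poly_gt0 _))//.
by field; rewrite gt_eqF.
Qed.

Lemma wt0_continuous : continuous wt0.
Proof.
by move=> u; apply/differentiable_continuous/derivable1_diffP; case: (is_derive_wt0 u).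
Qed.

Lemma wt_continuous i : continuous (wt i).
Proof.
move=> u; have c0 : cts wt0 u by exact: wt0_continuous.
have cid : cts (fun w : R => w) u by exact: cvg_id.
rewrite (_ : wt i = fun u => wt0 u / (u ^+ 2 + h i ^+ 2)); last first.
  by apply/funext => v; rewrite wtE.
change (cts (fun u => wt0 u / (u ^+ 2 + h i ^+ 2)) u).
by cts_arith; rewrite gt_eqF// uh_gt0.
Qed.

Lemma wtlast_continuous : continuous wtlast.
Proof.
move=> u; rewrite (_ : wtlast = fun u => \sum_(i < n) wt i u); last first.
  by apply/funext => v; rewrite wtlastE.
change (cts (fun u => \sum_(i < n) wt i u) u).
by apply: cts_sum => i; exact: wt_continuous.
Qed.

Definition is_derive_prim_wt0 w := is_derive_prim w wt0_continuous wt0_bounds.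
Definition is_derive_prim_wt i w := is_derive_prim w (@wt_continuous i) (wt_bounds i).
Definition is_derive_prim_wtlast w := is_derive_prim w wtlast_continuous wtlast_bounds.

Lemma prim_wtlast w : prim wtlast w = \sum_(i < n) prim (wt i) w.
Proof.
pose A w := prim wtlast w - \sum_(i < n) prim (wt i) w.
have dA u : is_derive u (1 : R) A (wtlast u - \sum_(i < n) wt i u).
  apply: is_deriveB; first exact: is_derive_prim_wtlast.
  have := @is_derive_sum R R R n (fun i => prim (wt i)) u 1 (fun i => wt i u) (fun i =>
    is_derive_prim_wt i u).
  by rewrite (_ : \sum_(i < n) prim (wt i) = fun w => \sum_(i < n) prim (wt i) w)//;
    apply/funext => v; rewrite fct_sumE.
have := @derive_le_bound R A _ w 0 dA.
rewrite mul0r normr_le0 {2}/A prim0 big1 ?subrr ?subr0 => [|i _]; last exact: prim0.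
move=> H; apply/eqP; rewrite -subr_eq0; apply: H => u _.
by rewrite wtlastE subrr normr0.
Qed.

Lemma wt0_tail u : 0 < u -> wt0 u <= (u ^+ n)^-1.
Proof.
move=> u0; rewrite lef_pV2 ?posrE ?sqrtS_gt0 ?exprn_gt0//.
rewrite -[leLHS]ger0_norm ?exprn_ge0 ?(ltW u0)// -sqrtr_sqr ler_sqrt ?(ltW (S_poly_gt0 _))//.
rewrite S_polyE -exprM mulnC exprM -[n in X in X <= _]card_ord -prodr_const ler_prod// => i _.
by rewrite sqr_ge0 lerDl sqr_ge0.
Qed.

Lemma wt_tail i u : 0 < u -> wt i u <= (u ^+ n.+2)^-1.
Proof.
move=> u0; have -> : u ^+ n.+2 = u ^+ n * u ^+ 2 by rewrite -exprD addn2.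
rewrite wtE invfM ler_pM ?invr_ge0 ?(ltW (wt0_gt0 _)) ?(ltW (uh_gt0 _ _))//.
  exact: wt0_tail.
by rewrite lef_pV2 ?posrE ?uh_gt0 ?exprn_gt0// lerDl sqr_ge0.
Qed.

Lemma prim_wt0_tail w : 0 < w ->
  0 <= \int[lebesgue_measure]_(u in `[0, +oo[) wt0 u - prim wt0 w <= (w ^+ n.-1)^-1.
Proof.
move=> w0; have n1 : n.-2.+2 = n by case: (n) n2 => [|[]].
have k0 : 0 <= n.-2.+1%:R^-1 :> R by [].
(* [prim_tail] is applied with m = n - 2, legitimate since n >= 2; its factor 1 / (n - 1) is dropped
   afterwards. *)
have H u : 0 < u -> wt0 u <= n.-2.+1%:R^-1 * (n.-2.+1%:R * (u ^+ n.-2.+2)^-1).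
  by move=> u0; rewrite mulrA mulVf ?mul1r ?n1 ?wt0_tail// pnatr_eq0.
have /andP[-> le] := prim_tail wt0_continuous wt0_bounds H k0 w0.
rewrite (le_trans le)//.
rewrite (_ : n.-2.+1 = n.-1); last by case: (n) n2 => [|[]].
by rewrite ler_piMl ?invr_ge0 ?exprn_ge0 ?(ltW w0)// invf_le1 ?ler1n ?ltr0n//;
  case: (n) n2 => [|[]].
Qed.

Lemma prim_wt_tail i w : 0 < w ->
  0 <= \int[lebesgue_measure]_(u in `[0, +oo[) wt i u - prim (wt i) w <= (w ^+ n.+1)^-1.
Proof.
move=> w0; have k0 : 0 <= n.+1%:R^-1 :> R by [].
have H u : 0 < u -> wt i u <= n.+1%:R^-1 * (n.+1%:R * (u ^+ n.+2)^-1).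
  by move=> u0; rewrite mulrA mulVf ?mul1r ?wt_tail// pnatr_eq0.
have /andP[-> le] := prim_tail (@wt_continuous i) (wt_bounds i) H k0 w0.
rewrite (le_trans le)//.
by rewrite ler_piMl ?invr_ge0 ?exprn_ge0 ?(ltW w0)// invf_le1 ?ler1n ?ltr0n.
Qed.

Lemma prim_wtlast_tail w : 0 < w ->
  0 <= \int[lebesgue_measure]_(u in `[0, +oo[) wtlast u - prim wtlast w <= n%:R * (w ^+ n.+1)^-1.
Proof.
move=> w0; have k0 : 0 <= n%:R / n.+1%:R :> R by rewrite divr_ge0.
have H u : 0 < u -> wtlast u <= n%:R / n.+1%:R * (n.+1%:R * (u ^+ n.+2)^-1).
  move=> u0; rewrite mulrA divfK ?pnatr_eq0// wtlastE mulr_natl -[n in _ *+ n]card_ord -sumr_const.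
  by apply: ler_sum => i _; exact: wt_tail.
have /andP[-> le] := prim_tail wtlast_continuous wtlast_bounds H k0 w0.
rewrite (le_trans le)//.
by rewrite ler_wpM2r ?invr_ge0 ?exprn_ge0 ?(ltW w0)// ler_pdivrMr ?ltr0n// ler_peMr// ler1n.
Qed.

End Weights.

(** * The potential *)

Section Solution.
Context {R : realType} {n : nat}.
Variable h : 'I_n -> R.
Hypothesis hpos : forall i, 0 < h i.
Hypothesis n2 : (2 <= n)%N.
Local Notation V := 'rV[R]_n.+1.
Implicit Types (x y : V) (b : bool).
Local Notation N := (lastcoord (R := R) (n := n)).

Definition hprod2 : R := (\prod_(j < n) h j) / 2.

Lemma hprod2_gt0 : 0 < hprod2.
Proof. by rewrite divr_gt0// prodr_gt0. Qed.

(* The potential of the focal ellipsoid integrated from 0 to w instead of from w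
   to infinity; an integration by parts has removed the divergent integral of
   u^(-2), leaving the term x_n z / sqrt (S (w^2)). *)
Definition potential x (w z : R) : R := hprod2 *
  (prim (wt0 h) w - \sum_(i < n) hcoord x i ^+ 2 * prim (wt h i) w
   + N x * z * wt0 h w + N x ^+ 2 * prim (wtlast h) w).

Definition fchart b x : R := potential x (wchart h b x) (zchart h b x).

Definition dfchart b (i : 'I_n.+1) x : R := ext_last
  (fun k x => - (2 * hprod2 * (hcoord x k * prim (wt h k) (wchart h b x))))
  (fun x => 2 * hprod2 * (zchart h b x * wt0 h (wchart h b x) +
     N x * prim (wtlast h) (wchart h b x))) i x.

Definition ddfchart b (i j : 'I_n.+1) x : R := ext_last
  (fun k x => - (2 * hprod2 * ((widen_ord (leqnSn n) k == j)%:R * prim (wt h k) (wchart h b x)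
     + hcoord x k * (dwchart h b x j * wt h k (wchart h b x)))))
  (fun x => 2 * hprod2 * (dzchart h b x j * wt0 h (wchart h b x) +
     zchart h b x * (dwchart h b x j * (- wchart h b x * wtlast h (wchart h b x))) +
     ((ord_max == j)%:R * prim (wtlast h) (wchart h b x) +
     N x * (dwchart h b x j * wtlast h (wchart h b x))))) i x.

Lemma has_grad_hcoord x (k : 'I_n) :
  has_grad (hcoord ^~ k) x (fun i => (widen_ord (leqnSn n) k == i)%:R).
Proof. exact: has_grad_coord. Qed.

Lemma has_grad_lastcoord x : has_grad N x (fun i => (ord_max == i)%:R).
Proof. exact: has_grad_coord. Qed.

(** This is the derivative of w z = x_n in the i-th direction. *)
Lemma wz_jac b x i : chart_dom h b x ->
  dwchart h b x i * zchart h b x + wchart h b x * dzchart h b x i = (ord_max == i)%:R.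
Proof.
move=> dx; have D0 := lt0r_neq0 (jdet_gt0 hpos dx).
move: i; apply: ord_lastP => [j|]; rewrite /dwchart /dzchart ?ext_last_widen ?ext_last_max.
  by rewrite max_eq_widen /= mulr0n (invfM (h j ^+ 2 + _)); ring.
rewrite eqxx mulr1n; set D := jdet h b x in D0 *.
transitivity (2 * (zchart h b x ^+ 2 + kapc h b x * wchart h b x ^+ 2) / D); first by ring.
by rewrite -/(jdet h b x) divff.
Qed.

(** Both sides equal 2 kap w / jdet. The Laplacian needs this identity to cancel its [wt0] terms. *)
Lemma dzchart_last b x : chart_dom h b x ->
  dzchart h b x ord_max = \sum_(k < n) hcoord x k * dwchart h b x (widen_ord (leqnSn n) k) /
    (wchart h b x ^+ 2 + h k ^+ 2).
Proof.
move=> dx; rewrite /dzchart ext_last_max /kapc /kap.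
rewrite (mulrC 2) -!mulrA mulr_suml; apply: eq_bigr => k _.
have D0 := lt0r_neq0 (jdet_gt0 hpos dx).
rewrite /dwchart ext_last_widen (addrC (wchart h b x ^+ 2)).
by field; rewrite D0 hw_neq0.
Qed.

(** The derivative through w and z collapses: the first two terms of the potential give z^2 [wt0] dw
    by the definition of [level], the two [wtlast] terms cancel since x_n = w z, and the remaining z
    [wt0] (z dw + w dz) is reduced by [wz_jac] to z [wt0] in the last direction. No derivative of w
    or z survives. *)
Lemma has_grad_fchart b x : chart_dom h b x -> has_grad (fchart b) x (dfchart b ^~ x).
Proof.
move=> dx.
have gw := has_grad_wchart hpos dx; have gz := has_grad_zchart hpos dx.
have gN := has_grad_lastcoord x.
set w := wchart h b x in gw *.
have g0 := has_grad_comp gw (is_derive_prim_wt0 hpos n2 w).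
have gk k := has_grad_comp gw (is_derive_prim_wt hpos n2 k w).
have gl := has_grad_comp gw (is_derive_prim_wtlast hpos n2 w).
have gw0 := has_grad_comp gw (is_derive_wt0 hpos w).
have gs k := has_gradM (has_gradM (has_grad_hcoord x k) (has_grad_hcoord x k)) (gk k).
have := has_gradM (has_gradC hprod2 x) (has_gradD (has_gradD (has_gradD g0 (has_gradN (has_grad_sum
  gs))) (has_gradM (has_gradM gN gz) gw0)) (has_gradM (has_gradM gN gN) gl)).
move=> H; apply: (has_grad_ext H) => i; rewrite mul0r add0r.
have jac := wz_jac i dx; rewrite -/w in jac.
have lev := level_wchart hpos dx; rewrite -/w in lev.
have wzN := wz_chart hpos b x; rewrite -/w in wzN.
set z := zchart h b x in jac lev wzN *.
set dw := dwchart h b x i in jac *; set dz := dzchart h b x i in jac *.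
have sumE : \sum_(k < n) (((widen_ord (leqnSn n) k == i)%:R * hcoord x k + hcoord x k *
  (widen_ord (leqnSn n) k == i)%:R) * prim (wt h k) w + hcoord x k * hcoord x k * (dw *
    wt h k w)) = 2 * \sum_(k < n) (widen_ord (leqnSn n) k == i)%:R * (hcoord x k *
      prim (wt h k) w) + dw * wt0 h w * (1 - z ^+ 2).
  rewrite -lev /level subKr !mulr_sumr -big_split/=; apply: eq_bigr => k _.
  by rewrite wtE (addrC (w ^+ 2)); ring.
rewrite sumE -wzN {sumE}.
have -> (c W0 S d Kp L : R) : c * (dw * W0 + - (2 * S + dw * W0 * (1 - z ^+ 2)) +
   ((d * z + w * z * dz) * W0 + w * z * z * (dw * (- w * L))) +
   ((d * (w * z) + w * z * d) * Kp + w * z * (w * z) * (dw * L))) =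
   c * (- (2 * S) + z * W0 * (dw * z + w * dz) + d * z * W0 + 2 * (d * (w * z) * Kp)) by ring.
rewrite jac {H gs gw0 gl gk g0 gw gz gN jac}.
move: i dw dz; apply: ord_lastP => [k|] _ _; rewrite /dfchart ?ext_last_widen ?ext_last_max -/w.
  rewrite max_eq_widen (bigD1 k)//= eqxx big1 => [|l /negPf lk]; last by rewrite widen_eq lk mul0r.
  by rewrite /= mulr0n mulr1n; ring.
rewrite eqxx big1 => [|l _]; last by rewrite widen_eq_max mul0r.
by rewrite -/z -wzN /= mulr1n; ring.
Qed.

Lemma has_grad_dfchart b x i : chart_dom h b x ->
  has_grad (dfchart b i) x (ddfchart b i ^~ x).
Proof.
move=> dx.
have gw := has_grad_wchart hpos dx; have gz := has_grad_zchart hpos dx.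
have gN := has_grad_lastcoord x.
have gk k := has_grad_comp gw (is_derive_prim_wt hpos n2 k _).
have gl := has_grad_comp gw (is_derive_prim_wtlast hpos n2 _).
have gw0 := has_grad_comp gw (is_derive_wt0 hpos _).
move: i; apply: ord_lastP => [k|].
  have -> : dfchart b (widen_ord (leqnSn n) k) = fun x => - (2 * hprod2 * (hcoord x k *
    prim (wt h k) (wchart h b x))).
    by apply/funext => y; rewrite /dfchart ext_last_widen.
  have H := has_gradN (has_gradM (has_gradC (2 * hprod2) x) (has_gradM (has_grad_hcoord x k) (gk
    k))).
  by apply: (has_grad_ext H) => j; rewrite /ddfchart ext_last_widen mul0r add0r.
have -> : dfchart b ord_max = fun x => 2 * hprod2 * (zchart h b x * wt0 h (wchart h b x) +
     N x * prim (wtlast h) (wchart h b x)).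
  by apply/funext => y; rewrite /dfchart ext_last_max.
have H := has_gradM (has_gradC (2 * hprod2) x) (has_gradD (has_gradM gz gw0) (has_gradM gN gl)).
by apply: (has_grad_ext H) => j; rewrite /ddfchart ext_last_max mul0r add0r.
Qed.

Lemma prim_cts (g : R -> R) (G : R -> R) (w : R) : is_derive w (1 : R) G (g w) -> cts G w.
Proof. by move=> H; apply/differentiable_continuous/derivable1_diffP; case: H. Qed.

Lemma ddfchart_cts b x i j : chart_dom h b x -> cts (ddfchart b i j) x.
Proof.
move=> dx; have [cw cz] := wzchart_cts hpos dx.
have cN := @lastcoord_cts R n x; have ch k := @hcoord_cts R n k x.
have cp0 : cts (fun y => wt0 h (wchart h b y)) x.
  by apply: cts_comp => //; exact: wt0_continuous.
have cpl : cts (fun y => wtlast h (wchart h b y)) x.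
  by apply: cts_comp => //; exact: wtlast_continuous.
have cpk k : cts (fun y => wt h k (wchart h b y)) x.
  by apply: cts_comp => //; exact: wt_continuous.
have cGl : cts (fun y => prim (wtlast h) (wchart h b y)) x.
  by apply: cts_comp => // w; exact: prim_cts (is_derive_prim_wtlast hpos n2 w).
have cGk k : cts (fun y => prim (wt h k) (wchart h b y)) x.
  by apply: cts_comp => // w; exact: prim_cts (is_derive_prim_wt hpos n2 k w).
have D0 := lt0r_neq0 (jdet_gt0 hpos dx).
have ckap : cts (kapc h b) x.
  by rewrite /kapc /kap; cts_arith; rewrite mulf_neq0 ?hw_neq0.
have cD : cts (jdet h b) x by rewrite /jdet; cts_arith.
have cdw : cts (fun y => dwchart h b y j) x.
  move: j; apply: ord_lastP => [k|].
    rewrite (_ : (fun y => _) = (fun y => 2 * wchart h b y * hcoord y k / ((h k ^+ 2 +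
      wchart h b y ^+ 2) * jdet h b y))).
      by cts_arith; rewrite mulf_neq0 ?hw_neq0.
    by apply/funext => y; rewrite /dwchart ext_last_widen.
  rewrite (_ : (fun y => _) = (fun y => 2 * zchart h b y / jdet h b y)); first by cts_arith.
  by apply/funext => y; rewrite /dwchart ext_last_max.
have cdz : cts (fun y => dzchart h b y j) x.
  move: j {cdw}; apply: ord_lastP => [k|].
    rewrite (_ : (fun y => _) = (fun y => - (2 * zchart h b y * hcoord y k / ((h k ^+ 2 +
      wchart h b y ^+ 2) * jdet h b y)))).
      by cts_arith; rewrite mulf_neq0 ?hw_neq0.
    by apply/funext => y; rewrite /dzchart ext_last_widen.
  rewrite (_ : (fun y => _) = (fun y => 2 * kapc h b y * wchart h b y / jdet h b y));
    first by cts_arith.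
  by apply/funext => y; rewrite /dzchart ext_last_max.
move: i; apply: ord_lastP => [k|].
  rewrite (_ : ddfchart b _ j = fun x => - (2 * hprod2 * ((widen_ord (leqnSn n) k == j)%:R *
    prim (wt h k) (wchart h b x)
     + hcoord x k * (dwchart h b x j * wt h k (wchart h b x))))); first by cts_arith.
  by apply/funext => y; rewrite /ddfchart ext_last_widen.
rewrite (_ : ddfchart b _ j = fun x => 2 * hprod2 * (dzchart h b x j * wt0 h (wchart h b x) +
     zchart h b x * (dwchart h b x j * (- wchart h b x * wtlast h (wchart h b x))) +
     ((ord_max == j)%:R * prim (wtlast h) (wchart h b x) +
     N x * (dwchart h b x j * wtlast h (wchart h b x))))); first by cts_arith.
by apply/funext => y; rewrite /ddfchart ext_last_max.
Qed.

(** In the trace of [ddfchart] the terms with [wtlast] itself cancel by x_n = w z. What is left in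
    the last entry, dz [wt0] plus the primitive of [wtlast], splits over k by [dzchart_last] and
    [prim_wtlast], and its k-th summand cancels the k-th entry. *)
Lemma fchart_harmonic b :
  class_C 2 (chart_dom h b) (fchart b) /\
  forall x, chart_dom h b x -> laplacian (fchart b) x = 0.
Proof.
have [C2 lapE] := @has_grad_class_C2 R n (chart_dom h b) (fchart b) (dfchart b) (ddfchart b)
  (@chart_dom_open _ _ h b) (@has_grad_fchart b) (fun x i dx => @has_grad_dfchart b x i dx)
  (fun x i j dx => @ddfchart_cts b x i j dx).
split; [exact: C2|move=> x dx]; rewrite /laplacian.
have -> : \sum_i 'D_(basis_vec i) ('D_(basis_vec i) (fchart b)) x = \sum_i ddfchart b i i x.
  by apply: eq_bigr => i _; exact: lapE.
rewrite big_ord_recr; cbv beta.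
rewrite /ddfchart ext_last_max eqxx mul1r prim_wtlast// dzchart_last//.
under eq_bigr do rewrite ext_last_widen eqxx mul1r.
have wzN := wz_chart hpos b x.
set w := wchart h b x in wzN *; set z := zchart h b x in wzN *.
rewrite -wzN.
have -> (c S W0 dw K L : R) : 2 * c * (S * W0 + z * (dw * (- w * L)) + (K + w * z * (dw * L))) =
  2 * c * (S * W0 + K) by ring.
rewrite mulr_suml -big_split/= mulr_sumr -big_split/= big1// => k _.
by rewrite wtE; ring.
Qed.

End Solution.

(** * Geometry of the ellipsoid *)

Section Coordinates.
Context {R : realType} {n : nat}.
Local Notation V := 'rV[R]_n.+1.
Implicit Types (u v : V).
Local Notation N := (lastcoord (R := R) (n := n)).

Lemma vec_eqP u v : (forall j, hcoord u j = hcoord v j) -> N u = N v -> u = v.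
Proof. by move=> hE NE; apply/rowP; apply: ord_lastP. Qed.

Definition mkvec (a : 'I_n -> R) (b : R) : V := \row_i ext_last a b i.

Lemma hcoord_mk a b j : hcoord (mkvec a b) j = a j.
Proof. by rewrite /hcoord mxE ext_last_widen. Qed.

Lemma last_mk a b : N (mkvec a b) = b.
Proof. by rewrite /lastcoord mxE ext_last_max. Qed.

Lemma hcoordD u v j : hcoord (u + v) j = hcoord u j + hcoord v j.
Proof. by rewrite /hcoord mxE. Qed.

Lemma hcoordZ (a : R) v j : hcoord (a *: v) j = a * hcoord v j.
Proof. by rewrite /hcoord mxE. Qed.

Lemma hcoordN v j : hcoord (- v) j = - hcoord v j.
Proof. by rewrite /hcoord mxE. Qed.

Lemma lastD u v : N (u + v) = N u + N v.
Proof. by rewrite /lastcoord mxE. Qed.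

Lemma lastZ (a : R) v : N (a *: v) = a * N v.
Proof. by rewrite /lastcoord mxE. Qed.

Lemma lastN v : N (- v) = - N v.
Proof. by rewrite /lastcoord mxE. Qed.

Definition coordE := (hcoordD, hcoordZ, hcoordN, lastD, lastZ, lastN, hcoord_mk, last_mk).

Lemma dotE u v : dot u v = \sum_(j < n) hcoord u j * hcoord v j + N u * N v.
Proof. by rewrite /dot big_ord_recr. Qed.

Lemma dot_ge0 u : 0 <= dot u u.
Proof. by apply: sumr_ge0 => i _; rewrite -expr2 sqr_ge0. Qed.

Lemma dot_eq0 u : dot u u = 0 -> u = 0.
Proof.
move=> /eqP; rewrite psumr_eq0 => [/allP u0|i _]; last by rewrite -expr2 sqr_ge0.
apply/rowP => i; rewrite mxE; have := u0 i (mem_index_enum i).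
by rewrite mulf_eq0 orbb => /eqP.
Qed.

Lemma dotC u v : dot u v = dot v u.
Proof. by apply: eq_bigr => i _; rewrite mulrC. Qed.

Lemma dotDl u v w : dot (u + v) w = dot u w + dot v w.
Proof. by rewrite /dot -big_split; apply: eq_bigr => i _; rewrite mxE mulrDl. Qed.

Lemma dotZl (a : R) u w : dot (a *: u) w = a * dot u w.
Proof. by rewrite /dot mulr_sumr; apply: eq_bigr => i _; rewrite mxE mulrA. Qed.

Lemma dotDr u v w : dot w (u + v) = dot w u + dot w v.
Proof. by rewrite dotC dotDl !(dotC w). Qed.

Lemma dotZr (a : R) u w : dot w (a *: u) = a * dot w u.
Proof. by rewrite dotC dotZl (dotC w). Qed.

Lemma enorm_sqr u : enorm u ^+ 2 = dot u u.
Proof. by rewrite sqr_sqrtr ?dot_ge0. Qed.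

Definition eN : V := mkvec (fun=> 0) 1.

Lemma dot_eN u : dot u eN = N u.
Proof.
by rewrite dotE last_mk mulr1 big1 ?add0r// => j _; rewrite hcoord_mk mulr0.
Qed.

Lemma cts_mx (T : topologicalType) p q (M : T -> 'M[R]_(p, q)) (t : T) :
  (forall i j, cts (fun s => M s i j) t) -> M @ t --> M t.
Proof.
move=> cM P [F FM FP].
have : \forall s \near t, forall i j, F i j (M s i j).
  apply: (@filter_forall _ _ _ (nbhs t) _) => i.
  apply: (@filter_forall _ _ _ (nbhs t) _) => j.
  exact: (cM i j _ (FM i j)).
by apply: filterS => s Fs; apply: FP.
Qed.

Lemma has_grad_diff (f : V -> R) (x v : V) d : has_grad f x d -> 'd f x v = \sum_i v 0 i * d i.
Proof.
move=> [df fd]; rewrite [v in LHS]row_sum_delta linear_sum; apply: eq_bigr => i _.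
by rewrite linearZ/= -fd deriveE.
Qed.
End Coordinates.

Section Ellipsoid.
Context {R : realType} {n : nat}.
Variable h : 'I_n -> R.
Hypothesis hpos : forall i, 0 < h i.
Local Notation V := 'rV[R]_n.+1.
Implicit Types (x y q v w : V).
Local Notation N := (lastcoord (R := R) (n := n)).
Local Notation E := (ellipsoid h).

Lemma ellipsoidP x : E x <-> quad h x = 1 /\ N x = 0. Proof. by []. Qed.

Lemma has_grad_quad x : has_grad (quad h) x (ext_last (fun j => 2 * (hcoord x j / h j ^+ 2)) 0).
Proof.
have H j := has_gradM (has_gradM (has_grad_hcoord x j) (has_grad_hcoord x j)) (has_gradC (h j ^+
  2)^-1 x).
apply: (has_grad_ext (has_grad_sum H)); apply: ord_lastP => [j|]; last first.
  by rewrite ext_last_max big1// => k _; rewrite widen_eq_max /= mulr0n /cst; ring.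
rewrite ext_last_widen (bigD1 j)//= big1 => [|k /negPf kj].
  by rewrite eqxx mulr1n /cst; ring.
by rewrite widen_eq kj mulr0n /cst; ring.
Qed.

(** A quarter of the squared length of the gradient of [quad]; [bnorm] is the number k of the
    overview. *)
Definition beta q : R := \sum_(j < n) (hcoord q j / h j ^+ 2) ^+ 2.
Definition bnorm q : R := Num.sqrt (beta q).

Lemma h2_gt0 j : 0 < h j ^+ 2. Proof. by rewrite exprn_gt0. Qed.

Lemma quadZ a x : quad h (a *: x) = a ^+ 2 * quad h x.
Proof. by rewrite mulr_sumr; apply: eq_bigr => j _; rewrite hcoordZ; ring. Qed.

Lemma beta_ge q : (hsup h)^-1 * quad h q <= beta q.
Proof.
rewrite mulr_sumr; apply: ler_sum => j _.
rewrite exprMn mulrCA ler_wpM2l ?sqr_ge0// expr2 ler_wpM2r ?invr_ge0 ?sqr_ge0//.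
by rewrite lef_pV2 ?posrE ?h2_gt0 ?hsup_gt0 ?le_hsup.
Qed.

Lemma beta_le q : beta q <= (hinf h)^-1 * quad h q.
Proof.
rewrite mulr_sumr; apply: ler_sum => j _.
rewrite exprMn [leRHS]mulrCA ler_wpM2l ?sqr_ge0// expr2 ler_wpM2r ?invr_ge0 ?sqr_ge0//.
by rewrite lef_pV2 ?posrE ?h2_gt0 ?hinf_gt0 ?hinf_le.
Qed.

Lemma beta_gt0 q : E q -> 0 < beta q.
Proof.
move=> [Eq _]; apply: lt_le_trans (beta_ge q).
by rewrite [quad h q]Eq mulr1 invr_gt0 hsup_gt0.
Qed.

Lemma bnorm_gt0 q : E q -> 0 < bnorm q.
Proof. by move=> Eq; rewrite sqrtr_gt0 beta_gt0. Qed.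

Lemma bnorm_sqr q : bnorm q ^+ 2 = beta q.
Proof. by rewrite sqr_sqrtr// sumr_ge0// => j _; rewrite sqr_ge0. Qed.

Lemma bnorm_ge q : E q -> (hsup h)^-1 <= bnorm q.
Proof.
move=> Eq; have H1 := hsup_ge1 h; have H0 := hsup_gt0 h.
have i0 : 0 <= (hsup h)^-1 by rewrite invr_ge0 ltW.
rewrite -[leLHS]ger0_norm// -sqrtr_sqr ler_sqrt ?(ltW (beta_gt0 Eq))//.
apply: le_trans (beta_ge q); have [-> _] := (ellipsoidP q).1 Eq.
by rewrite mulr1 expr2 ler_piMl// invf_le1.
Qed.

(** The outer unit normal of the ellipsoid inside the hyperplane; together with [eN] it spans the
    normal plane. *)
Definition nu q : V := mkvec (fun j => hcoord q j / h j ^+ 2 / bnorm q) 0.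

Lemma dot_nu q v : dot v (nu q) = (\sum_(j < n) hcoord v j * (hcoord q j / h j ^+ 2)) / bnorm q.
Proof.
rewrite dotE last_mk mulr0 addr0 mulr_suml; apply: eq_bigr => j _.
by rewrite hcoord_mk mulrA.
Qed.

Lemma dot_nunu q : E q -> dot (nu q) (nu q) = 1.
Proof.
move=> Eq; rewrite dot_nu; have b0 := lt0r_neq0 (bnorm_gt0 Eq).
under eq_bigr do rewrite hcoord_mk mulrAC -expr2.
by rewrite -mulr_suml -/(beta q) -bnorm_sqr; field.
Qed.

Lemma last_nu q : N (nu q) = 0. Proof. by rewrite last_mk. Qed.

Lemma tangent_vecP q v : E q ->
  tangent_vec E q v <-> dot v (nu q) = 0 /\ N v = 0.
Proof.
move=> Eq; have b0 := bnorm_gt0 Eq; split.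
  move=> [gamma [g0 gE dg]].
  have dgam : differentiable gamma 0 by apply/derivable1_diffP; case: dg.
  (* A function constant on the ellipsoid has zero derivative along the curve; this is applied to
     [quad] and to x_n. *)
  have comp0 (f : V -> R) d c : has_grad f q d -> (forall x, E x -> f x = c) ->
      \sum_i v 0 i * d i = 0.
    move=> fd fc; have [df _] := fd; rewrite -(has_grad_diff v fd).
    have df' : differentiable f (gamma 0) by rewrite g0.
    have dcomp := diff_comp dgam df'; rewrite g0 in dcomp.
    have -> : v = 'd gamma 0 1 by rewrite -deriveE//; case: dg.
    have -> : 'd f q ('d gamma 0 1) = 'd (f \o gamma) 0 1 by rewrite dcomp.
    rewrite -deriveE; last by apply: differentiable_comp.
    rewrite -(@near_eq_derive _ _ _ (cst c)); first exact: derive_cst.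
    by apply: filterS gE => t Et /=; rewrite fc.
  have := comp0 _ _ 1 (has_grad_quad q) (fun x Ex => (proj1 Ex)).
  have := comp0 _ _ 0 (has_grad_lastcoord q) (fun x Ex => (proj2 Ex)).
  rewrite !big_ord_recr/= ext_last_max mulr0 addr0 eqxx mulr1 big1 => [|j _]; last first.
    by rewrite max_eq_widen mulr0.
  rewrite add0r => Nv; rewrite dot_nu => H; split=> //.
  have : 2 * \sum_(j < n) hcoord v j * (hcoord q j / h j ^+ 2) = 0.
    rewrite mulr_sumr -[RHS]H; apply: eq_bigr => j _.
    by rewrite ext_last_widen /hcoord; ring.
  by move/eqP; rewrite mulf_eq0 pnatr_eq0/= => /eqP ->; rewrite mul0r.
move=> [vn Nv].
have cross : \sum_(j < n) hcoord v j * (hcoord q j / h j ^+ 2) = 0.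
  by move/eqP: vn; rewrite dot_nu mulf_eq0 invr_eq0 (gt_eqF b0) orbF => /eqP.
have quad_line t : quad h (q + t *: v) = 1 + t ^+ 2 * quad h v.
  case: Eq => Qq _; transitivity (quad h q + 2 * t * 0 + t ^+ 2 * quad h v).
    rewrite -cross !mulr_sumr -!big_split/=.
    by apply: eq_bigr => j _; rewrite !coordE; ring.
  by rewrite [quad h q]Qq mulr0 addr0.
have qv0 : 0 <= quad h v by apply: sumr_ge0 => j _; rewrite divr_ge0 ?sqr_ge0.
have ql_gt0 t : 0 < quad h (q + t *: v) by rewrite quad_line ltr_wpDr // mulr_ge0 // sqr_ge0.
(* A tangent vector is realised by the line q + t v projected radially back; since [quad] has no
   linear term along the line, s'(0) = 0 and the velocity is v. *)
pose s (t : R) := (Num.sqrt (1 + t ^+ 2 * quad h v))^-1.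
exists (fun t => s t *: q + (t * s t) *: v); split.
- by rewrite /s expr0n/= !mul0r addr0 sqrtr1 invr1 scale1r scale0r addr0.
- near=> t; have -> : s t *: q + (t * s t) *: v = s t *: (q + t *: v).
    by rewrite scalerDr scalerA (mulrC t).
  case: Eq => _ Nq; split; last by rewrite !coordE Nq Nv !mulr0 addr0 mulr0.
  rewrite -[LHS]/(quad h _) quadZ quad_line /s exprVn sqr_sqrtr ?mulVf//.
    by rewrite gt_eqF// -quad_line.
  by rewrite -quad_line ltW.
have ds : is_derive (0 : R) (1 : R) s 0.
  have dsq : is_derive (0 : R) (1 : R) (fun t : R => 1 + t ^+ 2 * quad h v) 0.
    have H1 := is_deriveD (is_derive_cst (1 : R) (0 : R) (1 : R)) (@is_deriveM R R (fun t : R => t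
      ^+ 2) (cst (quad h v)) 0 1 _ _ (is_derive_sqr 0) (is_derive_cst _ _ _)).
    apply: (@is_derive_eq _ _ _ _ _ _ _ _ H1).
    by rewrite !mulr0 !scaler0 !addr0.
  have pos : 0 < 1 + (0 : R) ^+ 2 * quad h v by rewrite expr0n/= mul0r addr0.
  have d1 := @is_derive1_comp R _ (fun t : R => 1 + t ^+ 2 *
    quad h v) 0 _ _ (is_derive1_sqrt pos) dsq.
  have sp : Num.sqrt (1 + (0 : R) ^+ 2 * quad h v) != 0 by rewrite gt_eqF// sqrtr_gt0.
  have d2 := @is_deriveV R _ 0 _ 1 sp d1.
  apply: (@is_derive_eq _ _ _ _ _ _ _ _ d2).
  by rewrite mulr0 scaler0.
have s0 : s 0 = 1 by rewrite /s expr0n/= mul0r addr0 sqrtr1 invr1.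
have dts : is_derive (0 : R) (1 : R) (fun t : R => t * s t) 1.
  have H1 := is_deriveM (is_derive_id (0 : R) (1 : R)) ds.
  apply: (@is_derive_eq _ _ _ _ _ _ _ _ H1).
  by rewrite s0 scaler0 add0r /GRing.scale/= mulr1.
have dscale (k : R -> R) (u : V) k' : is_derive (0 : R) (1 : R) k k' ->
  is_derive (0 : R) (1 : R) (fun t => k t *: u) (k' *: u).
  move=> [/derivable1_diffP dk kE].
  have dku := differentiableZl u dk.
  apply: DeriveDef; first by apply: diff_derivable.
  by rewrite deriveE// diffZl// -deriveE// kE.
have := is_deriveD (dscale _ q _ ds) (dscale _ v _ dts).
by rewrite scale0r add0r scale1r.
Unshelve. all: by end_near. Qed.

Lemma normal_vecP q w : E q ->
  normal_vec E q w <-> exists a b, w = a *: nu q + b *: eN.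
Proof.
move=> Eq; split=> [nw|[a [b ->]] v /(tangent_vecP _ Eq)[vn Nv]]; last first.
  by rewrite dotDl !dotZl dotC vn (dotC eN) dot_eN Nv !mulr0 addr0.
exists (dot w (nu q)), (N w).
pose t := w - (dot w (nu q) *: nu q + N w *: eN).
have t1 : dot t (nu q) = 0.
  rewrite /t -scaleN1r dotDl dotZl dotDl !dotZl dot_nunu// (dotC eN) dot_eN last_nu.
  by rewrite mulr0 addr0 mulr1 mulN1r subrr.
have t2 : N t = 0.
  by rewrite /t !coordE; ring.
have tw : dot w t = 0 by apply: nw; apply/tangent_vecP.
suff : t = 0 by move/subr0_eq.
apply: dot_eq0; rewrite {1}/t -scaleN1r dotDl dotZl dotDl !dotZl tw.
by rewrite (dotC _ t) t1 (dotC _ t) dot_eN t2 !mulr0 addr0 mulr0 addr0.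
Qed.

Lemma enorm_normal q a b : E q -> enorm (a *: nu q + b *: eN) = Num.sqrt (a ^+ 2 + b ^+ 2).
Proof.
move=> Eq; congr Num.sqrt; rewrite dotDl !dotDr !dotZl !dotZr dot_nunu// dot_eN.
by rewrite (dotC eN (nu q)) !dot_eN last_nu last_mk; ring.
Qed.

(** A skew map that sends [nu] to [eN] and [eN] to minus [nu], and kills the tangent space. With
    this orientation zeta = a + i b at q + a nu + b eN. *)
Definition cplx q : 'M[R]_n.+1 :=
  \matrix_(i, j) (nu q 0 i * eN 0 j - eN 0 i * nu q 0 j).

Lemma mul_cplx q w : w *m cplx q = dot w (nu q) *: eN - N w *: nu q.
Proof.
apply/rowP => j; rewrite !mxE -dot_eN /dot !mulr_suml -sumrB.
by apply: eq_bigr => i _; rewrite !mxE; ring.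
Qed.

Lemma cplx_normal q a b : E q ->
  (a *: nu q + b *: eN) *m cplx q = (- b) *: nu q + a *: eN.
Proof.
move=> Eq; rewrite mul_cplx dotDl !dotZl dot_nunu// (dotC eN) dot_eN.
by rewrite lastD !lastZ last_nu last_mk !mulr0 addr0 !mulr1 add0r addrC scaleNr.
Qed.

Lemma beta_cts x : cts beta x.
Proof. by have ch j := @hcoord_cts R n j x; rewrite /beta; cts_arith. Qed.

Lemma bnorm_cts x : cts bnorm x.
Proof. by apply: cts_comp; [exact: sqrt_continuous|exact: beta_cts]. Qed.

Lemma coorientation_cplx : coorientation E cplx.
Proof.
split.
  apply: continuous_in_subspaceT => q; rewrite inE => Eq.
  have b0 := lt0r_neq0 (bnorm_gt0 Eq).
  have cn i : cts (fun q => nu q 0 i) q.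
    move: i; apply: ord_lastP => [j|].
      rewrite (_ : (fun q => _) = fun q => hcoord q j / h j ^+ 2 / bnorm q); last first.
        by apply/funext => y; rewrite -[LHS]/(hcoord _ _) hcoord_mk.
      by have cb := @bnorm_cts q; have ch := @hcoord_cts R n j q; cts_arith.
    rewrite (_ : (fun q => _) = fun q => 0); first exact: ctsC.
    by apply/funext => y; rewrite -[LHS]/(N _) last_mk.
  apply: cts_mx => i j.
  rewrite (_ : (fun q => _) = fun q => nu q 0 i * (eN : V) 0 j - (eN : V) 0 i * nu q 0 j);
    last first.
    by apply/funext => y; rewrite !mxE.
  by cts_arith.
move=> q Eq; split.
- move=> w /(normal_vecP _ Eq)[a [b ->]]; rewrite cplx_normal//.
  by apply/normal_vecP => //; exists (- b), a.
- move=> w /(normal_vecP _ Eq)[a [b ->]]; rewrite cplx_normal// !enorm_normal//.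
  by rewrite sqrrN addrC.
- move=> w /(normal_vecP _ Eq)[a [b ->]]; rewrite !cplx_normal//.
  by rewrite opprD !scaleNr.
- by move=> v /(tangent_vecP _ Eq)[vn Nv]; rewrite mul_cplx vn Nv !scale0r subr0.
Qed.

Lemma ellipsoid_compact : compact E.
Proof.
apply: bounded_closed_compact.
  exists (hsup h); split=> [|M hM x /ellipsoidP[Qx Nx]]; first exact: num_real.
  apply: le_trans (ltW hM).
  rewrite [leLHS]mx_normrE; apply: bigmax_le; first exact: ltW (hsup_gt0 h).
  move=> [i0 i] _ /=; rewrite (ord1 i0); move: i; apply: ord_lastP => [j|]; last first.
    by rewrite -[x _ _]/(N x) Nx normr0 ltW// hsup_gt0.
  rewrite -[x _ _]/(hcoord x j); have H1 := hsup_ge1 h.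
  rewrite -(@ler_pXn2r _ 2) ?nnegrE ?(ltW (hsup_gt0 h))// real_normK ?num_real//.
  apply: (@le_trans _ _ (h j ^+ 2)); last first.
    by rewrite (le_trans (le_hsup h j))// expr2 ler_peMl// ltW// hsup_gt0.
  rewrite -[leRHS]mul1r -ler_pdivrMr ?h2_gt0// -Qx /quad (bigD1 j)//= lerDl.
  by apply: sumr_ge0 => k _; rewrite divr_ge0 ?sqr_ge0.
have cQ : continuous (quad h) by move=> x; exact: quad_cts.
have cN : continuous N by move=> x; exact: lastcoord_cts.
have -> : E = (quad h) @^-1` [set 1] `&` N @^-1` [set 0] by apply/seteqP; split.
apply: closedI; apply: closed_comp => [x _|].
- exact: cQ.
- exact: closed_eq.
- exact: cN.
- exact: closed_eq.
Qed.

End Ellipsoid.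

Lemma prim_odd {R : realType} (g : R -> R) (C w : R) : continuous g ->
  (forall u, 0 <= g u <= C / oneDsqr u) -> (forall u, g (- u) = g u) ->
  prim g (- w) = - prim g w.
Proof.
move=> cg gC ge; pose A u := prim g u + prim g (- u).
have dA u : is_derive u (1 : R) A (g u - g u).
  have H := @is_derive1_comp R (prim g) -%R u _ (- 1) (is_derive_prim _ cg gC) (is_deriveN
    (is_derive_id _ _)).
  rewrite -[X in _ - X]mulr1 -mulrN -{2}ge.
  exact: (is_deriveD (is_derive_prim u cg gC) H).
have := @derive_le_bound R A _ w 0 dA.
rewrite mul0r normr_le0 {2}/A oppr0 prim0 addr0 subr0 => H.
apply/eqP; rewrite -addr_eq0 addrC; apply: H => u _.
by rewrite subrr normr0.
Qed.

(** * Smoothness of quadratic maps *)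

Section QuadraticMaps.
Context {R : realType} {n : nat} {W : normedModType R}.
Local Notation V := 'rV[R]_n.+1.
Implicit Types (x : V).

Definition quad_map (a b : 'I_n.+1 -> W) (c : W) x : W :=
  \sum_i (x 0 i ^+ 2 *: a i + x 0 i *: b i) + c.

Lemma has_gradZl (k : V -> R) x d (u : W) : has_grad k x d ->
  differentiable (fun y => k y *: u) x /\
  forall i, 'D_(basis_vec i) (fun y => k y *: u) x = d i *: u.
Proof.
move=> [dk kE]; have dku := differentiableZl u dk; split=> // i.
by rewrite deriveE// diffZl// -deriveE// kE.
Qed.

Lemma quad_map_deriv a b c x :
  differentiable (quad_map a b c) x /\
  forall j, 'D_(basis_vec j) (quad_map a b c) x = (2 * x 0 j) *: a j + b j.
Proof.
have gi i := has_grad_coord x i.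
have g2 i := has_gradZl (a i) (has_gradM (gi i) (gi i)).
have g1 i := has_gradZl (b i) (gi i).
pose F i := (fun y : V => y 0 i * y 0 i *: a i) + (fun y : V => y 0 i *: b i).
have dF i : differentiable (F i) x by apply: differentiableD; [case: (g2 i)|case: (g1 i)].
have dS : differentiable (\sum_i F i) x by apply: differentiable_sum.
have E : quad_map a b c = \sum_i F i + cst c.
  by apply/funext => y; rewrite /quad_map [RHS]/(_ + _)/= fct_sumE.
rewrite E; split=> [|j]; first by apply: differentiableD => //; exact: differentiable_cst.
rewrite deriveD; [|exact: diff_derivable|exact: derivable_cst].
rewrite derive_cst addr0 derive_sum => [|i]; last exact: diff_derivable.
under eq_bigr => i _.
  rewrite deriveD; [|by apply: diff_derivable; case: (g2 i)|by apply: diff_derivable; case: (g1 i)].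
  have [_ ->] := g2 i; have [_ ->] := g1 i.
  over.
rewrite (bigD1 j)//= eqxx big1 => [|i /negPf ij]; last first.
  by rewrite ij /= mulr0n mul0r mulr0 addr0 !scale0r addr0.
by rewrite addr0 /= mulr1n mul1r mulr1 scale1r mulr2n mulrDl mul1r.
Qed.

(** Partial derivatives of a [quad_map] are again of that form, so the induction runs over all
    coefficients at once. *)
Lemma quad_map_smooth a b c : smooth_on setT (quad_map a b c).
Proof.
move=> k; elim: k a b c => [|k IH] a b c /=.
  by move=> x _; apply: differentiable_continuous; case: (quad_map_deriv a b c x).
split=> [x _|j]; first by case: (quad_map_deriv a b c x).
have -> : 'D_(basis_vec j) (quad_map a b c) =
    quad_map (fun=> 0) (fun i => if i == j then 2 *: a j else 0) (b j).
  apply/funext => x; have [_ ->] := quad_map_deriv a b c x; congr (_ + _).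
  rewrite (bigD1 j)//= eqxx big1 => [|i /negPf ->]; last by rewrite !scaler0 addr0.
  by rewrite scaler0 add0r addr0 scalerA mulrC.
exact: IH.
Qed.
End QuadraticMaps.

(** * The defining map of the ellipsoid and the flat bundle *)

Section Bundle.
Context {R : realType} {n : nat}.
Variable h : 'I_n -> R.
Hypothesis hpos : forall i, 0 < h i.
Local Notation V := 'rV[R]_n.+1.
Implicit Types (x y q v w : V).
Local Notation N := (lastcoord (R := R) (n := n)).
Local Notation E := (ellipsoid h).

Definition ell_map : V -> 'rV[R]_2 := quad_map
  (ext_last (fun j => (h j ^+ 2)^-1 *: delta_mx 0 0) 0)
  (ext_last (fun=> 0) (delta_mx 0 1)) (- delta_mx 0 0).

Lemma ell_mapE x : ell_map x = (quad h x - 1) *: delta_mx 0 0 + N x *: delta_mx 0 1.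
Proof.
rewrite /ell_map /quad_map big_ord_recr/= !ext_last_max scaler0 add0r.
rewrite scalerBl scale1r addrAC; congr (_ + _ + _).
rewrite /quad scaler_suml; apply: eq_bigr => j _.
by rewrite !ext_last_widen scaler0 addr0 scalerA.
Qed.

Lemma ellipsoid_submanifold : codim2_submanifold E.
Proof.
move=> p Ep; exists setT, ell_map; split=> //.
- exact: openT.
- exact: quad_map_smooth.
- apply/seteqP; split=> [x [[Qx Nx] _]|x [_ /rowP x0]] /=.
    by rewrite ell_mapE [quad h x]Qx [N x]Nx subrr !scale0r addr0.
  split=> //; have := x0 0; have := x0 1; rewrite ell_mapE !mxE/= !mulr0 !mulr1 add0r addr0.
  by move=> N0 /subr0_eq Q1; apply/ellipsoidP.
move=> x _ Ex; have [dphi phiE] := quad_map_deriv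
  (ext_last (fun j => (h j ^+ 2)^-1 *: delta_mx 0 0) 0)
  (ext_last (fun=> 0) (delta_mx 0 1)) (- delta_mx 0 0 : 'rV[R]_2) x.
have [j xj] : exists j, hcoord x j != 0.
  apply/existsP; rewrite -negb_forall; apply/negP => /forallP x0.
  case/ellipsoidP: Ex => + _; rewrite /quad big1 => [/esym/eqP|j _]; first by rewrite oner_eq0.
  by rewrite (eqP (x0 j)) expr0n/= mul0r.
(* The row space of the Jacobian contains both basis vectors: the derivative along a nonzero
   coordinate x_j is a nonzero multiple of the first, the one along x_n is the second. *)
apply/eqP; rewrite eqn_leq rank_leq_col -{1}(mxrank1 R 2) mxrankS//.
apply/row_subP => i; rewrite row1.
have [->|->] : i = 0 \/ i = 1 by case: i => [[|[|//]] ?]; [left|right]; apply: val_inj.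
  have : 'D_(basis_vec (widen_ord (leqnSn n) j)) ell_map x = (2 *
    hcoord x j / h j ^+ 2) *: delta_mx 0 0.
    by rewrite phiE !ext_last_widen addr0 scalerA.
  rewrite deriveEjacobian// => e0.
  have c0 : 2 * hcoord x j / h j ^+ 2 != 0.
    by rewrite !mulf_neq0// invr_eq0 gt_eqF// h2_gt0.
  by rewrite -[delta_mx _ _](scalerK c0) -e0 scalemxAl submxMl.
have : 'D_(basis_vec ord_max) ell_map x = delta_mx 0 1.
  by rewrite phiE !ext_last_max scaler0 add0r.
by rewrite deriveEjacobian// => <-; rewrite submxMl.
Qed.

(** One chart puts the sign of x_n on z, the other on w, so on the overlap the two pairs (w, z)
    differ by exactly this sign. *)
Definition ell_trans (i j : bool) x : R := if i == j then 1 else Num.sg (N x).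

Lemma chart_overlap i j x : chart_dom h i x -> chart_dom h j x -> i != j -> N x != 0.
Proof.
case: i j => [] [] // [//|+] [//|+] _ /=.
- by move=> /lt_trans lt /lt; rewrite ltxx.
- by move=> lt1 /(lt_trans lt1); rewrite ltxx.
Qed.

Lemma sgN_cases x : N x != 0 -> Num.sg (N x) = 1 \/ Num.sg (N x) = -1.
Proof. by case: sgrP => //; [left|right]. Qed.

Lemma ell_trans_sign i j x : chart_dom h i x -> chart_dom h j x ->
  ell_trans i j x = 1 \/ ell_trans i j x = -1.
Proof.
rewrite /ell_trans; case: eqVneq => [_|ij di dj]; first by left.
exact/sgN_cases/chart_overlap/ij.
Qed.

Lemma sg_near (T : topologicalType) (f : T -> R) (t : T) : cts f t -> f t != 0 ->
  \forall s \near t, Num.sg (f s) = Num.sg (f t).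
Proof.
move=> cf; rewrite neq_lt => /orP[ft|ft].
  by apply: filterS (cts_lt cf ft) => s fs; rewrite !ltr0_sg.
by apply: filterS (cts_gt cf ft) => s fs; rewrite !gtr0_sg.
Qed.

Lemma ell_trans_loc_const i j x : chart_dom h i x -> chart_dom h j x ->
  \forall y \near x, ell_trans i j y = ell_trans i j x.
Proof.
move=> di dj; rewrite /ell_trans; case: eqVneq => [_|ij].
  by apply: filterS (near_chart_dom di).
apply: sg_near; first exact: lastcoord_cts.
exact: chart_overlap di dj ij.
Qed.

Lemma ell_trans_cocycle i j k x : chart_dom h i x -> chart_dom h j x -> chart_dom h k x ->
  ell_trans i j x * ell_trans j k x = ell_trans i k x.
Proof.
move=> di dj dk; rewrite /ell_trans.
have [->|ij] := eqVneq i j; first by rewrite mul1r.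
have [jk|jk] := eqVneq j k; first by rewrite -jk (negPf ij) mulr1.
have <- : i = k by move: ij jk; case: i j k {di dj dk} => [] [] [].
by rewrite eqxx -expr2 sqr_sg (chart_overlap di dj ij).
Qed.

Lemma chart_cover : \bigcup_i chart_dom h i = ~` E.
Proof.
apply/seteqP; split=> [x [b _ [x0|Qx]] /ellipsoidP[Q1 N0]|x nEx].
- by rewrite N0 eqxx in x0.
- by move: Qx; rewrite Q1 ltxx; case: b.
have [N0|N0] := eqVneq (N x) 0; last by exists true => //; left.
have : quad h x != 1 by apply/eqP => Q1; exact: nEx.
by rewrite neq_lt => /orP[Q1|Q1]; [exists false|exists true] => //; right.
Qed.

Definition ell_bundle : flat_line_bundle (~` E) :=
  @FlatLineBundle R n (~` E) bool (chart_dom h) ell_trans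
    (@chart_dom_open R n h) chart_cover ell_trans_sign ell_trans_loc_const ell_trans_cocycle.

Hypothesis n2 : (2 <= n)%N.

(** The weights are even, so their primitives are odd, and x_n z [wt0 h w] is odd through z. With
    the sign of x_n for s, this is the transition rule of the bundle. *)
Lemma potential_odd x (s w z : R) : s = 1 \/ s = -1 ->
  potential h x (s * w) (s * z) = s * potential h x w z.
Proof.
case=> ->; first by rewrite !mul1r.
rewrite !mulN1r /potential.
have wev i u : wt h i (- u) = wt h i u by rewrite /wt sqrrN.
have -> : wt0 h (- w) = wt0 h w by rewrite /wt0 sqrrN.
rewrite (prim_odd _ (wt0_continuous hpos) (wt0_bounds hpos n2)); last by move=> u;
  rewrite /wt0 sqrrN.
rewrite (prim_odd _ (wtlast_continuous hpos) (wtlast_bounds hpos n2)); last by move=> u;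
  rewrite /wtlast sqrrN.
under eq_bigr => i _ do rewrite (prim_odd _ (wt_continuous hpos (i :=
  i)) (wt_bounds hpos n2 i)) ?mulrN//.
by rewrite sumrN; ring.
Qed.

Lemma fchart_section : is_section (L := ell_bundle) (fchart h).
Proof.
move=> i j x di dj; rewrite /= /ell_trans; have [->|ij] := eqVneq i j; first by rewrite mul1r.
have N0 := chart_overlap di dj ij.
have s1 := sgN_cases N0; have ss : Num.sg (N x) * Num.sg (N x) = 1 by rewrite -expr2 sqr_sg N0.
rewrite /fchart -potential_odd// /wchart /zchart.
by case: i j {di dj} ij => [] [] //= _; rewrite mulrA ss mul1r.
Qed.

End Bundle.

(** * The tubular neighbourhood *)

Section Tube.
Context {R : realType} {n : nat}.
Variable h : 'I_n -> R.
Hypothesis hpos : forall i, 0 < h i.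
Local Notation V := 'rV[R]_n.+1.
Implicit Types (x y q v : V) (a b s r : R).
Local Notation N := (lastcoord (R := R) (n := n)).
Local Notation E := (ellipsoid h).

(** Since [bnorm] >= 1 / hsup on the ellipsoid, |a| < [tube_eps] gives |a / bnorm| < hinf / 2, so
    that h_j^2 + a / bnorm stays above h_j^2 / 2. *)
Definition tube_eps : R := hinf h / hsup h / 2.

Lemma tube_eps_gt0 : 0 < tube_eps.
Proof. by rewrite !divr_gt0 ?hinf_gt0 ?hsup_gt0. Qed.

Lemma tube_eps_le1 : tube_eps <= 1.
Proof.
have h1 : hinf h / hsup h <= 1.
  by rewrite ler_pdivrMr ?hsup_gt0// mul1r (le_trans (hinf_le1 h))// hsup_ge1.
by rewrite /tube_eps; lra.
Qed.

Definition tube_pt q a b : V := q + (a *: nu h q + b *: eN).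

Lemma hcoord_tube q a b j :
  hcoord (tube_pt q a b) j = hcoord q j * (1 + a / bnorm h q / h j ^+ 2).
Proof. by rewrite /tube_pt !coordE; ring. Qed.

Lemma last_tube q a b : E q -> N (tube_pt q a b) = b.
Proof.
by move=> /ellipsoidP[_ N0]; rewrite /tube_pt !coordE N0 mulr0 mulr1 !add0r.
Qed.

Lemma tube_s_lt2 q a : E q -> `|a| < tube_eps -> `|a / bnorm h q| < hinf h / 2.
Proof.
move=> Eq ae; have b0 := bnorm_gt0 hpos Eq.
rewrite normrM normfV (gtr0_norm b0) ltr_pdivrMr// mulrAC.
rewrite (lt_le_trans ae)// /tube_eps ler_wpM2r// ler_wpM2l ?(ltW (hinf_gt0 h))//.
exact: bnorm_ge.
Qed.

Lemma tube_s_lt q a : E q -> `|a| < tube_eps -> `|a / bnorm h q| < hinf h.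
Proof.
move=> Eq ae; apply: lt_le_trans (tube_s_lt2 Eq ae) _.
by have := hinf_gt0 h; lra.
Qed.

(** If x = q + a nu + b eN and s = a / bnorm, then q_j = x_j h_j^2 / (h_j^2 + s), and [tubeF x s] is
    [quad] of this q. So s is the Lagrange multiplier of the nearest-point problem and solves
    [tubeF x s] = 1. *)
Definition tubeF y s : R := \sum_(j < n) (hcoord y j * h j) ^+ 2 / (h j ^+ 2 + s) ^+ 2.

Lemma hs_gt0 j s : - hinf h < s -> 0 < h j ^+ 2 + s.
Proof. by move=> sh; have := hinf_le hpos j; lra. Qed.

Lemma tubeF_lt y s t : - hinf h < s -> s < t -> s < hinf h -> 0 < tubeF y t ->
  tubeF y t < tubeF y s.
Proof.
move=> hs st sh F0; have H0 : 0 < hsup h + hinf h by rewrite addr_gt0 ?hsup_gt0 ?hinf_gt0.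
(* One factor k > 1 serves all j, because h_j^2 + s <= hsup + hinf; strictness then follows from
   positivity of the whole sum, without singling out a nonzero coordinate. *)
pose k := 1 + (t - s) / (hsup h + hinf h).
have k1 : 1 < k by rewrite ltrDl divr_gt0// subr_gt0.
apply: (@lt_le_trans _ _ (k * tubeF y t)); first by rewrite ltr_pMl.
rewrite mulr_sumr; apply: ler_sum => j _.
have a0 := hs_gt0 j hs; have ht : - hinf h < t by exact: lt_trans st.
have a0' := hs_gt0 j ht.
rewrite mulrCA ler_wpM2l ?sqr_ge0// ler_pdivrMr ?exprn_gt0// mulrC ler_pdivlMr ?exprn_gt0//.
rewrite !expr2 mulrA ler_pM ?mulr_ge0 ?(ltW a0) ?(le_trans ler01 (ltW k1))//; last first.
  by rewrite lerD2l ltW.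
rewrite /k mulrDl mul1r -addrA -lerBrDl; have -> : h j ^+ 2 + t - h j ^+ 2 = s + (t - s) by ring.
rewrite lerD2l mulrAC ler_pdivrMr// ler_wpM2l ?subr_ge0 ?(ltW st)//.
by rewrite lerD ?le_hsup// ltW.
Qed.

Lemma tubeF_tube q a b : E q -> `|a| < tube_eps -> tubeF (tube_pt q a b) (a / bnorm h q) = 1.
Proof.
move=> Eq ae; have [Q1 _] := (ellipsoidP _ q).1 Eq.
rewrite -Q1; apply: eq_bigr => j _; rewrite hcoord_tube.
have := tube_s_lt Eq ae; rewrite ltr_norml => /andP[/(hs_gt0 j) s1 _].
set s := a / bnorm h q in s1 *; field; rewrite (gt_eqF s1) gt_eqF//.
Qed.

Definition is_tube_s x s : Prop := `|s| < hinf h /\ tubeF x s = 1.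

Lemma is_tube_s_unique x s t : is_tube_s x s -> is_tube_s x t -> s = t.
Proof.
move=> [sh Fs] [th Ft]; move: sh th; rewrite !ltr_norml => /andP[s1 s2] /andP[t1 t2].
apply/eqP; rewrite eq_le !leNgt; apply/andP; split; apply/negP => lt.
- by have := @tubeF_lt x t s t1 lt t2; rewrite Fs Ft ltxx => /(_ ltr01).
- by have := @tubeF_lt x s t s1 lt s2; rewrite Fs Ft ltxx => /(_ ltr01).
Qed.

Definition tube_s x : R := xget 0 [set s | is_tube_s x s].

Lemma tube_s_eq x s : is_tube_s x s -> tube_s x = s.
Proof.
move=> xs; have H : is_tube_s x (tube_s x) := xgetPex 0 (ex_intro (is_tube_s x) s xs).
exact: is_tube_s_unique H xs.
Qed.

Lemma tube_sE q a b : E q -> `|a| < tube_eps -> tube_s (tube_pt q a b) = a / bnorm h q.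
Proof.
by move=> Eq ae; apply: tube_s_eq; split; [exact: tube_s_lt|exact: tubeF_tube].
Qed.

Lemma tube_s_cts x s0 : is_tube_s x s0 -> cts tube_s x.
Proof.
move=> xs; have sE := tube_s_eq xs; have [] := xs; rewrite ltr_norml => /andP[s1 s2] F1.
apply: cts_dist => e e0; rewrite sE.
(* d keeps [s0 - d, s0 + d] inside (-hinf, hinf), where the root is unique, and inside the
   e-neighbourhood of s0. The strict inequalities at its ends persist near x, so the intermediate
   value theorem finds the root for y there. *)
pose d := Num.min (e / 2) (Num.min ((s0 + hinf h) / 2) ((hinf h - s0) / 2)).
have d0 : 0 < d by rewrite !lt_min !divr_gt0//; lra.
have de : d <= e / 2 by rewrite ge_min lexx.
have d1 : d <= (s0 + hinf h) / 2 by rewrite !ge_min lexx !orbT.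
have d2 : d <= (hinf h - s0) / 2 by rewrite !ge_min lexx !orbT.
have cF s : - hinf h < s -> cts (tubeF ^~ s) x.
  by move=> hs; rewrite /tubeF; have ch j := @hcoord_cts R n j x; cts_arith.
have lo : 1 < tubeF x (s0 - d).
  by rewrite -F1 tubeF_lt ?F1//; lra.
have up : tubeF x (s0 + d) < 1.
  have [Fp|Fp] := ltP 0 (tubeF x (s0 + d)); last exact: le_lt_trans ltr01.
  by rewrite -[ltRHS]F1 tubeF_lt//; lra.
near=> y.
have loy : 1 < tubeF y (s0 - d) by near: y; apply: (cts_gt (cF _ _) lo); lra.
have upy : tubeF y (s0 + d) < 1 by near: y; apply: (cts_lt (cF _ _) up); lra.
have [|||s] := @IVT R (tubeF y) (s0 - d) (s0 + d) 1.
- by lra.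
- apply: continuous_in_subspaceT => s; rewrite inE/= in_itv/= => /andP[sa sb].
  change (cts (tubeF y) s); rewrite /tubeF.
  have cid : cts (fun w : R => w) s by exact: cvg_id.
  cts_arith; rewrite expf_neq0// gt_eqF// hs_gt0//; lra.
- by rewrite ge_min le_max (ltW loy) (ltW upy) orbT.
rewrite in_itv/= => /andP[sa sb] Fs.
rewrite (@tube_s_eq y s); first by apply/andP; lra.
by split=> //; rewrite ltr_norml; apply/andP; lra.
Unshelve. all: by end_near. Qed.

Definition foot x : V := mkvec (fun j => hcoord x j * h j ^+ 2 / (h j ^+ 2 + tube_s x)) 0.

Lemma foot_tube q a b : E q -> `|a| < tube_eps -> foot (tube_pt q a b) = q.
Proof.
move=> Eq ae; have [_ N0] := (ellipsoidP _ q).1 Eq.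
apply: vec_eqP => [j|]; last by rewrite last_mk N0.
rewrite hcoord_mk hcoord_tube tube_sE//.
have := tube_s_lt Eq ae; rewrite ltr_norml => /andP[/(hs_gt0 j) s1 _].
set s := a / bnorm h q in s1 *; field; rewrite (gt_eqF s1) gt_eqF//.
Qed.

(** In the tube zeta = [rho x] + i x_n, and [rad x] is its modulus. *)
Definition rho x : R := tube_s x * bnorm h (foot x).
Definition rad x : R := Num.sqrt (rho x ^+ 2 + N x ^+ 2).

Lemma rho_tube q a b : E q -> `|a| < tube_eps -> rho (tube_pt q a b) = a.
Proof.
by move=> Eq ae; rewrite /rho foot_tube// tube_sE// divfK// gt_eqF// bnorm_gt0.
Qed.

Lemma foot_cts x s0 : is_tube_s x s0 -> cts (fun y => bnorm h (foot y)) x /\ cts rho x /\ cts rad x.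
Proof.
move=> xs; have cs := tube_s_cts xs; have cN := @lastcoord_cts R n x.
have ch j := @hcoord_cts R n j x.
have cf j : cts (fun y => hcoord (foot y) j) x.
  rewrite (_ : (fun y => _) = fun y => hcoord y j * h j ^+ 2 / (h j ^+ 2 + tube_s y)).
    cts_arith; rewrite gt_eqF// (tube_s_eq xs) hs_gt0//.
    by case: xs; rewrite ltr_norml => /andP[].
  by apply/funext => y; rewrite hcoord_mk.
have cb : cts (fun y => bnorm h (foot y)) x.
  apply: cts_comp; first exact: sqrt_continuous.
  by rewrite /beta; cts_arith.
have cr : cts rho x by rewrite /rho; cts_arith.
split=> //; split=> //; apply: cts_comp; first exact: sqrt_continuous.
by cts_arith.
Qed.

Lemma quad_nu_le q : E q -> quad h (nu h q) <= (hinf h)^-1.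
Proof.
move=> Eq; rewrite -[leRHS]mulr1 -(dot_nunu hpos Eq) dotE last_nu mulr0 addr0 mulr_sumr.
apply: ler_sum => j _; rewrite -expr2 mulrC ler_wpM2r ?sqr_ge0//.
by rewrite lef_pV2 ?posrE ?h2_gt0 ?hinf_gt0 ?hinf_le.
Qed.

Lemma quad_tube q a b : E q ->
  quad h (tube_pt q a b) = 1 + a * (2 * bnorm h q + a * quad h (nu h q)).
Proof.
move=> Eq; have [Q1 _] := (ellipsoidP _ q).1 Eq; have b0 := lt0r_neq0 (bnorm_gt0 hpos Eq).
have cross : \sum_(j < n) hcoord q j * hcoord (nu h q) j / h j ^+ 2 = bnorm h q.
  rewrite -[RHS](mulfK b0) -expr2 bnorm_sqr mulr_suml; apply: eq_bigr => j _.
  by rewrite hcoord_mk; ring.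
rewrite -{1}Q1 -cross !mulrDr !mulr_sumr -!big_split/=; apply: eq_bigr => j _.
by rewrite /tube_pt !coordE; ring.
Qed.

(** With [quad_tube] this shows that [quad] - 1 has the sign of a, which decides to which chart a
    point of the hyperplane belongs. The size of [tube_eps] makes 2 bnorm dominate. *)
Lemma quad_tube_factor q a : E q -> `|a| < tube_eps ->
  0 < 2 * bnorm h q + a * quad h (nu h q).
Proof.
move=> Eq ae; have b0 := bnorm_gt0 hpos Eq; have bge := bnorm_ge hpos Eq.
have Q0 : 0 <= quad h (nu h q) by apply: sumr_ge0 => j _; rewrite divr_ge0 ?sqr_ge0.
have : `|a * quad h (nu h q)| <= (hsup h)^-1.
  rewrite normrM (ger0_norm Q0) (le_trans (ler_pM _ _ (ltW ae) (quad_nu_le Eq)))//.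
  have -> : tube_eps / hinf h = (hsup h)^-1 / 2.
    by rewrite /tube_eps; field; rewrite !gt_eqF ?hinf_gt0 ?hsup_gt0.
  by rewrite ler_pdivrMr// ler_peMr ?invr_ge0 ?(ltW (hsup_gt0 h))// ler1n.
by rewrite ler_norml => /andP[]; lra.
Qed.

Lemma chart_dom_tube c q a b : E q -> `|a| < tube_eps -> chart_dom h c (tube_pt q a b) ->
  b != 0 \/ (if c then 0 < a else a < 0).
Proof.
move=> Eq ae; have f0 := quad_tube_factor Eq ae.
rewrite /chart_dom /= last_tube// quad_tube//; case=> [|H]; [by left|right].
by case: c H; rewrite ?gtrDl ?ltrDl ?pmulr_lgt0 ?pmulr_llt0.
Qed.

Lemma normal_abs_le q a b : E q -> `|a| <= enorm (a *: nu h q + b *: eN).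
Proof.
by move=> Eq; rewrite enorm_normal// -sqrtr_sqr ler_wsqrtr// lerDl sqr_ge0.
Qed.

(** [foot] recovers q from q + v, so the foot point is unique, and then v is too. *)
Lemma ellipsoid_tubular : tubular_radius E tube_eps.
Proof.
split; first exact: tube_eps_gt0.
move=> q q' v v' Eq Eq' /(normal_vecP hpos _ Eq)[a [b vE]] /(normal_vecP hpos _ Eq')[a' [b' vE']].
move=> ve ve' vv; have qq : q = q'.
  rewrite -[q](@foot_tube _ a b)//; last by rewrite (le_lt_trans _ ve)// vE normal_abs_le.
  rewrite -[q'](@foot_tube _ a' b')//; last by rewrite (le_lt_trans _ ve')// vE' normal_abs_le.
  by rewrite /tube_pt -vE -vE' vv.
by split=> //; move: vv; rewrite qq => /addrI.
Qed.

Lemma punctured_tubeP x : punctured_tube E tube_eps x ->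
  exists q a b, [/\ E q, 0 < Num.sqrt (a ^+ 2 + b ^+ 2) < tube_eps & x = tube_pt q a b].
Proof.
move=> [q [v [Eq /(normal_vecP hpos _ Eq)[a [b vE]] ve xE]]].
have vn := enorm_normal hpos a b Eq.
by exists q, a, b; split=> //; [rewrite -vn -vE|rewrite xE vE].
Qed.

Lemma abs_le_hypot a b : `|a| <= Num.sqrt (a ^+ 2 + b ^+ 2).
Proof. by rewrite -sqrtr_sqr ler_wsqrtr// lerDl sqr_ge0. Qed.

Lemma exists_angle a b : a ^+ 2 + b ^+ 2 = 1 -> exists t, a = cos t /\ b = sin t.
Proof.
move=> ab; have a2 : a ^+ 2 <= 1 by rewrite -ab lerDl sqr_ge0.
have a1 : -1 <= a <= 1 by rewrite -ler_norml -(@ler_pXn2r _ 2) ?nnegrE// expr1n real_normK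
  ?num_real.
have bE : `|b| = Num.sqrt (1 - a ^+ 2) by rewrite -ab addrAC subrr add0r sqrtr_sqr.
have [b0|b0] := leP 0 b.
  by exists (acos a); rewrite acosK// sin_acos// -bE ger0_norm.
exists (- acos a); rewrite cosN sinN acosK// sin_acos// -bE ltr0_norm// opprK //.
Qed.

Lemma hypot_angle a b : let r := Num.sqrt (a ^+ 2 + b ^+ 2) in 0 < r ->
  exists t, a = r * cos t /\ b = r * sin t.
Proof.
move=> r r0; have rr : r ^+ 2 = a ^+ 2 + b ^+ 2 by rewrite sqr_sqrtr// addr_ge0 ?sqr_ge0.
have [t [at_ bt]] : exists t, a / r = cos t /\ b / r = sin t.
  apply: exists_angle; rewrite !expr_div_n -mulrDl -rr divff// expf_neq0//.
  exact: lt0r_neq0.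
exists t; rewrite -at_ -bt; have := lt0r_neq0 r0.
by split; field.
Qed.

Lemma unit_normalP q e : E q -> unit_normal E q e ->
  exists t, e = cos t *: nu h q + sin t *: eN.
Proof.
move=> Eq [/(normal_vecP hpos _ Eq)[a [b ->]]]; rewrite enorm_normal// => ab.
have [t [-> ->]] : exists t, a = cos t /\ b = sin t.
  apply: exists_angle; rewrite -[LHS]sqr_sqrtr ?addr_ge0 ?sqr_ge0//.
  by rewrite ab expr1n.
by exists t.
Qed.

Lemma normal_polarE q t r s : E q ->
  normal_polar (cplx h) q (cos t *: nu h q + sin t *: eN) r s =
  tube_pt q (r * cos (s + t)) (r * sin (s + t)).
Proof.
move=> Eq; rewrite /normal_polar cplx_normal// /tube_pt cosD sinD; congr (_ + _).
by apply: vec_eqP => [j|]; rewrite !coordE; ring.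
Qed.

Lemma cos_half (t : R) : cos t = 1 - 2 * sin (t / 2) ^+ 2 /\ cos t = 2 * cos (t / 2) ^+ 2 - 1.
Proof.
have tE : t = t / 2 + t / 2 by field.
by rewrite {1 3}tE cosD -!expr2 cos2sin2; split; ring.
Qed.

Lemma sin_half (t : R) : sin t = 2 * (sin (t / 2) * cos (t / 2)).
Proof.
have tE : t = t / 2 + t / 2 by field.
by rewrite {1}tE sinD; ring.
Qed.

Definition half_fun (c : bool) (t : R) : R := if c then cos (t / 2) else sin (t / 2).

(** cos (t / 2) vanishes only on the negative ray of zeta, which lies in the disc, outside the chart
    with w > 0; sin (t / 2) vanishes only on the positive ray, outside the other chart. *)
Lemma half_fun_neq0 c q r t : E q -> 0 < r < tube_eps ->
  chart_dom h c (tube_pt q (r * cos t) (r * sin t)) -> half_fun c t != 0.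
Proof.
move=> Eq /andP[r0 re] dc; apply/eqP => H.
have ae : `|r * cos t| < tube_eps.
  rewrite (le_lt_trans _ re)// normrM (gtr0_norm r0) ler_piMr// ?(ltW r0)//.
  by rewrite ler_norml cos_geN1 cos_le1.
have := chart_dom_tube Eq ae dc; rewrite sin_half.
have [c1 c2] := cos_half t.
case: c dc H => _ /= H; [rewrite c2|rewrite c1]; rewrite H.
  by rewrite !mulr0 eqxx expr0n/= mulr0 sub0r mulrN1 oppr_gt0 ltNge (ltW r0); case.
by rewrite mul0r !mulr0 eqxx expr0n/= mulr0 subr0 mulr1 ltNge (ltW r0); case.
Qed.

Definition sgtau (c : bool) (t : R) : R := Num.sg (half_fun c t).

(* On the double cover w and z are positive multiples of [cos (t / 2)] and
   [sin (t / 2)] up to higher order, t being the angle of zeta; charts compare with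
   a parallel section by the signs of these two numbers. *)
Lemma parallel_sgtau (T : topologicalType) (D : set T) (Phi : T -> V) (r t : T -> R) q :
  E q -> (forall u, D u -> cts t u) ->
  (forall u, D u -> 0 < r u < tube_eps /\ Phi u = tube_pt q (r u * cos (t u)) (r u * sin (t u))) ->
  parallel_unit (L := ell_bundle h) D Phi (fun c u => sgtau c (t u)).
Proof.
move=> Eq ct DP; have hf0 c u : D u -> chart_dom h c (Phi u) -> half_fun c (t u) != 0.
  by move=> Du; have [re ->] := DP u Du; exact: half_fun_neq0.
split=> /=.
- by move=> c u Du du; have := hf0 c u Du du; rewrite /sgtau; case: sgrP => //; [left|right].
- move=> c u Du du; have H := hf0 c u Du du.
  have chf : cts (fun u => half_fun c (t u)) u.
    have ct2 : cts (fun u => t u / 2) u by have := ct u Du => ?; cts_arith.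
    by case: c {du H}; [apply: cts_comp (@continuous_cos R) ct2|apply: cts_comp (@continuous_sin R)
      ct2].
  by apply: filterS (sg_near chf H) => u' ? _ _.
- move=> c d u Du dc dd; rewrite /ell_trans; have [->|cd] := eqVneq c d; first by rewrite mul1r.
  have [/andP[r0 _] PE] := DP u Du.
  have -> : N (Phi u) = r u * (2 * (half_fun c (t u) * half_fun d (t u))).
    rewrite PE last_tube// sin_half; case: c d {dc dd} cd => [] [] //= _;
      by rewrite (mulrC (sin _)).
  have := hf0 c u Du dc; have := hf0 d u Du dd; rewrite /sgtau !sgrM (gtr0_sg r0).
  rewrite (@gtr0_sg R 2)// !mul1r => d0 _.
  by rewrite -mulrA -expr2 sqr_sg d0 mulr1.
Qed.

Lemma ell_monodromy : linking_monodromy (cplx h) (ell_bundle h).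
Proof.
exists tube_eps; first exact: ellipsoid_tubular.
move=> q e r Eq /(unit_normalP Eq)[t ->] re.
exists (fun c u => sgtau c (2 * pi * u + t)).
  apply: (@parallel_sgtau R _ _ (fun=> r) (fun u => 2 * pi * u + t) q) => // [u _|u _].
    have cid : cts (fun w : R => w) u by exact: cvg_id.
    by cts_arith.
  by rewrite normal_polarE.
(* A full turn adds pi to the half angle, and both sine and cosine change sign. *)
move=> c _; rewrite mulr1 mulr0 add0r mulN1r /sgtau -sgrN; congr Num.sg.
rewrite /half_fun (_ : (2 * pi + t) / 2 = t / 2 + pi); last by field.
by case: c; rewrite ?cosDpi ?sinDpi.
Qed.

End Tube.

(** * The two-valued functions zeta^(1/2) and B zeta^(3/2) *)

Section HalfPowers.
Context {R : realType} {n : nat}.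
Variable h : 'I_n -> R.
Hypothesis hpos : forall i, 0 < h i.
Local Notation V := 'rV[R]_n.+1.
Implicit Types (x y q v : V) (a b s r t : R) (c : bool).
Local Notation N := (lastcoord (R := R) (n := n)).
Local Notation E := (ellipsoid h).
Local Notation eps := (tube_eps h).

(* [rootA c x + i rootB c x] is the square root of zeta with positive real part
   (c = true) or positive imaginary part (c = false). *)
Definition rootA c x : R :=
  if c then Num.sqrt ((rad h x + rho h x) / 2)
  else N x / (2 * Num.sqrt ((rad h x - rho h x) / 2)).
Definition rootB c x : R :=
  if c then N x / (2 * Num.sqrt ((rad h x + rho h x) / 2))
  else Num.sqrt ((rad h x - rho h x) / 2).

Definition Bcoef q : R := - (2 / 3 * Num.sqrt (2 * bnorm h q)).

(** Real and imaginary part of B times the cube of [rootA] + i [rootB], with B taken at the foot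
    point. *)
Definition sB c x : R[i] := Complex
  (Bcoef (foot h x) * (rootA c x ^+ 3 - 3 * rootA c x * rootB c x ^+ 2))
  (Bcoef (foot h x) * (3 * rootA c x ^+ 2 * rootB c x - rootB c x ^+ 3)).

Lemma cos_abs_lt r t : 0 < r < eps -> `|r * cos t| < eps.
Proof.
move=> /andP[r0 re]; rewrite (le_lt_trans _ re)// normrM (gtr0_norm r0) ler_piMr// ?(ltW r0)//.
by rewrite ler_norml cos_geN1 cos_le1.
Qed.

Lemma rad_polar q r t : E q -> 0 < r < eps -> rad h (tube_pt h q (r * cos t) (r * sin t)) = r.
Proof.
move=> Eq re; have [r0 _] := andP re.
rewrite /rad rho_tube ?cos_abs_lt// last_tube//.
by rewrite !exprMn -mulrDr cos2Dsin2 mulr1 sqrtr_sqr gtr0_norm.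
Qed.

(** Half-angle formulas: the square root in the definition produces the absolute value of a
    half-angle function, and [sgtau] is the sign of that function. *)
Lemma root_polar c q r t : E q -> 0 < r < eps ->
  chart_dom h c (tube_pt h q (r * cos t) (r * sin t)) ->
  rootA c (tube_pt h q (r * cos t) (r * sin t)) = sgtau c t * (Num.sqrt r * cos (t / 2)) /\
  rootB c (tube_pt h q (r * cos t) (r * sin t)) = sgtau c t * (Num.sqrt r * sin (t / 2)).
Proof.
move=> Eq re dc; have H := half_fun_neq0 hpos Eq re dc.
have [r0 _] := andP re; have sr0 : 0 < Num.sqrt r by rewrite sqrtr_gt0.
rewrite /rootA /rootB rad_polar// rho_tube ?cos_abs_lt// last_tube// /sgtau.
have [c1 c2] := cos_half t; have s1 := sin_half t.
have rr : r = Num.sqrt r ^+ 2 by rewrite sqr_sqrtr// ltW.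
have E1 : Num.sqrt ((r + r * cos t) / 2) = Num.sqrt r * `|cos (t / 2)|.
  rewrite (_ : _ / 2 = r * cos (t / 2) ^+ 2); last by rewrite c2; field.
  by rewrite sqrtrM ?(ltW r0)// sqrtr_sqr.
have E2 : Num.sqrt ((r - r * cos t) / 2) = Num.sqrt r * `|sin (t / 2)|.
  rewrite (_ : _ / 2 = r * sin (t / 2) ^+ 2); last by rewrite c1; field.
  by rewrite sqrtrM ?(ltW r0)// sqrtr_sqr.
case: c dc H => _ /= H; rewrite ?E1 ?E2 s1 [in r * (2 * _)]rr normrEsg.
  have sg2 : Num.sg (cos (t / 2)) ^+ 2 = 1 by rewrite sqr_sg H.
  split; first by ring.
  have sg0 : Num.sg (cos (t / 2)) != 0 by rewrite sgr_eq0.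
  rewrite -[RHS]mul1r -[X in X * _ = _]mulr1.
  rewrite -{1}(divff sg0).
  have -> : Num.sg (cos (t / 2)) * (Num.sqrt r * sin (t / 2)) = Num.sg (cos (t / 2)) ^+ 2 *
    (Num.sqrt r * sin (t / 2)) / Num.sg (cos (t / 2)) by field.
  by rewrite sg2; field; rewrite sg0 H gt_eqF.
have sg2 : Num.sg (sin (t / 2)) ^+ 2 = 1 by rewrite sqr_sg H.
split; last by ring.
have sg0 : Num.sg (sin (t / 2)) != 0 by rewrite sgr_eq0.
have -> : Num.sg (sin (t / 2)) * (Num.sqrt r * cos (t / 2)) = Num.sg (sin (t / 2)) ^+ 2 *
  (Num.sqrt r * cos (t / 2)) / Num.sg (sin (t / 2)) by field.
by rewrite sg2; field; rewrite sg0 H gt_eqF.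
Qed.

Lemma sgtau_sqr c q r t : E q -> 0 < r < eps ->
  chart_dom h c (tube_pt h q (r * cos t) (r * sin t)) -> sgtau c t ^+ 2 = 1.
Proof. by move=> Eq re dc; rewrite sqr_sg (half_fun_neq0 hpos Eq re dc). Qed.

Lemma tube_polar x : punctured_tube E eps x ->
  exists q r t, [/\ E q, 0 < r < eps & x = tube_pt h q (r * cos t) (r * sin t)].
Proof.
move=> /(punctured_tubeP hpos)[q [a [b [Eq re xE]]]]; have [r0 _] := andP re.
have [t [aE bE]] := hypot_angle r0.
by exists q, (Num.sqrt (a ^+ 2 + b ^+ 2)), t; split=> //; rewrite -aE -bE.
Qed.

Lemma sB_polar c q r t : E q -> 0 < r < eps ->
  chart_dom h c (tube_pt h q (r * cos t) (r * sin t)) ->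
  sB c (tube_pt h q (r * cos t) (r * sin t)) =
  Complex (sgtau c t * (Bcoef q * Num.sqrt r ^+ 3 * cos (3 / 2 * t)))
          (sgtau c t * (Bcoef q * Num.sqrt r ^+ 3 * sin (3 / 2 * t))).
Proof.
move=> Eq re dc; have s2 := sgtau_sqr Eq re dc.
rewrite /sB foot_tube ?cos_abs_lt//; have [-> ->] := root_polar Eq re dc.
have -> : 3 / 2 * t = t / 2 + (t / 2 + t / 2) by field.
(* The cube of a sign is that sign, so the cubes carry the same chart signs as the roots. *)
have s3 : sgtau c t ^+ 3 = sgtau c t by rewrite exprS s2 mulr1.
rewrite cosD (sinD (t / 2) (t / 2 + t / 2)) (cosD (t / 2) (t / 2)) (sinD (t / 2) (t / 2)).
have [cs sc] : cos (t / 2) ^+ 2 = 1 - sin (t / 2) ^+ 2 /\ sin (t / 2) ^+ 2 = 1 - cos (t / 2) ^+ 2.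
  by have := cos2Dsin2 (t / 2); split; lra.
by congr Complex; rewrite -[X in _ = X * _]s3; ring.
Qed.

Lemma CmulRe a b d : Complex a 0 * Complex b d = Complex (a * b) (a * d) :> R[i].
Proof. by apply/eqP; rewrite eq_complex /= !mul0r subr0 addr0 !eqxx. Qed.

Lemma Cmul a b d e : Complex a b * Complex d e = Complex (a * d - b * e) (a * e + b * d) :> R[i].
Proof. by []. Qed.

Lemma sB_trans i j x : punctured_tube E eps x -> chart_dom h i x -> chart_dom h j x ->
  sB i x = Complex (ell_trans i j x) 0 * sB j x.
Proof.
move=> px; have [q [r [t [Eq re xE]]]] := tube_polar px; rewrite xE => di dj.
rewrite !sB_polar// CmulRe.
have [_ _ /(_ i j t I di dj) /= ->] : parallel_unit (L := ell_bundle h) [set: R]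
    (fun t => tube_pt h q (r * cos t) (r * sin t)) (fun c u => sgtau c u).
  by apply: (@parallel_sgtau R n h hpos R setT _ (fun=> r) id q) => // u _; exact: cvg_id.
by congr Complex; ring.
Qed.

Lemma Bcoef_lt0 q : E q -> Bcoef q < 0.
Proof.
by move=> Eq; rewrite oppr_lt0 mulr_gt0 ?sqrtr_gt0 ?mulr_gt0 ?bnorm_gt0 ?invr_gt0.
Qed.

Lemma sB_neq0 c x : punctured_tube E eps x -> chart_dom h c x -> sB c x != 0.
Proof.
move=> px; have [q [r [t [Eq re xE]]]] := tube_polar px; rewrite xE => dc.
have [r0 _] := andP re.
rewrite sB_polar//; apply/eqP => -[re0 im0].
have B0 : Bcoef q * Num.sqrt r ^+ 3 != 0.
  by rewrite mulf_neq0// ?(lt_eqF (Bcoef_lt0 Eq))// expf_neq0// gt_eqF// sqrtr_gt0.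
have s2 := sgtau_sqr Eq re dc.
have : (Bcoef q * Num.sqrt r ^+ 3) ^+ 2 * (sgtau c t ^+ 2 * (cos (3 / 2 * t) ^+ 2 + sin (3 / 2 *
  t) ^+ 2)) = 0.
  transitivity ((sgtau c t * (Bcoef q * Num.sqrt r ^+ 3 * cos (3 / 2 * t))) ^+ 2 + (sgtau c t *
    (Bcoef q * Num.sqrt r ^+ 3 * sin (3 / 2 * t))) ^+ 2); first by ring.
  by rewrite re0 im0 expr0n/= addr0.
by rewrite s2 cos2Dsin2 !mulr1 => /eqP; rewrite sqrf_eq0 (negPf B0).
Qed.

Lemma tube_is_s x : punctured_tube E eps x -> is_tube_s h x (tube_s h x).
Proof.
move=> px; have [q [r [t [Eq re ->]]]] := tube_polar px.
rewrite tube_sE ?cos_abs_lt//; split; [exact: tube_s_lt (cos_abs_lt _ re)|exact: tubeF_tube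
  (cos_abs_lt _ re)].
Qed.

Lemma root_den_neq0 c x : punctured_tube E eps x -> chart_dom h c x ->
  2 * Num.sqrt ((if c then rad h x + rho h x else rad h x - rho h x) / 2) != 0.
Proof.
move=> px; have [q [r [t [Eq re ->]]]] := tube_polar px => dc.
have H := half_fun_neq0 hpos Eq re dc; have [r0 _] := andP re.
have [c1 c2] := cos_half t.
rewrite rad_polar// rho_tube ?cos_abs_lt// mulf_neq0// gt_eqF// sqrtr_gt0.
case: c dc H => _ /= H.
- rewrite (_ : _ / 2 = r * cos (t / 2) ^+ 2); last by rewrite c2; field.
  by rewrite mulr_gt0// lt_def sqr_ge0 sqrf_eq0 H.
- rewrite (_ : _ / 2 = r * sin (t / 2) ^+ 2); last by rewrite c1; field.
  by rewrite mulr_gt0// lt_def sqr_ge0 sqrf_eq0 H.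
Qed.

Lemma sB_cts c x : punctured_tube E eps x -> chart_dom h c x ->
  cts (fun x => complex.Re (sB c x)) x /\ cts (fun x => complex.Im (sB c x)) x.
Proof.
move=> px dc; have [cb [cr crad]] := foot_cts hpos (tube_is_s px).
have cN := @lastcoord_cts R n x; have d0 := root_den_neq0 px dc.
have cB : cts (fun x => Bcoef (foot h x)) x.
  have cs : cts (fun x => Num.sqrt (2 * bnorm h (foot h x))) x.
    by apply: cts_comp; [exact: sqrt_continuous|cts_arith].
  by rewrite /Bcoef; cts_arith.
have cp : cts (fun x => Num.sqrt ((rad h x + rho h x) / 2)) x.
  by apply: cts_comp; [exact: sqrt_continuous|cts_arith].
have cm : cts (fun x => Num.sqrt ((rad h x - rho h x) / 2)) x.
  by apply: cts_comp; [exact: sqrt_continuous|cts_arith].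
have [cA cB'] : cts (rootA c) x /\ cts (rootB c) x.
  by rewrite /rootA /rootB; case: c {dc} d0 => d0; split=> //; cts_arith.
by rewrite /sB /=; split; cts_arith.
Qed.

Lemma half_power_sB : half_power (L := ell_bundle h) (cplx h) eps 3 sB.
Proof.
split.
- by move=> i j x px di dj; exact: sB_trans.
- move=> c; split; apply: continuous_in_subspaceT => x; rewrite inE => -[px dc];
  by have [] := sB_cts px dc.
move=> q e Eq /(unit_normalP hpos Eq)[t ->].
exists (fun c z => sgtau c (z.2 + t)).
exists (Complex (Bcoef q * cos (3 / 2 * t)) (Bcoef q * sin (3 / 2 * t))); split.
  apply: (@parallel_sgtau R n h hpos _ _ _ fst (fun z => z.2 + t) q) => // [u _|u /= re].
    have c2 : cts (fun z : R * R => z.2) u by exact: cvg_snd.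
    by cts_arith.
  by rewrite normal_polarE.
move=> c r th re; rewrite normal_polarE// => dc /=.
have [r0 _] := andP re; have s2 := sgtau_sqr Eq re dc.
rewrite sB_polar// /expi.
have -> : r `^ (3%:R / 2) = Num.sqrt r ^+ 3.
  by rewrite -(powR12_sqrt (ltW r0)) -powR_mulrn ?powR_ge0// -powRrM mulrC.
rewrite mulrDr cosD sinD CmulRe !Cmul; congr Complex.
- transitivity (sgtau c (th + t) ^+ 2 * (Bcoef q * Num.sqrt r ^+ 3 * (cos (3 / 2 * th) *
  cos (3 / 2 * t) - sin (3 / 2 * th) * sin (3 / 2 * t)))); first by ring.
  by rewrite s2; ring.
- transitivity (sgtau c (th + t) ^+ 2 * (Bcoef q * Num.sqrt r ^+ 3 * (sin (3 / 2 * th) *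
  cos (3 / 2 * t) + cos (3 / 2 * th) * sin (3 / 2 * t)))); first by ring.
  by rewrite s2; ring.
Qed.

Lemma half_power_zero : half_power (L := ell_bundle h) (cplx h) eps 1 (fun _ _ => 0).
Proof.
split.
- by move=> i j x _ _ _; rewrite mulr0.
- by move=> c; split; move=> x; exact: cvg_cst.
move=> q e Eq /(unit_normalP hpos Eq)[t ->].
exists (fun c z => sgtau c (z.2 + t)), 0; split.
  apply: (@parallel_sgtau R n h hpos _ _ _ fst (fun z => z.2 + t) q) => // [u _|u /= re].
    have c2 : cts (fun z : R * R => z.2) u by exact: cvg_snd.
    by cts_arith.
  by rewrite normal_polarE.
by move=> c r th _ _; rewrite mulr0 !mul0r.
Qed.

End HalfPowers.

(** * Local integrability *)

Section LocalIntegrability.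
Context {R : realType}.
Import HBNNSimple.

(* No measurability of F is assumed: the integral of a nonnegative function is a
   supremum over simple functions. *)
Lemma integral_bounded_lty (d : measure_display) (T : measurableType d)
    (mu : {measure set T -> \bar R}) (D B : set T) (F : T -> R) (M : R) :
  measurable B -> D `<=` B -> (mu B < +oo)%E -> (forall x, D x -> 0 <= F x <= M) ->
  (\int[mu]_(x in D) (F x)%:E < +oo)%E.
Proof.
move=> mB DB Boo FM; have M0 : 0 <= Num.max M 0 by rewrite le_max lexx orbT.
have mcst : measurable_fun setT (fun x => (Num.max M 0 * \1_B x)%:E).
  by apply/measurable_EFinP; apply: measurable_funM => //; exact: measurable_indic.
rewrite integral_mkcond ge0_integralTE => [|x]; last first.
  rewrite patchE; case: ifPn => // /set_mem /FM /andP[F0 _].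
  by rewrite lee_fin.
apply: (@le_lt_trans _ _ (\int[mu]_x (Num.max M 0 * \1_B x)%:E)%E).
  apply: ge_ereal_sup => _ [g gF <-].
  rewrite -integralT_nnsfun; apply: ge0_le_integral => //.
  - by move=> x _; rewrite lee_fin; exact: fun_ge0.
  - by apply/measurable_EFinP; exact: measurable_funP.
  - move=> x _; apply: (le_trans (gF x)); rewrite patchE; case: ifPn => [/set_mem Dx|_].
      have /andP[F0 FM'] := FM x Dx.
      by rewrite indicE mem_set ?mulr1 ?lee_fin ?le_max ?FM'//; exact: DB.
    by rewrite lee_fin mulr_ge0.
under eq_integral do rewrite EFinM.
rewrite ge0_integralZl//; last by apply/measurable_EFinP; exact: measurable_indic.
rewrite integral_indic// setIT lte_mul_pinfty// lee_fin //.
Qed.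

Lemma lebesgue_space_box (n : nat) (M : R) : exists B : set (ems_type (lebesgue_space R n)),
  [/\ measurable B, (ems_mu (lebesgue_space R n) B < +oo)%E &
      forall t, (forall i, `|ems_vec t 0 i| <= M) -> B t].
Proof.
elim: n => [|n [B [mB Boo Bt]]].
  by exists setT; split=> //; rewrite /= diracT ltry.
exists (`[- M, M] `*` B); split.
- exact: measurableX.
- rewrite /= product_measure2E//= lebesgue_measure_itv/=.
  case: ifPn => [|_]; last by rewrite mul0e ltry.
  rewrite lte_fin => MM; rewrite -EFinD; apply: lte_mul_pinfty => //.
  by rewrite lee_fin; lra.
move=> [u t] tM; split=> /=.
  have := tM (lshift n (ord0 : 'I_1)); rewrite /= (row_mxEl (u%:M : 'rV_1)) mxE eqxx mulr1n.
  by rewrite in_itv/= ler_norml.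
apply: Bt => i; have := tM (rshift 1 i).
by rewrite /= (row_mxEr (u%:M : 'rV_1)).
Qed.

Lemma coord_le_norm (n : nat) (x : 'rV[R]_n.+1) i : `|x 0 i| <= `|x|.
Proof.
rewrite [leRHS]mx_normrE.
by apply: (le_bigmax _ (fun ij : 'I_1 * 'I_n.+1 => `|x ij.1 ij.2|) (0, i)).
Qed.

Lemma locally_bounded_integrable (n : nat) (F : 'rV[R]_n.+1 -> R) :
  (forall M, exists C, forall x, `|x| <= M -> 0 <= F x <= C) -> Defs.locally_integrable F.
Proof.
move=> FB K cK; have [M0 [_ KM]] := compact_bounded cK.
have KM1 x : K x -> `|x| <= M0 + 1 by apply: KM; rewrite ltrDl.
have [C FC] := FB (M0 + 1).
have [B [mB Boo Bt]] := lebesgue_space_box n.+1 (M0 + 1).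
apply: (@integral_bounded_lty _ _ _ _ B _ C) => // [t /= Kt|t /= Kt].
  by apply: Bt => i; rewrite (le_trans (coord_le_norm _ i))// KM1.
by rewrite FC// KM1.
Qed.
End LocalIntegrability.

(** * Bounds on the potential and its gradient *)

Section SolutionIntegrable.
Context {R : realType} {n : nat}.
Variable h : 'I_n -> R.
Hypothesis hpos : forall i, 0 < h i.
Hypothesis n2 : (2 <= n)%N.
Local Notation V := 'rV[R]_n.+1.
Implicit Types (x y q v : V) (c : bool).
Local Notation N := (lastcoord (R := R) (n := n)).
Local Notation E := (ellipsoid h).

Lemma prim_abs_le (g : R -> R) (C w : R) : continuous g ->
  (forall u, 0 <= g u <= C / oneDsqr u) -> `|prim g w| <= C * `|w|.
Proof.
move=> cg gC; have := @derive_le_bound R (prim g) g w C (fun u => is_derive_prim u cg gC).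
rewrite prim0 subr0; apply=> u _; have /andP[g0 gu] := gC u.
rewrite ger0_norm// (le_trans gu)//.
have C0 : 0 <= C by move: (le_trans g0 gu); rewrite pmulr_lge0// invr_gt0 oneDsqr_gt0.
by rewrite ler_piMr// oneDsqrV_le1.
Qed.

Lemma bound_oneDsqr (g C u : R) : 0 <= g <= C / oneDsqr u -> `|g| <= C.
Proof.
move=> /andP[g0 gu]; rewrite ger0_norm// (le_trans gu)//.
have C0 : 0 <= C by move: (le_trans g0 gu); rewrite pmulr_lge0// invr_gt0 oneDsqr_gt0.
by rewrite ler_piMr// oneDsqrV_le1.
Qed.

(** The ellipsoidal equation gives w^2 = x_n^2 + sum_i x_i^2 w^2 / (h_i^2 + w^2), and each fraction
    w^2 / (h_i^2 + w^2) is at most 1. *)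
Lemma wcoord_le x : wcoord h x ^+ 2 <= dot x x.
Proof.
have [w0 _] := wcoordP hpos x; set w := wcoord h x in w0 *.
rewrite /level mulrBr mulr1 => /eqP; rewrite subr_eq => /eqP ->.
rewrite dotE addrC lerD//.
rewrite mulr_sumr; apply: ler_sum => i _; rewrite mulrCA -expr2 ler_piMr ?sqr_ge0//.
by rewrite ler_pdivrMr ?hw_gt0// mul1r lerDr sqr_ge0.
Qed.

Lemma zchart_le1 c x : chart_dom h c x -> `|zchart h c x| <= 1.
Proof.
move=> dx; rewrite -(@ler_pXn2r _ 2) ?nnegrE// expr1n real_normK ?num_real//.
rewrite -level_wchart// /level gerBl sumr_ge0// => i _.
by rewrite divr_ge0 ?sqr_ge0// ltW// hw_gt0.
Qed.

Lemma dot_le_norm x (M : R) : `|x| <= M -> dot x x <= n.+1%:R * M ^+ 2.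
Proof.
move=> xM; rewrite mulr_natl -[n.+1 in leRHS]card_ord -sumr_const; apply: ler_sum => i _.
rewrite -expr2 -real_normK ?num_real// lerXn2r ?nnegrE ?(le_trans _ xM)//.
by rewrite (le_trans (coord_le_norm _ i)).
Qed.

Lemma wchart_le c x (M : R) : chart_dom h c x -> `|x| <= M ->
  `|wchart h c x| <= Num.sqrt (n.+1%:R * M ^+ 2).
Proof.
move=> dx xM; rewrite -sqrtr_sqr ler_wsqrtr// wchart_sqr// (le_trans (wcoord_le x))//.
exact: dot_le_norm.
Qed.

Lemma fchart_bounded (M : R) : exists C, forall c x, chart_dom h c x -> `|x| <= M ->
  `|fchart h c x| <= C.
Proof.
pose W := Num.sqrt (n.+1%:R * M ^+ 2).
exists (hprod2 h * (wtC h * W + \sum_(i < n) M ^+ 2 * ((hinf h)^-1 * wtC h * W) + M * 1 * wtC h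
  + M ^+ 2 * (n%:R * ((hinf h)^-1 * wtC h) * W))) => c x dx xM.
have wW := wchart_le dx xM; have z1 := zchart_le1 dx.
have M0 : 0 <= M by rewrite (le_trans _ xM).
have NM : `|N x| <= M by rewrite (le_trans (coord_le_norm _ _)).
have hM i : `|hcoord x i ^+ 2| <= M ^+ 2.
  by rewrite normrX lerXn2r ?nnegrE// (le_trans (coord_le_norm _ _)).
have C0 := wtC_gt0 h; have hi := hinf_gt0 h.
have B0 : 0 <= wtC h by exact: ltW.
have B1 : 0 <= (hinf h)^-1 * wtC h by rewrite mulr_ge0// invr_ge0 ltW.
have B2 : 0 <= n%:R * ((hinf h)^-1 * wtC h) by rewrite mulr_ge0.
rewrite /fchart /potential normrM (gtr0_norm (hprod2_gt0 hpos)) ler_wpM2l ?(ltW (hprod2_gt0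
  hpos))//.
rewrite (le_trans (ler_normD _ _))// lerD//.
  rewrite (le_trans (ler_normD _ _))// lerD//.
    rewrite (le_trans (ler_normB _ _))// lerD//.
      rewrite (le_trans (prim_abs_le _ (wt0_continuous hpos) (wt0_bounds hpos n2)))//.
      by rewrite ler_wpM2l.
    rewrite (le_trans (ler_norm_sum _ _ _))//; apply: ler_sum => i _.
    rewrite normrM ler_pM//.
    rewrite (le_trans (prim_abs_le _ (wt_continuous hpos (i := i)) (wt_bounds hpos n2 i)))//.
    by rewrite ler_wpM2l.
  rewrite !normrM ler_pM ?mulr_ge0//; first by rewrite ler_pM.
  exact: bound_oneDsqr (wt0_bounds hpos n2 _).
rewrite normrM ler_pM ?normr_ge0//; first by rewrite normrX lerXn2r ?nnegrE.
rewrite (le_trans (prim_abs_le _ (wtlast_continuous hpos) (wtlast_bounds hpos n2)))//.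
by rewrite ler_wpM2l.
Qed.

(** [dfchart] contains w and z but none of their derivatives, which blow up at the ellipsoid; so the
    gradient is bounded up to it. *)
Lemma fchart_grad_bounded (M : R) : exists C, forall c x, chart_dom h c x -> `|x| <= M ->
  grad_sq (fchart h c) x <= C.
Proof.
pose W := Num.sqrt (n.+1%:R * M ^+ 2).
pose C1 := 2 * hprod2 h * (M * ((hinf h)^-1 * wtC h * W)).
pose C2 := 2 * hprod2 h * (1 * wtC h + M * (n%:R * ((hinf h)^-1 * wtC h) * W)).
exists (\sum_(i < n) C1 ^+ 2 + C2 ^+ 2) => c x dx xM.
have wW := wchart_le dx xM; have z1 := zchart_le1 dx.
have M0 : 0 <= M by rewrite (le_trans _ xM).
have NM : `|N x| <= M by rewrite (le_trans (coord_le_norm _ _)).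
have hM i : `|hcoord x i| <= M by rewrite (le_trans (coord_le_norm _ _)).
have C0 := wtC_gt0 h; have hi := hinf_gt0 h.
have c20 : 0 <= 2 * hprod2 h by rewrite mulr_ge0// ltW// hprod2_gt0.
have B0 : 0 <= wtC h by exact: ltW.
have B1 : 0 <= (hinf h)^-1 * wtC h by rewrite mulr_ge0// invr_ge0 ltW.
have B2 : 0 <= n%:R * ((hinf h)^-1 * wtC h) by rewrite mulr_ge0.
have W0 : 0 <= W by exact: sqrtr_ge0.
have [_ dE] := has_grad_fchart hpos n2 dx.
have sqle (u C : R) : `|u| <= C -> u ^+ 2 <= C ^+ 2.
  by move=> uC; rewrite -real_normK ?num_real// lerXn2r ?nnegrE// (le_trans _ uC).
rewrite /grad_sq big_ord_recr/= lerD//.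
  apply: ler_sum => i _; rewrite dE /dfchart ext_last_widen; apply: sqle.
  rewrite normrN normrM (ger0_norm c20) ler_wpM2l// normrM ler_pM//.
  rewrite (le_trans (prim_abs_le _ (wt_continuous hpos (i := i)) (wt_bounds hpos n2 i)))//.
  by rewrite ler_wpM2l.
rewrite dE /dfchart ext_last_max; apply: sqle.
rewrite normrM (ger0_norm c20) ler_wpM2l//.
rewrite (le_trans (ler_normD _ _))// !normrM lerD// ler_pM//.
  exact: bound_oneDsqr (wt0_bounds hpos n2 _).
rewrite (le_trans (prim_abs_le _ (wtlast_continuous hpos) (wtlast_bounds hpos n2)))//.
by rewrite ler_wpM2l.
Qed.

(** On the ellipsoid itself no chart applies and [xget] returns its default 0, hence the maximum
    with 0. *)
Lemma section_fun_bounded (F : bool -> V -> R) (C M : R) x :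
  (forall c, chart_dom h c x -> 0 <= F c x <= C) ->
  0 <= xget 0 [set y | exists2 c, chart_dom h c x & y = F c x] <= Num.max C 0.
Proof.
move=> FC; case: xgetP => [y _ [c dc ->]|_]; last by rewrite lexx le_max lexx orbT.
by have /andP[-> FC'] := FC c dc; rewrite le_max FC'.
Qed.

Lemma fchart_L2loc : Defs.locally_integrable (section_sq (L := ell_bundle h) (fchart h)).
Proof.
apply: locally_bounded_integrable => M; have [C fC] := fchart_bounded M.
exists (Num.max (C ^+ 2) 0) => x xM.
apply: (@section_fun_bounded (fun c x => fchart h c x ^+ 2)) => // c dc.
rewrite sqr_ge0 -real_normK ?num_real// lerXn2r ?nnegrE//=;
  first by rewrite (le_trans _ (fC c x dc xM)).
exact: fC.
Qed.

Lemma fchart_grad_L2loc : Defs.locally_integrable (section_grad_sq (L := ell_bundle h) (fchart h)).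
Proof.
apply: locally_bounded_integrable => M; have [C fC] := fchart_grad_bounded M.
exists (Num.max C 0) => x xM.
apply: (@section_fun_bounded (fun c => grad_sq (fchart h c))) => // c dc.
rewrite fC// andbT; apply: sumr_ge0 => i _; exact: sqr_ge0.
Qed.

Lemma Z2_harmonic_fchart : Z2_harmonic (L := ell_bundle h) (cplx h) (fchart h).
Proof.
split.
- exact: ellipsoid_compact.
- exact: ellipsoid_submanifold.
- exact: coorientation_cplx.
- exact: ell_monodromy.
- exact: fchart_section.
- exact: fchart_L2loc.
- exact: fchart_grad_L2loc.
- by move=> c; exact: fchart_harmonic.
Qed.
End SolutionIntegrable.

(** * Expansion near the ellipsoid *)

Section CubicComparison.
Context {R : realType}.

Lemma sqr_le_norm (u M : R) : 0 <= M -> u ^+ 2 <= M ^+ 2 -> `|u| <= M.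
Proof.
by move=> M0 uM; rewrite -(@ler_pXn2r _ 2) ?nnegrE// real_normK ?num_real.
Qed.

(* In complex notation: |w - e| |e| <= |w^2 - e^2| for w, e in the same closed
   quadrant. *)
Lemma same_quadrant (w1 w2 e1 e2 d : R) : 0 <= w1 * e1 -> 0 <= w2 * e2 ->
  w1 * w2 = e1 * e2 -> d = w1 ^+ 2 - w2 ^+ 2 - (e1 ^+ 2 - e2 ^+ 2) ->
  ((w1 - e1) ^+ 2 + (w2 - e2) ^+ 2) * (e1 ^+ 2 + e2 ^+ 2) <= d ^+ 2.
Proof.
move=> p1 p2 im ->.
set P := (w1 - e1) ^+ 2 + (w2 - e2) ^+ 2.
have P0 : 0 <= P by rewrite addr_ge0 ?sqr_ge0.
have -> : (w1 ^+ 2 - w2 ^+ 2 - (e1 ^+ 2 - e2 ^+ 2)) ^+ 2 =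
    P * ((w1 + e1) ^+ 2 + (w2 + e2) ^+ 2) - 4 * (w1 * w2 - e1 * e2) ^+ 2.
  by rewrite /P; ring.
rewrite im subrr expr0n/= mulr0 subr0 ler_wpM2l//.
rewrite -subr_ge0.
have -> : (w1 + e1) ^+ 2 + (w2 + e2) ^+ 2 - (e1 ^+ 2 + e2 ^+ 2) =
  w1 ^+ 2 + w2 ^+ 2 + 2 * (w1 * e1) + 2 * (w2 * e2) by ring.
by rewrite !addr_ge0 ?sqr_ge0// mulr_ge0.
Qed.

(** The cubic is Re (w1 + i w2)^3. Its increment splits into three products, which contribute 3, 3
    and 6 to the constant 12. *)
Lemma re_cube_dist (w1 w2 e1 e2 M D : R) : 0 <= M -> 0 <= D ->
  `|w1| <= M -> `|w2| <= M -> `|e1| <= M -> `|e2| <= M ->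
  `|w1 - e1| <= D -> `|w2 - e2| <= D ->
  `|(w1 ^+ 3 - 3 * w1 * w2 ^+ 2) - (e1 ^+ 3 - 3 * e1 * e2 ^+ 2)| <= 12 * M ^+ 2 * D.
Proof.
move=> M0 D0 h1 h2 h3 h4 d1 d2.
have -> : (w1 ^+ 3 - 3 * w1 * w2 ^+ 2) - (e1 ^+ 3 - 3 * e1 * e2 ^+ 2) =
  (w1 - e1) * (w1 * w1 + w1 * e1 + e1 * e1) - 3 * ((w1 - e1) * (w2 * w2))
  - 3 * ((w2 - e2) * (e1 * (w2 + e2))) by ring.
have pM (u v : R) : `|u| <= M -> `|v| <= M -> `|u * v| <= M ^+ 2.
  by move=> uM vM; rewrite normrM expr2 ler_pM.
have pD (u v X : R) : `|u| <= D -> `|v| <= X -> `|u * v| <= D * X.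
  by move=> uM vM; rewrite normrM ler_pM.
have A1 : `|(w1 - e1) * (w1 * w1 + w1 * e1 + e1 * e1)| <= D * (3 * M ^+ 2).
  apply: pD => //; have := pM _ _ h1 h1; have := pM _ _ h1 h3; have := pM _ _ h3 h3.
  by rewrite !ler_norml => /andP[? ?] /andP[? ?] /andP[? ?]; apply/andP; split; lra.
have A2 : `|(w1 - e1) * (w2 * w2)| <= D * M ^+ 2 by apply: pD => //; exact: pM.
have A3 : `|(w2 - e2) * (e1 * (w2 + e2))| <= D * (2 * M ^+ 2).
  apply: pD => //; rewrite mulrDr; have := pM _ _ h3 h2; have := pM _ _ h3 h4.
  by rewrite !ler_norml => /andP[? ?] /andP[? ?]; apply/andP; split; lra.
move: A1 A2 A3; rewrite !ler_norml => /andP[? ?] /andP[? ?] /andP[? ?].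
by apply/andP; split; lra.
Qed.
End CubicComparison.

Section Expansion.
Context {R : realType} {n : nat}.
Variable h : 'I_n -> R.
Hypothesis hpos : forall i, 0 < h i.
Hypothesis n2 : (2 <= n)%N.
Local Notation V := 'rV[R]_n.+1.
Implicit Types (x y q v : V) (a b s u r : R) (c : bool).
Local Notation N := (lastcoord (R := R) (n := n)).
Local Notation E := (ellipsoid h).
Local Notation H := (hsup h).
Local Notation m := (hinf h).
Local Notation eps := (tube_eps h).

Let H1 : 1 <= H. Proof. exact: hsup_ge1. Qed.
Let H0 : 0 < H. Proof. exact: hsup_gt0. Qed.
Let m0 : 0 < m. Proof. exact: hinf_gt0. Qed.
Let m1 : m <= 1. Proof. exact: hinf_le1. Qed.
Let mi1 : 1 <= m^-1. Proof. by rewrite invf_ge1. Qed.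

Lemma bnorm_le q : E q -> bnorm h q <= m^-1.
Proof.
move=> Eq; have [Q1 _] := (ellipsoidP _ q).1 Eq.
have -> : m^-1 = Num.sqrt (m^-1 ^+ 2) by rewrite sqrtr_sqr ger0_norm// invr_ge0 ltW.
apply: ler_wsqrtr.
by rewrite (le_trans (beta_le hpos q))// Q1 mulr1 expr2 ler_peMr// invr_ge0 ltW.
Qed.

(* Constants depending on h only, so that the expansions are uniform along the
   ellipsoid. *)
Definition expC1 : R := 20 * H * (7 * m^-1).
Definition expC2 : R := 3 * m^-1 ^+ 2 * (H + expC1).
Definition expC3 : R := hprod2 h * (n%:R * (m^-1 * wtC h)).
Definition expC4 : R := expC3 * expC1 * (2 * (1 + 3 * m^-1) * expC1) + expC1 * expC2 + expC3.
Definition expC5 : R := expC2 * expC1 + m^-1.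
Definition expC6 : R := (expC4 + H * (16 * m^-1 ^+ 2 * expC1 * expC5 * H)) * expC1.
Definition expC7 : R := 2 * m^-1 + expC6.

Let mi0 : 0 <= m^-1. Proof. by rewrite invr_ge0 ltW. Qed.

Lemma expC1_ge1 : 1 <= expC1.
Proof.
rewrite /expC1 (_ : 20 * H * (7 * m^-1) = 140 * (H * m^-1)); last by ring.
have : 1 <= H * m^-1 by rewrite (le_trans H1)// ler_peMr// ltW.
by lra.
Qed.

Let C1_ge0 : 0 <= expC1. Proof. exact: le_trans expC1_ge1. Qed.

Let C2_ge0 : 0 <= expC2.
Proof.
have mi20 : 0 <= m^-1 ^+ 2 by rewrite sqr_ge0.
by rewrite /expC2; apply: mulr_ge0; [exact: mulr_ge0|apply: addr_ge0 => //; exact: ltW].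
Qed.

Let C3_ge0 : 0 <= expC3.
Proof.
rewrite /expC3; apply: mulr_ge0; first exact: ltW (hprod2_gt0 hpos).
by apply: mulr_ge0 => //; apply: mulr_ge0 => //; exact: ltW (wtC_gt0 h).
Qed.

Let C4_ge0 : 0 <= expC4.
Proof.
rewrite /expC4; apply: addr_ge0 => //; apply: addr_ge0; last exact: mulr_ge0.
apply: mulr_ge0; first exact: mulr_ge0.
apply: mulr_ge0 => //; apply: mulr_ge0 => //; apply: addr_ge0 => //; exact: mulr_ge0.
Qed.

Let C5_ge0 : 0 <= expC5.
Proof. by apply: addr_ge0 => //; exact: mulr_ge0. Qed.

(** * Estimates at one point of the tube *)

Section Point.
Variables (q : V) (a b : R) (c : bool).
Let r := Num.sqrt (a ^+ 2 + b ^+ 2).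
Hypothesis Eq : E q.
Hypothesis re : 0 < r < eps.
Let x := tube_pt h q a b.
Hypothesis dx : chart_dom h c x.
Let w := wchart h c x.
Let z := zchart h c x.
Let k := bnorm h q.
Let s := a / k.
Let d := a * (2 * k + a * quad h (nu h q)).

Let r0 : 0 < r. Proof. by case/andP: re. Qed.
Let r_lt : r < eps. Proof. by case/andP: re. Qed.
Let r1 : r <= 1. Proof. by rewrite ltW// (lt_le_trans r_lt)// tube_eps_le1. Qed.
Let k0 : 0 < k. Proof. exact: bnorm_gt0. Qed.
Let aR : `|a| <= r. Proof. exact: abs_le_hypot. Qed.
Let bR : `|b| <= r. Proof. by rewrite /r addrC abs_le_hypot. Qed.
Let ae : `|a| < eps. Proof. exact: le_lt_trans r_lt. Qed.
Let Q1 : quad h q = 1. Proof. by case: ((ellipsoidP _ q).1 Eq). Qed.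
Let wz : w * z = b. Proof. by rewrite /w /z wz_chart// last_tube. Qed.
Let lev : level h x w = z ^+ 2. Proof. exact: level_wchart. Qed.
Let quadx : quad h x = 1 + d. Proof. exact: quad_tube. Qed.
Let Qnu0 : 0 <= quad h (nu h q).
Proof. by apply: sumr_ge0 => j _; rewrite divr_ge0 ?sqr_ge0. Qed.
Let Qnu : quad h (nu h q) <= m^-1. Proof. exact: quad_nu_le. Qed.
Let sm : `|s| < m / 2. Proof. exact: tube_s_lt2. Qed.

Let sR : `|s| <= H * r.
Proof.
rewrite /s normrM normfV (gtr0_norm k0) ler_pdivrMr// mulrAC.
rewrite (le_trans aR)// ler_peMl ?(ltW r0)//.
by rewrite -ler_pdivrMl// mulr1 bnorm_ge.
Qed.

Let dR : `|d| <= 3 * m^-1 * r.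
Proof.
rewrite /d normrM mulrC ler_pM//.
have : `|a * quad h (nu h q)| <= m^-1.
  rewrite normrM (ger0_norm Qnu0) (le_trans (ler_pM _ _ (le_trans aR r1) Qnu))//.
  by rewrite mul1r.
have kk : k <= m^-1 by exact: bnorm_le.
by have := k0; rewrite !ler_norml => ? /andP[? ?]; apply/andP; split; lra.
Qed.

Let hcx j : hcoord x j = hcoord q j * (1 + s / h j ^+ 2). Proof. exact: hcoord_tube. Qed.

Let sh j : `|s / h j ^+ 2| <= 1 / 2.
Proof.
rewrite normrM normfV (gtr0_norm (h2_gt0 hpos j)) ler_pdivrMr ?h2_gt0//.
have := sm; have := hinf_le hpos j; lra.
Qed.

Let quad_lo : 1 / 4 <= quad h x.
Proof.
suff : 1 / 4 * quad h q <= quad h x by rewrite Q1 mulr1.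
rewrite mulr_sumr; apply: ler_sum => j _.
rewrite hcx exprMn [leRHS]mulrAC [leRHS]mulrC ler_wpM2r ?divr_ge0 ?sqr_ge0//.
by have := sh j; rewrite ler_norml => /andP[? ?]; nra.
Qed.

Let quad_hi : quad h x <= 3.
Proof.
suff : quad h x <= 3 * quad h q by rewrite Q1 mulr1.
rewrite mulr_sumr; apply: ler_sum => j _.
rewrite hcx exprMn mulrAC [leLHS]mulrC ler_wpM2r ?divr_ge0 ?sqr_ge0//.
by have := sh j; rewrite ler_norml => /andP[? ?]; nra.
Qed.

Let w2_hi : w ^+ 2 <= 4 * H.
Proof.
rewrite /w wchart_sqr// (le_trans (wcoord_le hpos x))// dotE last_tube//.
have : b * b <= 1.
  by rewrite -expr2 -real_normK ?num_real// expr_le1// (le_trans bR).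
suff : \sum_(j < n) hcoord x j * hcoord x j <= 3 * H by have := H1; lra.
apply: (@le_trans _ _ (H * quad h x)); last by rewrite [leRHS]mulrC ler_pM2l.
rewrite mulr_sumr; apply: ler_sum => j _; rewrite -expr2 mulrCA ler_peMr ?sqr_ge0//.
by rewrite ler_pdivlMr ?h2_gt0// mul1r le_hsup.
Qed.

Let k0w := kap h x x 0 w.

(** Since [level x 0] is -d, this is [levelB] between 0 and w. It is the exact real part of (sqrt
    k0w w + i z)^2, whose imaginary part is 2 sqrt k0w b. *)
Let k0w_eq : k0w * w ^+ 2 - z ^+ 2 = d.
Proof.
have := levelB hpos x 0 w; rewrite lev level0 quadx expr0n/= subr0 -/k0w.
by rewrite (mulrC (w ^+ 2)); lra.
Qed.

(** The factor 20 is 5 times 4: h_j^2 + w^2 <= 5 H by [w2_hi], and [quad h x] >= 1 / 4. *)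
Let k0w_lo : (20 * H)^-1 <= k0w.
Proof.
rewrite /k0w /kap; apply: (@le_trans _ _ ((5 * H)^-1 * quad h x)).
  rewrite (_ : (20 * H)^-1 = (5 * H)^-1 * (1 / 4)); last by field; rewrite gt_eqF.
  by apply: ler_wpM2l quad_lo; rewrite invr_ge0 mulr_ge0// ltW.
rewrite mulr_sumr; apply: ler_sum => j _.
rewrite mulrCA ler_wpM2l ?sqr_ge0// expr0n/= addr0 -invfM.
rewrite lef_pV2 ?posrE ?mulr_gt0 ?h2_gt0 ?hw_gt0// [leRHS]mulrC ler_pM2l ?h2_gt0//.
by have := le_hsup h j; have := w2_hi; lra.
Qed.

Let kap_hi u : kap h x x u w <= 3 * m^-1.
Proof.
apply: (@le_trans _ _ (m^-1 * quad h x)); last first.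
  by rewrite [leRHS]mulrC; apply: ler_wpM2l quad_hi; rewrite invr_ge0 ltW.
rewrite mulr_sumr; apply: ler_sum => j _.
rewrite mulrCA ler_wpM2l ?sqr_ge0// -invfM lef_pV2 ?posrE ?mulr_gt0 ?h2_gt0 ?hw_gt0//.
rewrite mulrC ler_pM ?(ltW m0) ?(ltW (h2_gt0 hpos j))//; last first.
  by rewrite (le_trans (hinf_le hpos j))// lerDl sqr_ge0.
by rewrite lerDl sqr_ge0.
Qed.

(** The square of k0w w^2 + z^2 is d^2 + 4 k0w b^2, and 4 k0w <= (k0w + 1)^2, so the sum is at most
    |d| + (k0w + 1) |b|. The 7 is 3 from |d| plus 4 from k0w + 1, and (20 H)^-1 bounds both k0w and
    1 from below. *)
Let wz_bound : w ^+ 2 + z ^+ 2 <= 20 * H * (7 * m^-1) * r.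
Proof.
have k1 : 0 < k0w by apply: lt_le_trans k0w_lo; rewrite invr_gt0 mulr_gt0.
have P0 : 0 <= k0w * w ^+ 2 + z ^+ 2.
  by apply: addr_ge0 (sqr_ge0 z); apply: mulr_ge0 (sqr_ge0 w); exact: ltW.
have khi : k0w <= 3 * m^-1 by exact: kap_hi.
have step : k0w * w ^+ 2 + z ^+ 2 <= `|d| + (k0w + 1) * `|b|.
  rewrite -(@ler_pXn2r _ 2) ?nnegrE//; last by rewrite addr_ge0 ?mulr_ge0// addr_ge0// ltW.
  have -> : (k0w * w ^+ 2 + z ^+ 2) ^+ 2 = (k0w * w ^+ 2 - z ^+ 2) ^+ 2 + 4 * k0w * (w *
    z) ^+ 2 by ring.
  rewrite k0w_eq wz -(real_normK (num_real d)) -(real_normK (num_real b)).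
  have := normr_ge0 d; have := normr_ge0 b; set B := `|b|; set D := `|d| => B0 D0.
  rewrite -subr_ge0.
  have -> : (D + (k0w + 1) * B) ^+ 2 - (D ^+ 2 + 4 * k0w * B ^+ 2) =
     2 * (D * ((k0w + 1) * B)) + ((k0w - 1) * B) ^+ 2 by ring.
  by rewrite addr_ge0 ?sqr_ge0// !mulr_ge0// addr_ge0// ltW.
have step2 : `|d| + (k0w + 1) * `|b| <= 7 * m^-1 * r.
  apply: (@le_trans _ _ (3 * m^-1 * r + (4 * m^-1) * r)); last by rewrite -mulrDl -mulrDl; lra.
  rewrite lerD// ler_pM//; first by rewrite addr_ge0// ltW.
  by have := mi1; lra.
have k20 : (20 * H)^-1 * (w ^+ 2 + z ^+ 2) <= k0w * w ^+ 2 + z ^+ 2.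
  rewrite mulrDr lerD ?ler_wpM2r ?sqr_ge0// ler_piMl ?sqr_ge0//.
  by rewrite invf_le1 ?mulr_gt0//; have := H1; lra.
have H20 : 0 < 20 * H by rewrite mulr_gt0.
rewrite -mulrA -ler_pdivrMl//.
exact: le_trans (le_trans k20 step) step2.
Qed.

(** At s = u = w = 0 the two sums coincide term by term, and over a common denominator the
    difference of the j-th terms is linear in s, u^2 and w^2 to leading order. The weights q_j^2 /
    h_j^2 sum to 1, so a bound for each j suffices. *)
Let kap_beta u : `|u| <= `|w| -> `|kap h x x u w - beta h q| <= 3 * m^-1 ^+ 2 * (`|s| + w ^+ 2).
Proof.
move=> uw; have u2 : u ^+ 2 <= w ^+ 2.
  by rewrite -(real_normK (num_real u)) -(real_normK (num_real w)) lerXn2r ?nnegrE.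
rewrite -(mulr1 (_ * (_ + _))) -[X in _ * X]Q1 mulr_sumr /kap /beta -sumrB.
apply: (le_trans (ler_norm_sum _ _ _)); apply: ler_sum => j _.
have y0 := h2_gt0 hpos j; have ym := hinf_le hpos j; rewrite hcx.
have u20 := sqr_ge0 u; have w20 := sqr_ge0 w.
set y := h j ^+ 2 in y0 ym *; set U := u ^+ 2 in u2 u20 *; set W := w ^+ 2 in u2 w20 *.
have den0 : 0 < y * ((y + U) * (y + W)) by rewrite !mulr_gt0// ltr_pwDl.
have -> : (hcoord q j * (1 + s / y)) ^+ 2 / ((y + U) * (y + W)) - (hcoord q j / y) ^+ 2 =
   hcoord q j ^+ 2 / y * (((2 * y * s + s ^+ 2) - (y * (U + W) + U * W)) / (y * ((y + U) * (y +
     W)))).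
  by field; rewrite !gt_eqF// ltr_pwDl.
have qy0 : 0 <= hcoord q j ^+ 2 / y by rewrite divr_ge0 ?sqr_ge0// ltW.
rewrite normrM (ger0_norm qy0) [leRHS]mulrC ler_wpM2l//.
rewrite normrM normfV (gtr0_norm den0) ler_pdivrMr//.
have sy : `|s| <= y by have := sm; have := m0; lra.
have num : `|2 * y * s + s ^+ 2 - (y * (U + W) + U * W)| <= 3 * y * `|s| + 2 * y * W + U * W.
  have s2 : s ^+ 2 <= y * `|s|.
    by rewrite -(real_normK (num_real s)) expr2 ler_wpM2r.
  have sa : - (y * `|s|) <= y * s <= y * `|s|.
    by rewrite -mulrN !ler_pM2l// ler_norm lerNl -normrN ler_norm.
  have [sa1 sa2] := andP sa.
  have UW : 0 <= U * W by rewrite mulr_ge0.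
  have yU : y * U <= y * W by rewrite ler_pM2l.
  have yU0 : 0 <= y * U by rewrite mulr_ge0// ltW.
  have yW0 : 0 <= y * W by rewrite mulr_ge0// ltW.
  have := sqr_ge0 s.
  by rewrite ler_norml => ss; apply/andP; split; lra.
apply: (le_trans num).
have m2 : m^-1 ^+ 2 * (y * y) >= 1.
  by rewrite -expr2 -exprMn exprn_ege1// mulrC ler_pdivlMr// mul1r.
have den1 : y * y * y <= y * ((y + U) * (y + W)).
  by rewrite -mulrA ler_pM2l// ler_pM ?(ltW y0)// lerDl.
have den2 : y * (U * y) <= y * ((y + U) * (y + W)).
  by rewrite ler_pM2l// ler_pM ?(ltW y0)// ?lerDr ?lerDl ?(ltW y0).
have mi20 : 0 <= m^-1 ^+ 2 by rewrite sqr_ge0.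
have t1 : y <= m^-1 ^+ 2 * (y * ((y + U) * (y + W))).
  by rewrite (le_trans _ (ler_wpM2l mi20 den1))// [leRHS]mulrA ler_peMl// ltW.
have t2 : U <= m^-1 ^+ 2 * (y * ((y + U) * (y + W))).
  rewrite (le_trans _ (ler_wpM2l mi20 den2))//.
  by rewrite (_ : _ * _ = m^-1 ^+ 2 * (y * y) * U); [rewrite ler_peMl|ring].
set DD := m^-1 ^+ 2 * (y * ((y + U) * (y + W))) in t1 t2 *.
have -> : 3 * m^-1 ^+ 2 * (`|s| + W) * (y * ((y + U) * (y + W))) = 3 * `|s| * DD + 3 * W * DD.
  by rewrite /DD; ring.
have e1 : `|s| * y <= `|s| * DD by rewrite ler_wpM2l.
have e2 : W * y <= W * DD by rewrite ler_wpM2l.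
have e3 : W * U <= W * DD by rewrite ler_wpM2l.
by lra.
Qed.

Lemma tube_wz_le : w ^+ 2 + z ^+ 2 <= expC1 * r.
Proof. exact: wz_bound. Qed.

Lemma tube_kap_le u : `|u| <= `|w| -> `|kap h x x u w - beta h q| <= expC2 * r.
Proof.
move=> uw; apply: (le_trans (kap_beta uw)); rewrite /expC2 -[leRHS]mulrA; apply: ler_wpM2l.
  by apply: mulr_ge0; rewrite ?sqr_ge0.
by rewrite mulrDl lerD// (le_trans _ wz_bound)// lerDl sqr_ge0.
Qed.

Let wt0_0 : hprod2 h * wt0 h 0 = 1 / 2.
Proof.
have P0 : 0 < \prod_(j < n) h j by apply: prodr_gt0.
rewrite /wt0 S_polyE expr0n/=.
under eq_bigr do rewrite add0r.
rewrite prodrXl sqrtr_sqr gtr0_norm// /hprod2.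
by field; rewrite gt_eqF.
Qed.

(** The derivative -u [wtlast] has a factor u, so the mean value inequality gives order u^2 instead
    of u. *)
Let wt0_dist u : `|hprod2 h * wt0 h u - 1 / 2| <= expC3 * u ^+ 2.
Proof.
have c0 := hprod2_gt0 hpos.
rewrite -wt0_0 -mulrBr normrM (gtr0_norm c0) /expC3 -mulrA ler_wpM2l ?(ltW c0)//.
have C0 : 0 <= n%:R * ((hinf h)^-1 * wtC h).
  apply: mulr_ge0 => //; apply: mulr_ge0; first by rewrite invr_ge0 ltW.
  exact: ltW (wtC_gt0 h).
have := @derive_le_bound R (wt0 h) _ u (`|u| * (n%:R * ((hinf h)^-1 * wtC h))) (is_derive_wt0 hpos).
have -> : n%:R * ((hinf h)^-1 * wtC h) * u ^+ 2 = `|u| * (n%:R * ((hinf h)^-1 * wtC h)) * `|u|.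
  by rewrite -(real_normK (num_real u)); ring.
apply=> v vu.
rewrite normrM normrN ler_pM//.
exact: bound_oneDsqr (wtlast_bounds hpos n2 v).
Qed.

(** The integral part A is compared with half the integral of z^2 - beta (w^2 - u^2), obtained by
    freezing [hprod2 h * wt0 h u] at 1/2 and [kap] at beta; it equals z^2 w / 2 - beta w^3 / 3. The
    boundary term, with x_n z = w z^2, supplies the other half of w z^2. For |u| <= |w| freezing
    costs O(r^2) in the integrand, hence O(r^2 |w|). *)
Lemma fchart_main :
  `|fchart h c x - (w * z ^+ 2 - beta h q * w ^+ 3 / 3)| <= expC4 * r ^+ 2 * `|w|.
Proof.
have c0 := hprod2_gt0 hpos; have wzr := tube_wz_le.
have w2r : w ^+ 2 <= expC1 * r by apply: le_trans wzr; rewrite lerDl sqr_ge0.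
have z2r : z ^+ 2 <= expC1 * r by apply: le_trans wzr; rewrite lerDr sqr_ge0.
have Cr0 : 0 <= expC1 * r by rewrite mulr_ge0// ltW.
pose A u := hprod2 h * (prim (wt0 h) u - \sum_(i < n) hcoord x i ^+ 2 * prim (wt h i) u).
pose B u := A u - 1 / 2 * (z ^+ 2 * u - beta h q * (w ^+ 2 * u - u ^+ 3 / 3)).
pose dB u := hprod2 h * wt0 h u * level h x u - 1 / 2 * (z ^+ 2 - beta h q * (w ^+ 2 - u ^+ 2)).
have dBP u : is_derive u (1 : R) B (dB u).
  have dS : is_derive u (1 : R) (fun u => \sum_(i < n) hcoord x i ^+ 2 *
    prim (wt h i) u) (\sum_(i < n) hcoord x i ^+ 2 * wt h i u).
    have HS := @is_derive_sum R R R n (fun i => hcoord x i ^+ 2 \*: prim (wt h i)) u 1 _ (fun i =>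
      is_deriveZ (hcoord x i ^+ 2) (is_derive_prim_wt hpos n2 i u)).
    have -> : (fun u => \sum_(i < n) hcoord x i ^+ 2 * prim (wt h i) u) =
      \sum_(i < n) (hcoord x i ^+ 2 \*: prim (wt h i)).
      by apply/funext => v; rewrite fct_sumE.
    exact: HS.
  have d1 := is_deriveZ (hprod2 h) (is_deriveB (is_derive_prim_wt0 hpos n2 u) dS).
  have d3 : is_derive u (1 : R) (fun u : R => u ^+ 3) (3 * u ^+ 2).
    apply: DeriveDef; first exact: exprn_derivable.
    by rewrite exp_derive /GRing.scale/= mulr1.
  have did : is_derive u (1 : R) (fun u : R => u) 1 := is_derive_id u 1.
  have d2 := is_deriveZ (- (1 / 2)) (is_deriveB (is_deriveZ (z ^+ 2) did)
     (is_deriveZ (beta h q) (is_deriveB (is_deriveZ (w ^+ 2) did) (is_deriveZ 3^-1 d3)))).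
  have d12 := is_deriveD d1 d2.
  have -> : B = (hprod2 h \*: (prim (wt0 h) - (fun u => \sum_(i < n) hcoord x i ^+ 2 *
    prim (wt h i) u))) +
     (- (1 / 2) \*: (z ^+ 2 \*: (fun u => u) - beta h q \*: (w ^+ 2 \*: (fun u => u) -
       3^-1 \*: (fun u => u ^+ 3)))).
    apply/funext => v; rewrite /B /A /=.
    change (hprod2 h * (prim (wt0 h) v - \sum_(i < n) hcoord x i ^+ 2 * prim (wt h i) v) -
      1 / 2 * (z ^+ 2 * v - beta h q * (w ^+ 2 * v - v ^+ 3 / 3)) =
      hprod2 h * (prim (wt0 h) v - \sum_(i < n) hcoord x i ^+ 2 * prim (wt h i) v) +
      - (1 / 2) * (z ^+ 2 * v - beta h q * (w ^+ 2 * v - 3^-1 * v ^+ 3))).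
    by ring.
  apply: (@is_derive_eq _ _ _ _ _ _ _ _ d12).
  rewrite /dB /level /GRing.scale/=.
  have -> : \sum_(i < n) hcoord x i ^+ 2 * wt h i u = wt0 h u *
    \sum_(i < n) hcoord x i ^+ 2 / (h i ^+ 2 + u ^+ 2).
    by rewrite mulr_sumr; apply: eq_bigr => i _; rewrite wtE (addrC (u ^+ 2)); ring.
  by field.
have B0 : B 0 = 0.
  rewrite /B /A prim0 big1 => [|i _]; last by rewrite prim0 mulr0.
  by rewrite expr0n/=; ring.
have Bw : `|B w| <= (expC3 * (expC1 * r) * ((1 + 3 * m^-1) * (expC1 * r)) + 1 / 2 * (expC1 * r *
  (expC2 * r))) * `|w|.
  have := @derive_le_bound R B dB w _ dBP; rewrite B0 subr0; apply=> u uw.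
  have u2 : u ^+ 2 <= w ^+ 2.
    by rewrite -(real_normK (num_real u)) -(real_normK (num_real w)) lerXn2r ?nnegrE.
  have levu : level h x u = z ^+ 2 - (w ^+ 2 - u ^+ 2) * kap h x x u w.
    by rewrite -levelB// lev; ring.
  have -> : dB u = (hprod2 h * wt0 h u - 1 / 2) * level h x u
     - 1 / 2 * ((w ^+ 2 - u ^+ 2) * (kap h x x u w - beta h q)).
    by rewrite /dB levu; ring.
  have wu0 : 0 <= w ^+ 2 - u ^+ 2 by rewrite subr_ge0.
  have wu : w ^+ 2 - u ^+ 2 <= expC1 * r by have := sqr_ge0 u; lra.
  have kh := kap_hi u; have kp := kap_ge0 hpos x x u w.
  apply: (le_trans (ler_normB _ _)); rewrite lerD//.
    rewrite normrM ler_pM//.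
      by rewrite (le_trans (wt0_dist u))// ler_wpM2l// (le_trans u2).
    rewrite levu (le_trans (ler_normB _ _))// [leRHS]mulrDl mul1r lerD//.
      by rewrite ger0_norm ?sqr_ge0.
    by rewrite normrM (ger0_norm wu0) (ger0_norm kp) mulrC ler_pM.
  rewrite normrM (@ger0_norm _ (1 / 2))// ler_wpM2l//.
  rewrite normrM (ger0_norm wu0) ler_pM//.
  exact: tube_kap_le.
have Lw : `|prim (wtlast h) w| <= n%:R * ((hinf h)^-1 * wtC h) * `|w|.
  exact: prim_abs_le (wtlast_continuous hpos) (wtlast_bounds hpos n2).
have -> : fchart h c x - (w * z ^+ 2 - beta h q * w ^+ 3 / 3) =
   B w + (w * (z ^+ 2 * (hprod2 h * wt0 h w - 1 / 2)) + b ^+ 2 * (hprod2 h * prim (wtlast h) w)).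
  rewrite /fchart /potential -/w -/z /B /A last_tube// -wz.
  by field.
apply: (le_trans (ler_normD _ _)).
have T1 : `|w * (z ^+ 2 * (hprod2 h * wt0 h w - 1 / 2))| <= `|w| * (expC1 * r * (expC3 * (expC1 *
  r))).
  rewrite normrM ler_wpM2l// normrM (ger0_norm (sqr_ge0 z)) ler_pM ?sqr_ge0//.
  by rewrite (le_trans (wt0_dist w))// ler_wpM2l.
have T2 : `|b ^+ 2 * (hprod2 h * prim (wtlast h) w)| <= r ^+ 2 * (expC3 * `|w|).
  rewrite normrM ler_pM//.
    by rewrite normrX lerXn2r ?nnegrE// ltW.
  by rewrite normrM (gtr0_norm c0) /expC3 -[leRHS]mulrA ler_wpM2l ?(ltW c0).
have T12 := le_trans (ler_normD _ _) (lerD T1 T2).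
apply: (le_trans (lerD Bw T12)); rewrite -subr_ge0.
have -> : expC4 * r ^+ 2 * `|w| - ((expC3 * (expC1 * r) * ((1 + 3 * m^-1) * (expC1 * r)) + 1 / 2 *
  (expC1 * r * (expC2 * r))) * `|w| +
    (`|w| * (expC1 * r * (expC3 * (expC1 * r))) + r ^+ 2 * (expC3 * `|w|))) =
   (expC3 * expC1 ^+ 2 * (3 * m^-1) + 1 / 2 * (expC1 * expC2)) * (r ^+ 2 * `|w|).
  by rewrite /expC4; field; rewrite gt_eqF.
have r20 : 0 <= r ^+ 2 by exact: sqr_ge0.
have C10 : 0 <= expC1 ^+ 2 by exact: sqr_ge0.
apply: mulr_ge0; last exact: mulr_ge0.
apply: addr_ge0; first by apply: mulr_ge0; apply: mulr_ge0.
by apply: mulr_ge0 => //; apply: mulr_ge0.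
Qed.

(** By [k0w_eq] the leftovers are a^2 quad (nu) and (k0w - beta) w^2, and each contains two factors
    of order r. *)
Lemma re_square_dist : `|(k * w) ^+ 2 - z ^+ 2 - 2 * k * a| <= expC5 * r ^+ 2.
Proof.
have -> : (k * w) ^+ 2 - z ^+ 2 - 2 * k * a = a ^+ 2 * quad h (nu h q) - (k0w - beta h q) * w ^+ 2.
  by rewrite exprMn bnorm_sqr; move: k0w_eq; rewrite /d; lra.
apply: (le_trans (ler_normB _ _)); rewrite /expC5 [leRHS]mulrDl [leLHS]addrC lerD//.
  rewrite normrM (ger0_norm (sqr_ge0 w)).
  apply: (@le_trans _ _ (expC2 * r * (expC1 * r))).
    apply: ler_pM => //; rewrite ?sqr_ge0//.
      by apply: tube_kap_le; rewrite normr0.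
    by apply: le_trans tube_wz_le; rewrite lerDl sqr_ge0.
  by rewrite le_eqVlt; apply/orP; left; apply/eqP; ring.
rewrite normrM (ger0_norm Qnu0) normrX mulrC ler_pM// ?exprn_ge0//.
by rewrite lerXn2r ?nnegrE// ltW.
Qed.

End Point.

(** * Comparison with the cube of the square root of zeta *)

Section Polar.
Variables (q : V) (r t : R) (c : bool).
Hypothesis Eq : E q.
Hypothesis re : 0 < r < eps.
Let x := tube_pt h q (r * cos t) (r * sin t).
Hypothesis dx : chart_dom h c x.
Let w := wchart h c x.
Let z := zchart h c x.
Let k := bnorm h q.
Let A := rootA h c x.
Let B := rootB h c x.
Let g := Num.sqrt (2 * k).
Let u := Num.sqrt r.

Let r0 : 0 < r. Proof. by case/andP: re. Qed.
Let u0 : 0 < u. Proof. by rewrite sqrtr_gt0. Qed.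
Let u2 : u ^+ 2 = r. Proof. by rewrite sqr_sqrtr// ltW. Qed.
Let u1 : u <= 1.
Proof.
rewrite -(@ler_pXn2r _ 2) ?nnegrE ?(ltW u0)// u2 expr1n ltW//.
by case/andP: re => _ rl; apply: (lt_le_trans rl); exact: tube_eps_le1.
Qed.
Let k0 : 0 < k. Proof. exact: bnorm_gt0. Qed.
Let g2 : g ^+ 2 = 2 * k. Proof. by rewrite sqr_sqrtr// mulr_ge0// ltW. Qed.
Let hyp : Num.sqrt ((r * cos t) ^+ 2 + (r * sin t) ^+ 2) = r.
Proof. by rewrite !exprMn -mulrDr cos2Dsin2 mulr1 sqrtr_sqr gtr0_norm. Qed.

Let root_eqs : [/\ A ^+ 2 - B ^+ 2 = r * cos t, 2 * (A * B) = r * sin t & A ^+ 2 + B ^+ 2 = r].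
Proof.
rewrite /A /B /x; have [-> ->] := root_polar hpos Eq re dx.
have s2 := sgtau_sqr hpos Eq re dx; have [c1 c2] := cos_half t; have s1 := sin_half t.
rewrite !exprMn s2 !mul1r -/u u2 c2 s1.
have cs : sin (t / 2) ^+ 2 = 1 - cos (t / 2) ^+ 2 by have := cos2Dsin2 (t / 2); lra.
split; [by rewrite cs; ring| |by rewrite cs; ring].
have -> : 2 * (sgtau c t * (u * cos (t / 2)) * (sgtau c t * (u * sin (t / 2)))) =
  sgtau c t ^+ 2 * u ^+ 2 * (2 * (sin (t / 2) * cos (t / 2))) by ring.
by rewrite s2 u2 mul1r.
Qed.

(** The chart fixes the signs of w and [rootA], or those of z and [rootB]; the other pair follows
    from w z = 2 [rootA] [rootB]. *)
Let quadrant : 0 <= w * A /\ 0 <= z * B.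
Proof.
have [_ AB _] := root_eqs; have wz : w * z = 2 * (A * B).
  by rewrite AB /w /z wz_chart// last_tube.
have A2 := sqr_ge0 A; have B2 := sqr_ge0 B.
rewrite /w /z /A /B in wz A2 B2 *; case: c dx wz A2 B2 => dc wz A2 B2.
  have w0 : 0 < wchart h true x by exact: wcoord_gt0 dc.
  have A0 : 0 <= rootA h true x by exact: sqrtr_ge0.
  split; first by apply: mulr_ge0 => //; exact: ltW.
  rewrite -(pmulr_rge0 _ w0) mulrA wz.
  have -> : 2 * (rootA h true x * rootB h true x) * rootB h true x = 2 * (rootA h true x *
    rootB h true x ^+ 2) by ring.
  by apply: mulr_ge0 => //; exact: mulr_ge0.
have z0 : 0 < zchart h false x by exact: zcoord_gt0 dc.
have B0 : 0 <= rootB h false x by exact: sqrtr_ge0.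
split; last by apply: mulr_ge0 => //; exact: ltW.
rewrite -(pmulr_rge0 _ z0) mulrCA mulrA wz.
have -> : 2 * (rootA h false x * rootB h false x) * rootA h false x = 2 * (rootA h false x ^+ 2 *
  rootB h false x) by ring.
by apply: mulr_ge0 => //; exact: mulr_ge0.
Qed.

Let w_le : `|w| <= expC1 * u /\ `|z| <= expC1 * u.
Proof.
have C1 := expC1_ge1; have wzr := tube_wz_le Eq _ dx; rewrite hyp -/w -/z in wzr.
have {}wzr : w ^+ 2 + z ^+ 2 <= expC1 ^+ 2 * u ^+ 2.
  rewrite (le_trans (wzr re))// u2 ler_pM2r// expr2 ler_peMr// (le_trans ler01)//.
have C0 : 0 <= expC1 * u by rewrite mulr_ge0 ?(ltW u0) ?(le_trans ler01).
have := sqr_ge0 w; have := sqr_ge0 z => z2 w2.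
by split; apply: sqr_le_norm => //; rewrite exprMn; lra.
Qed.

Lemma re_sB : complex.Re (sB h c x) = - ((g * A) ^+ 3 - 3 * (g * A) * (g * B) ^+ 2) / (3 * k).
Proof.
rewrite /sB /= foot_tube ?cos_abs_lt// /Bcoef -/k -/g -/A -/B.
have -> : (g * A) ^+ 3 - 3 * (g * A) * (g * B) ^+ 2 = g ^+ 2 * g * (A ^+ 3 - 3 * A *
  B ^+ 2) by ring.
by rewrite g2; field; rewrite gt_eqF.
Qed.

(** [same_quadrant] for k w + i z and g A + i g B, whose squares have the same imaginary part: the
    squared distance times 2 k r is at most expC5^2 r^4. Then 1 / k <= H and H >= 1 give the
    constant. *)
Lemma root_dist : `|(k * w) - g * A| <= expC5 * H * u ^+ 3 /\ `|z - g * B| <= expC5 * H * u ^+ 3.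
Proof.
have [AB2 AB ABr] := root_eqs; have [wA zB] := quadrant.
have wz : w * z = 2 * (A * B) by rewrite AB /w /z wz_chart// last_tube.
have g0 : 0 <= g by exact: sqrtr_ge0.
have p1 : 0 <= k * w * (g * A) by rewrite mulrACA; apply: mulr_ge0 => //; apply: mulr_ge0 => //;
  exact: ltW.
have p2 : 0 <= z * (g * B) by rewrite mulrCA; apply: mulr_ge0.
have im : k * w * z = g * A * (g * B).
  by rewrite -mulrA wz mulrACA -expr2 g2; ring.
have := same_quadrant p1 p2 im erefl.
have -> : (g * A) ^+ 2 - (g * B) ^+ 2 = 2 * k * (r * cos t) by rewrite !exprMn -mulrBr AB2 g2.
have -> : (g * A) ^+ 2 + (g * B) ^+ 2 = 2 * k * r by rewrite !exprMn -mulrDr ABr g2.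
set P := (k * w - g * A) ^+ 2; set Q := (z - g * B) ^+ 2.
have := re_square_dist Eq _ dx; rewrite hyp => /(_ re); rewrite -/w -/z -/k => dd PQ.
have P0 : 0 <= P by exact: sqr_ge0.
have Q0 : 0 <= Q by exact: sqr_ge0.
have d2 : (P + Q) * (2 * k * r) <= expC5 ^+ 2 * r ^+ 4.
  apply: (le_trans PQ); rewrite (_ : expC5 ^+ 2 * r ^+ 4 = (expC5 * r ^+ 2) ^+ 2); last by ring.
  rewrite -[leLHS]real_normK ?num_real// lerXn2r ?nnegrE//.
  by apply: mulr_ge0 (sqr_ge0 r); exact: C5_ge0.
have kH : H^-1 <= k by exact: bnorm_ge.
have PQr : P + Q <= expC5 ^+ 2 * H * r ^+ 3.
  rewrite -(ler_pM2r r0) -[leRHS]mulrA -exprSr.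
  have Hk : 1 <= H * (2 * k).
    have : 1 <= H * k by rewrite mulrC -ler_pdivrMr// mul1r.
    by have := ltW k0; lra.
  apply: (@le_trans _ _ (H * ((P + Q) * (2 * k * r)))).
    have -> : H * ((P + Q) * (2 * k * r)) = (H * (2 * k)) * ((P + Q) * r) by ring.
    by rewrite ler_peMl// mulr_ge0 ?(ltW r0)// addr_ge0.
  have -> : expC5 ^+ 2 * H * r ^+ 4 = H * (expC5 ^+ 2 * r ^+ 4) by ring.
  by rewrite ler_pM2l.
have PQu : P + Q <= (expC5 * H * u ^+ 3) ^+ 2.
  apply: (le_trans PQr); rewrite -u2 (_ : (expC5 * H * u ^+ 3) ^+ 2 = H * (expC5 ^+ 2 * H *
    (u ^+ 2) ^+ 3)); last by ring.
  apply: ler_peMl => //; apply: mulr_ge0; last by apply: exprn_ge0; exact: sqr_ge0.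
  by apply: mulr_ge0 (sqr_ge0 _) (ltW H0).
have D0 : 0 <= expC5 * H * u ^+ 3.
  by apply: mulr_ge0; [apply: mulr_ge0 C5_ge0 (ltW H0)|apply: exprn_ge0; exact: ltW].
by split; apply: sqr_le_norm => //; rewrite -/P -/Q; lra.
Qed.

(** Two errors of order u^5 meet: r^2 |w| from [fchart_main], and M^2 times the distance of order
    u^3 between the roots from [re_cube_dist]. *)
Lemma fchart_cubic : `|fchart h c x - complex.Re (sB h c x)| <= expC6 * u ^+ 5.
Proof.
have C1 := expC1_ge1.
have [wC zC] := w_le; have [dA dB] := root_dist; have [AB2 AB ABr] := root_eqs.
have km : k <= m^-1 by exact: bnorm_le.
(* A common bound for the four numbers in the cubes: |k w| <= m^-1 expC1 u, |z| <= expC1 u, and g A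
   + i g B has modulus sqrt (2 k) u. *)
pose M := 2 * m^-1 * expC1 * u.
have uC : expC1 * u <= M.
  rewrite /M -mulrA; apply: ler_peMl; first by apply: mulr_ge0 (ltW u0).
  by have := mi1; lra.
have M0 : 0 <= M by apply: (le_trans _ uC); apply: mulr_ge0 (ltW u0).
have D0 : 0 <= expC5 * H * u ^+ 3.
  by apply: mulr_ge0; [apply: mulr_ge0 C5_ge0 (ltW H0)|apply: exprn_ge0; exact: ltW].
have h1 : `|k * w| <= M.
  rewrite normrM (gtr0_norm k0) (@le_trans _ _ (m^-1 * (expC1 * u)))//.
    by apply: ler_pM => //; exact: ltW.
  have : 0 <= m^-1 * (expC1 * u) by apply: mulr_ge0 => //; apply: mulr_ge0 (ltW u0).
  by rewrite /M; lra.
have h2 : `|z| <= M by exact: le_trans uC.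
have gAB : (g * A) ^+ 2 + (g * B) ^+ 2 <= M ^+ 2.
  rewrite !(exprMn _ g) -mulrDr ABr g2 -u2 /M (exprMn _ (_ *
    expC1)) ler_pM ?sqr_ge0 ?mulr_ge0 ?(ltW k0)//.
  rewrite expr2; apply: (@le_trans _ _ (2 * m^-1)); first by rewrite ler_pM2l.
  have X1 : 1 <= 2 * m^-1 * expC1 by apply: mulr_ege1 => //; have := mi1; lra.
  apply: (@le_trans _ _ (2 * m^-1 * expC1)).
    by apply: ler_peMr => //; apply: mulr_ge0.
  by apply: ler_peMr => //; exact: le_trans X1.
have gA0 := sqr_ge0 (g * A); have gB0 := sqr_ge0 (g * B).
have h3 : `|g * A| <= M by apply: sqr_le_norm => //; lra.
have h4 : `|g * B| <= M by apply: sqr_le_norm => //; lra.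
have cube := re_cube_dist M0 D0 h1 h2 h3 h4 dA dB.
have main := fchart_main Eq _ dx; rewrite hyp in main; have {}main := main re.
rewrite -/w -/z -bnorm_sqr -/k in main.
have -> : fchart h c x - complex.Re (sB h c x) =
   (fchart h c x - (w * z ^+ 2 - k ^+ 2 * w ^+ 3 / 3)) -
   ((k * w) ^+ 3 - 3 * (k * w) * z ^+ 2 - ((g * A) ^+ 3 - 3 * (g * A) * (g * B) ^+ 2)) / (3 * k).
  by rewrite re_sB; field; rewrite gt_eqF.
apply: (le_trans (ler_normB _ _)).
have T1 : `|fchart h c x - (w * z ^+ 2 - k ^+ 2 * w ^+ 3 / 3)| <= expC4 * expC1 * u ^+ 5.
  apply: (le_trans main); rewrite -u2.
  have -> : expC4 * expC1 * u ^+ 5 = expC4 * (u ^+ 2) ^+ 2 * (expC1 * u) by ring.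
  by apply: ler_wpM2l => //; apply: mulr_ge0 (sqr_ge0 _).
rewrite /expC6 [X in _ <= X * _]mulrDl [leRHS]mulrDl lerD//.
have k3 : 0 < 3 * k by rewrite mulr_gt0.
rewrite normrM normfV (gtr0_norm k3) ler_pdivrMr//; apply: (le_trans cube).
have Hk : 1 <= H * k by rewrite mulrC -ler_pdivrMr// mul1r; exact: bnorm_ge.
have -> : H * (16 * m^-1 ^+ 2 * expC1 * expC5 * H) * expC1 * u ^+ 5 * (3 * k) =
  (H * k) * (12 * M ^+ 2 * (expC5 * H * u ^+ 3)).
  by rewrite /M; field; rewrite gt_eqF.
apply: ler_peMl => //; apply: mulr_ge0 => //; apply: mulr_ge0 => //; exact: sqr_ge0.
Qed.

(** This is the expansion with A = 0: |B| <= 2 / m bounds the leading term, and u <= 1 lets u^3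
    absorb u^5. *)
Lemma fchart_small : `|fchart h c x| <= expC7 * u ^+ 3.
Proof.
have u30 : 0 < u ^+ 3 by rewrite exprn_gt0.
have C60 : 0 <= expC6 * u ^+ 5 by exact: le_trans fchart_cubic.
have T1 : expC6 * u ^+ 5 <= expC6 * u ^+ 3.
  have : 0 <= expC6 by rewrite -(pmulr_lge0 _ (exprn_gt0 5 u0)).
  move=> C6; apply: ler_wpM2l => //; apply: ler_wiXn2l => //; exact: ltW.
have T2 : `|complex.Re (sB h c x)| <= 2 * m^-1 * u ^+ 3.
  rewrite sB_polar//= normrM.
  have -> : `|sgtau c t| = 1.
    by apply/eqP; rewrite -(@eqrXn2 _ 2)// expr1n real_normK ?num_real// (sgtau_sqr hpos Eq re dx).
  rewrite mul1r normrM -/u -[leRHS]mulr1 ler_pM//; last by rewrite ler_norml cos_geN1 cos_le1.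
  rewrite normrM (gtr0_norm u30) ler_pM2r// /Bcoef normrN -/k ger0_norm ?mulr_ge0 ?sqrtr_ge0//.
  have kk : 2 * k <= (2 * m^-1) ^+ 2.
    have := bnorm_le Eq; rewrite -/k => km; have := ler_wpM2l mi0 mi1.
    by rewrite mulr1 exprMn (expr2 m^-1) (_ : (2 : R) ^+ 2 = 4); [move: mi0; lra|ring].
  have := ler_wsqrtr kk; rewrite sqrtr_sqr ger0_norm ?mulr_ge0// => gm.
  by have := sqrtr_ge0 (2 * k); lra.
have -> : fchart h c x = (fchart h c x - complex.Re (sB h c x)) +
  complex.Re (sB h c x) by rewrite subrK.
apply: (le_trans (ler_normD _ _)); rewrite /expC7 mulrDl addrC lerD//.
exact: le_trans fchart_cubic T1.
Qed.
End Polar.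

Lemma nondegenerate_fchart : Z2_nondegenerate (L := ell_bundle h) (cplx h) (fchart h).
Proof.
have tubE q v : E q -> normal_vec E q v -> 0 < enorm v < eps ->
    exists t, q + v = tube_pt h q (enorm v * cos t) (enorm v * sin t).
  move=> Eq /(normal_vecP hpos _ Eq)[a [b ->]]; rewrite enorm_normal// => /andP[r0 _].
  have [t [aE bE]] := hypot_angle r0; exists t.
  by rewrite /tube_pt -aE -bE.
have pow (r : R) (k : nat) : 0 < r -> Num.sqrt r ^+ k = r `^ (k%:R / 2).
  move=> r0; rewrite -powR12_sqrt ?(ltW r0)// -powR_mulrn ?powR_ge0// -powRrM.
  by congr (_ `^ _); rewrite mulrC.
exists eps, (fun _ _ => 0), (sB h); split.
- exact: ellipsoid_tubular.
- split; first exact: half_power_zero.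
  exists expC7 => c q v Eq nv ve dx; have [t xE] := tubE q v Eq nv ve.
  have [v0 _] := andP ve; rewrite /= subr0 -pow// xE; rewrite xE in dx.
  exact: fchart_small.
- split; first exact: half_power_sB.
  exists expC6 => c q v Eq nv ve dx; have [t xE] := tubE q v Eq nv ve.
  have [v0 _] := andP ve; rewrite -pow// xE; rewrite xE in dx.
  exact: fchart_cubic.
- by [].
- by move=> c x; exact: sB_neq0.
Qed.
End Expansion.

(** * Expansion at infinity *)

Section Infinity.
Context {R : realType} {n : nat}.
Variable h : 'I_n -> R.
Hypothesis hpos : forall i, 0 < h i.
Hypothesis n2 : (2 <= n)%N.
Local Notation V := 'rV[R]_n.+1.
Implicit Types (x y q v : V) (c : bool).
Local Notation N := (lastcoord (R := R) (n := n)).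
Local Notation E := (ellipsoid h).

Lemma dot_le_quad x : dot x x <= hsup h * quad h x + N x ^+ 2.
Proof.
rewrite dotE lerD// mulr_sumr; apply: ler_sum => j _.
rewrite -expr2 mulrCA ler_peMr ?sqr_ge0// ler_pdivlMr ?h2_gt0// mul1r.
exact: le_hsup.
Qed.

Lemma ellipsoid_enorm x : E x -> enorm x <= 2 * hsup h.
Proof.
move=> /ellipsoidP[Q1 N0]; have H1 := hsup_ge1 h.
rewrite -(@ler_pXn2r _ 2) ?nnegrE ?sqrtr_ge0 ?mulr_ge0 ?(ltW (hsup_gt0 h))//.
rewrite enorm_sqr (le_trans (dot_le_quad x))// Q1 N0 expr0n/= addr0 mulr1.
by nra.
Qed.

Lemma far_dot x : 2 * hsup h < enorm x -> 4 * hsup h < dot x x.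
Proof.
move=> xl; have H1 := hsup_ge1 h; rewrite -enorm_sqr.
have : (2 * hsup h) ^+ 2 < enorm x ^+ 2.
  by rewrite ltr_pXn2r ?nnegrE ?sqrtr_ge0// mulr_ge0// ltW// hsup_gt0.
by nra.
Qed.

(** The closed disc lies within this radius, so far away the chart with w > 0 is everything and its
    function is the single-valued branch. *)
Lemma far_chart x : 2 * hsup h < enorm x -> chart_dom h true x.
Proof.
move=> /far_dot xl; have [N0|N0] := eqVneq (N x) 0; [right|by left].
have := dot_le_quad x; rewrite N0 expr0n/= addr0 => xq.
have H0 := hsup_gt0 h; rewrite -(ltr_pM2l H0) mulr1 (lt_le_trans _ xq)//.
by lra.
Qed.

(** Every denominator in the ellipsoidal equation is at most hsup + w^2, so |x|^2 / (hsup + w^2) <=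
    1. *)
Lemma wcoord_far x : 0 < wcoord h x -> dot x x <= hsup h + wcoord h x ^+ 2.
Proof.
have [_ _] := wcoordP hpos x; set w := wcoord h x => wN w0.
have w20 : 0 < w ^+ 2 by rewrite exprn_gt0.
have H0 := hsup_gt0 h; have Hw : 0 < hsup h + w ^+ 2 by rewrite addr_gt0.
rewrite -(@ler_pM2r _ (w ^+ 2 / (hsup h + w ^+ 2))) ?divr_gt0//.
rewrite [leRHS]mulrC divfK ?gt_eqF//.
have wE : w ^+ 2 = N x ^+ 2 + \sum_(i < n) w ^+ 2 * (hcoord x i ^+ 2 / (h i ^+ 2 + w ^+ 2)).
  by rewrite -wN -mulr_sumr /level; ring.
rewrite [leRHS]wE dotE mulrDl addrC lerD//.
  by rewrite -expr2 ler_piMr ?sqr_ge0// ler_pdivrMr// mul1r lerDr ltW.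
rewrite mulr_suml; apply: ler_sum => i _.
rewrite -expr2 mulrCA ler_wpM2l ?(ltW w20)// ler_wpM2l ?sqr_ge0//.
by rewrite lef_pV2 ?posrE ?hw_gt0// lerD2r le_hsup.
Qed.

Lemma wcoord_far_half x : 2 * hsup h < enorm x -> enorm x / 2 <= wcoord h x.
Proof.
move=> xl; have w0 := wcoord_gt0 hpos (far_chart xl).
have := wcoord_far w0; have := far_dot xl; rewrite -enorm_sqr => f1 f2.
rewrite -(@ler_pXn2r _ 2) ?nnegrE ?divr_ge0 ?sqrtr_ge0 ?(ltW w0)//.
by nra.
Qed.

Lemma enorm_far_le x : 2 * hsup h < enorm x -> dot x x <= 4 * wcoord h x ^+ 2.
Proof.
move=> xl; have := wcoord_far_half xl; rewrite -enorm_sqr => H.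
have : (enorm x / 2) ^+ 2 <= wcoord h x ^+ 2.
  by rewrite lerXn2r// nnegrE ?wcoord_ge0// divr_ge0 ?sqrtr_ge0.
by lra.
Qed.

(** The difference consists of the tails of the integrals and of the boundary term. With e = w^(1 -
    n) as unit and |x|^2 <= 4 w^2, the constant collects 1 from [wt0], 4 from the x_i^2, 1 from the
    boundary term and 4 n from x_n^2. *)
Lemma fchart_far_error x : 2 * hsup h < enorm x ->
  `|fchart h true x - (a_zero h - (\sum_(i < n) a_coef h i * hcoord x i ^+ 2
     + a_last h * N x ^+ 2))| <= hprod2 h * (6 + 4 * n%:R) * (wcoord h x ^+ n.-1)^-1.
Proof.
move=> xl; have dx := far_chart xl; have w0 := wcoord_gt0 hpos dx.
have d4 := enorm_far_le xl; have c0 := hprod2_gt0 hpos.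
have n1 : n.-1.+1 = n by case: (n) n2.
rewrite /fchart /potential -[wchart h true x]/(wcoord h x); set w := wcoord h x in w0 d4 *.
set z := zchart h true x.
have wz : w * z = N x by exact: wz_chart hpos true x.
have z1 : z ^+ 2 <= 1 by rewrite -real_normK ?num_real// expr_le1// zchart_le1.
pose D0 := \int[lebesgue_measure]_(u in `[0, +oo[) wt0 h u - prim (wt0 h) w.
pose Di i := \int[lebesgue_measure]_(u in `[0, +oo[) wt h i u - prim (wt h i) w.
pose Dl := \int[lebesgue_measure]_(u in `[0, +oo[) wtlast h u - prim (wtlast h) w.
have -> : hprod2 h * (prim (wt0 h) w - \sum_(i < n) hcoord x i ^+ 2 * prim (wt h i) w +
    N x * z * wt0 h w + N x ^+ 2 * prim (wtlast h) w) -
    (a_zero h - (\sum_(i < n) a_coef h i * hcoord x i ^+ 2 + a_last h * N x ^+ 2)) =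
    hprod2 h * (- D0 + \sum_(i < n) hcoord x i ^+ 2 * Di i + N x * z * wt0 h w - N x ^+ 2 * Dl).
  have -> : \sum_(i < n) a_coef h i * hcoord x i ^+ 2 = hprod2 h * \sum_(i < n) hcoord x i ^+ 2 *
    (Di i + prim (wt h i) w).
    by rewrite mulr_sumr; apply: eq_bigr => i _; rewrite /a_coef -/(hprod2 h) /Di subrK; ring.
  have -> : \sum_(i < n) hcoord x i ^+ 2 * (Di i + prim (wt h i) w) =
      \sum_(i < n) hcoord x i ^+ 2 * Di i + \sum_(i < n) hcoord x i ^+ 2 * prim (wt h i) w.
    by rewrite -big_split; apply: eq_bigr => i _; rewrite mulrDr.
  have -> : a_zero h = hprod2 h * (D0 + prim (wt0 h) w) by rewrite /D0 subrK.
  have -> : a_last h = - (hprod2 h * (Dl + prim (wtlast h) w)) by rewrite /Dl subrK.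
  by ring.
have B0 := prim_wt0_tail hpos n2 w0; have Bi i := prim_wt_tail hpos n2 i w0.
have Bl := prim_wtlast_tail hpos n2 w0.
rewrite -/D0 in B0; rewrite -/Dl in Bl.
have {}Bi i : 0 <= Di i <= (w ^+ n.+1)^-1 by exact: Bi.
rewrite normrM (gtr0_norm c0) -[leRHS]mulrA ler_wpM2l ?(ltW c0)//.
set e := (w ^+ n.-1)^-1; have e0 : 0 < e by rewrite invr_gt0 exprn_gt0.
have en : (w ^+ n.+1)^-1 * w ^+ 2 = e.
  rewrite /e -{1}n1 -addn2 exprD invfM -mulrA mulVf ?mulr1//.
  by rewrite expf_neq0// gt_eqF.
have S1 : 0 <= \sum_(i < n) hcoord x i ^+ 2 * Di i <= 4 * e.
  apply/andP; split.
    by apply: sumr_ge0 => i _; rewrite mulr_ge0 ?sqr_ge0//; case/andP: (Bi i).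
  apply: (@le_trans _ _ (\sum_(i < n) hcoord x i ^+ 2 * (w ^+ n.+1)^-1)).
    by apply: ler_sum => i _; rewrite ler_wpM2l ?sqr_ge0//; case/andP: (Bi i).
  rewrite -mulr_suml -en mulrCA [leRHS]mulrC ler_wpM2r ?invr_ge0 ?exprn_ge0 ?(ltW w0)//.
  apply: le_trans d4; rewrite dotE lerDl -expr2 sqr_ge0//.
have S1' : \sum_(i < n) hcoord x i ^+ 2 * Di i <= 4 * e by case/andP: S1.
have T1 : `|N x * z * wt0 h w| <= e.
  rewrite normrM (gtr0_norm (wt0_gt0 hpos w)) -wz -mulrA -expr2 normrM (gtr0_norm w0).
  rewrite (ger0_norm (sqr_ge0 z)) (@le_trans _ _ (w * 1 * (w ^+ n)^-1))//.
    apply: ler_pM; [|exact: ltW (wt0_gt0 hpos w)| |exact: wt0_tail].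
      by rewrite mulr_ge0 ?sqr_ge0// ltW.
    by rewrite ler_wpM2l// ltW.
  by rewrite mulr1 /e -{1}n1 exprS invfM mulrA divff ?mul1r// gt_eqF.
have T2 : 0 <= N x ^+ 2 * Dl <= 4 * n%:R * e.
  have /andP[l0 l1] := Bl; rewrite mulr_ge0 ?sqr_ge0//=.
  apply: (@le_trans _ _ (N x ^+ 2 * (n%:R * (w ^+ n.+1)^-1))); first by rewrite ler_wpM2l ?sqr_ge0.
  rewrite mulrCA -mulrA (mulrCA 4) ler_wpM2l// -en mulrCA [leRHS]mulrC ler_wpM2r ?invr_ge0
    ?exprn_ge0 ?(ltW w0)//.
  apply: le_trans d4; rewrite dotE -expr2 lerDr sumr_ge0// => i _.
  by rewrite -expr2 sqr_ge0.
move: S1 T1 T2 B0; rewrite ler_norml -/e => /andP[s0 s1] /andP[t0 t1] /andP[u0 u1] /andP[v0 v1].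
rewrite ler_norml; apply/andP; split; lra.
Qed.

Lemma fchart_asymptotics : exists C, forall x, 2 * hsup h < enorm x ->
  `|fchart h true x - (a_zero h - (\sum_(i < n) a_coef h i * hcoord x i ^+ 2
     + a_last h * N x ^+ 2))| <= C * enorm x ^ (2 - (n.+1)%:Z).
Proof.
exists (hprod2 h * (6 + 4 * n%:R) * 2 ^+ n.-1) => x xl.
have x0 : 0 < enorm x by rewrite (lt_trans _ xl)// mulr_gt0// hsup_gt0.
(* The dimension is n + 1, so the exponent is -(n - 1); the factor 2^(n - 1) in the witness comes
   from w >= |x| / 2. *)
have -> : 2 - (n.+1)%:Z = - (n.-1)%:Z.
  case: (n) n2 => [//|[//|m]] _ /=.
  by rewrite -[m.+3]/(2 + m.+1)%N PoszD opprD addrA subrr add0r.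
rewrite -exprz_inv; apply: (le_trans (fchart_far_error xl)).
rewrite -[leRHS]mulrA ler_wpM2l//.
  by rewrite mulr_ge0 ?(ltW (hprod2_gt0 hpos))// addr_ge0// mulr_ge0.
rewrite -exprnP -exprMn -[X in X <= _]exprVn lerXn2r ?nnegrE ?invr_ge0 ?wcoord_ge0//.
  by rewrite mulr_ge0// invr_ge0 ltW.
rewrite -[leRHS]invrK lef_pV2 ?posrE ?(wcoord_gt0 hpos (far_chart xl))//.
  by rewrite invfM invrK mulrC wcoord_far_half.
by rewrite invr_gt0 mulr_gt0// invr_gt0.
Qed.

Lemma fchart_branch : single_valued_branch (L := ell_bundle h) (fchart h)
  [set x | 2 * hsup h < enorm x] (fchart h true).
Proof.
(* The parallel section is the transition function from the chart that covers the whole region. *)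
exists (fun c x => ell_trans true c x).
  split=> /=.
  - by move=> c x xl dc; apply: ell_trans_sign (far_chart xl) dc.
  - move=> c x xl dc; apply: filterS (ell_trans_loc_const (far_chart xl) dc) => y yE _ _.
    exact: yE.
  - move=> i j x xl di dj; have dt := far_chart xl.
    rewrite -(ell_trans_cocycle dt dj di) mulrC; congr (_ * _).
    by rewrite /ell_trans eq_sym.
by move=> c x xl dc; exact: fchart_section (far_chart xl) dc.
Qed.
End Infinity.

(* the ambient space has dimension n.+1 *)
Theorem theorem1p1 (R : realType) (n : nat) (h : 'I_n -> R)
    (hn : (3 <= n.+1)%N) (hpos : forall i, 0 < h i) :
  exists (J : 'rV[R]_n.+1 -> 'M[R]_n.+1)
         (L : flat_line_bundle (~` ellipsoid h))
         (f : chart L -> 'rV[R]_n.+1 -> R),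
    [/\ Z2_harmonic J f,
        Z2_nondegenerate J f &
        exists (rho C : R) (F : 'rV[R]_n.+1 -> R),
          [/\ forall x, ellipsoid h x -> enorm x <= rho,
              single_valued_branch f [set x | rho < enorm x] F &
              forall x, rho < enorm x ->
                `|F x - (a_zero h - (\sum_(i < n) a_coef h i * hcoord x i ^+ 2
                                    + a_last h * lastcoord x ^+ 2))|
                <= C * enorm x ^ (2 - (n.+1)%:Z)]].
Proof.
have n2 : (2 <= n)%N by [].
exists (cplx h), (ell_bundle h), (fchart h); split.
- exact: Z2_harmonic_fchart.
- exact: nondegenerate_fchart.
have [C fC] := fchart_asymptotics hpos n2.
exists (2 * hsup h), C, (fchart h true); split=> //.
- exact: ellipsoid_enorm.
- exact: fchart_branch.
Qed.
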